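(* Let $\mathbb{K}$ be a field and let $\Gamma$ be a Dynkin tree. If either $\Gamma=A_n$ (and $\mathbb{K}$ is arbitrary), or $\Gamma=D_n$ and $\mathrm{char}\,\mathbb{K}\neq 2$, then there is a quasi-isomorphism of DG-algebras $$\mathscr{B}_\Gamma\simeq\mathscr{G}_\Gamma .$$
   Context: Let $\Gamma$ be a finite tree with vertex set $\Gamma_0$. Choose a root and orient all edges away from the root; $\Gamma_1$ is the resulting set of arrows, and $g_{wv}$ denotes an arrow from $v$ to $w$. Let $\mathrm{k}=\bigoplus_{v\in\Gamma_0}\mathbb{K}e_v$ with $e_v^2=e_v$, $e_ve_w=0$ for $v\ne w$. Paths are multiplied from right to left. All DG-algebras are cohomologically graded (differential of degree $+1$) and satisfy the graded Leibniz rule $d(a_2a_1)=(da_2)a_1+(-1)^{|a_2|}a_2(da_1)$. Ginzburg DG-algebra $\mathscr{G}_\Gamma$: let $\widehat\Gamma$ be the quiver with vertices $\Gamma_0$ and arrows: the arrows $g\in\Gamma_1$ in bidegree $(1,-1)$; the opposite arrows $g^*$, $g\in\Gamma_1$, in bidegree $(1,-1)$; loops $h_v$ at each $v\in\Gamma_0$ in bidegree $(1,-2)$. Then $\mathscr{G}_\Gamma$ is the path algebra $\mathbb{K}\widehat\Gamma$ over $\mathrm{k}$ with the $\mathrm{k}$-linear derivation $d$ of bidegree $(1,0)$ given by $dg=dg^*=0$ and $dh=\sum_{g\in\Gamma_1}(g^*g-gg^* )$, where $h=\sum_v h_v$. In a bidegree $(r,s)$, $r$ is the path length, $s$ the internal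 degree, and the DG-algebra degree is the total degree $r+s$. $\mathscr{B}_\Gamma=LCA^*(\Lambda_\Gamma)$ is the cohomologically graded Chekanov–Eliashberg (Legendrian cohomology) DG-algebra of the Legendrian link $\Lambda_\Gamma=\bigcup_v\Lambda_v$ in standard form whose components are Legendrian unknots linked (plumbed) according to $\Gamma$; it is a model for the wrapped Floer algebra of the cocores in the plumbing of copies of $T^*S^2$ according to $\Gamma$. Explicitly: fix a linear order on the set of children of each vertex (from a planar embedding of the rooted tree). $\mathscr{B}_\Gamma$ is the tensor algebra over $\mathrm{k}$ on generators $c_v=e_vc_ve_v$ ($v\in\Gamma_0$) of degree $-1$ and $c_{wv}=e_wc_{wv}e_v$, $c_{vw}=e_vc_{vw}e_w$ of degree $0$ for every pair of adjacent vertices $v,w$. Its differential $D$ satisfies $Dc_{wv}=0$ for all adjacent $v,w$ and $$D(c_v)=-\sum_{u:\ g_{vu}\in\Gamma_1}c_{vu}c_{uv}+\sum_{i\ge1}\ \sum_{\substack{w_1<\cdots<w_i\\ g_{w_jv}\in\Gamma_1}}c_{vw_1}c_{w_1v}\cdots c_{vw_i}c_{w_iv},$$ extended by the graded Leibniz rule. *)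

(* Defs.v *)
From HB Require Import structures.
From mathcomp Require Import all_boot all_order all_algebra finmap.
From mathcomp.multinomials Require Import monalg.

Set Implicit Arguments.
Unset Strict Implicit.
Unset Printing Implicit Defensive.

Import GRing.Theory.
Local Open Scope ring_scope.

HB.lock Definition linext (K : fieldType) (B : choiceType) (W : lmodType K)
    (h : B -> W) (x : {malg K[B]}) : W :=
  \sum_(b <- msupp x) x@_b *: h b.

Section LinearExtension.
Context (K : fieldType) (B : choiceType) (W : lmodType K).
Implicit Types (h : B -> W) (x y : {malg K[B]}).
Local Notation linext := (@linext K B W).

Lemma linextE h x : linext h x = \sum_(b <- msupp x) x@_b *: h b.
Proof. by rewrite linext.unlock. Qed.

Lemma linextEw h (E : {fset B}) x :
  (msupp x `<=` E)%fset -> linext h x = \sum_(b <- E) x@_b *: h b.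
Proof.
move=> le; rewrite linext.unlock [LHS](big_fset_incl _ le) => //= b _ /mcoeff_outdom ->.
by rewrite scale0r.
Qed.

Lemma linextU h b : linext h << b >> = h b.
Proof. by rewrite (linextEw _ msuppU_le) big_seq_fset1 mcoeffUU scale1r. Qed.

Lemma linext_is_linear h : linear (linext h).
Proof.
move=> c x y; pose E := (msupp x `|` msupp y)%fset.
have xE : (msupp x `<=` E)%fset by apply: fsubsetUl.
have yE : (msupp y `<=` E)%fset by apply: fsubsetUr.
have zE : (msupp (c *: x + y) `<=` E)%fset.
  apply: fsubset_trans (msuppD_le _ _) _.
  by rewrite fsubUset yE (fsubset_trans (msuppZ_le _ _) xE).
rewrite !(linextEw _ xE, linextEw _ yE, linextEw _ zE) scaler_sumr -big_split /=.
by apply: eq_bigr => b _; rewrite mcoeffD mcoeffZ scalerDl scalerA.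
Qed.

HB.instance Definition _ h :=
  GRing.isLinear.Build K {malg K[B]} W *:%R (linext h) (linext_is_linear h).

Lemma malg_basisE x : x = \sum_(b <- msupp x) x@_b *: << b >>.
Proof.
rewrite {1}[x]monalgE; apply: eq_bigr => b _; apply/malgP => k.
by rewrite mcoeffZ !mcoeffU mulr_natr.
Qed.

Lemma malg_linearP (f g : {linear {malg K[B]} -> W}) :
  (forall b, f << b >> = g << b >>) -> f =1 g.
Proof.
move=> fg x; rewrite [x]malg_basisE !linear_sum.
by apply: eq_bigr => b _; rewrite !linearZ /= fg.
Qed.

Lemma malg_ind (P : {malg K[B]} -> Prop) :
  (forall c x y, P x -> P y -> P (c *: x + y)) -> P 0 ->
  forall x, (forall b, b \in msupp x -> P << b >>) -> P x.
Proof.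
move=> PD P0 x Px; rewrite [x]malg_basisE.
rewrite big_seq; elim/big_rec: _ => [//|b y bx Py].
by apply: PD => //; apply: Px.
Qed.

End LinearExtension.

(* The vertex [qpoint] only records that the quiver is nonempty, so that its
   path algebra is a nonzero ring. *)
Record quiver := Quiver {
  qvert : finType;
  qarr : finType;
  qsrc : qarr -> qvert;
  qtgt : qarr -> qvert;
  qpoint : qvert }.

Section Paths.
Context (Q : quiver).
Implicit Types (v w : qvert Q) (a : qarr Q) (s : seq (qarr Q)).

(* Paths are written as they are multiplied, from right to left: the word
   [:: a_n; ...; a_1] is the path that traverses a_1 first.  [walk v s] says
   that s is a path ending at v, and [wsrc v s] is its starting point. *)
Fixpoint walk v s : bool :=
  if s is a :: s' then (qtgt a == v) && walk (qsrc a) s' else true.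

Fixpoint wsrc v s : qvert Q :=
  if s is a :: s' then wsrc (qsrc a) s' else v.

Lemma walk_cat v s1 s2 : walk v (s1 ++ s2) = walk v s1 && walk (wsrc v s1) s2.
Proof. by elim: s1 v => //= a s1 IH v; rewrite IH andbA. Qed.

Lemma wsrc_cat v s1 s2 : wsrc v (s1 ++ s2) = wsrc (wsrc v s1) s2.
Proof. by elim: s1 v => //=. Qed.

(* The first component is the end point, so that (v, [::]) is the lazy path. *)
Definition qpath : Type := {p : qvert Q * seq (qarr Q) | walk p.1 p.2}.
HB.instance Definition _ := SubChoice.on qpath.

Definition ptgt (p : qpath) : qvert Q := (val p).1.
Definition pword (p : qpath) : seq (qarr Q) := (val p).2.
Definition psrc (p : qpath) : qvert Q := wsrc (ptgt p) (pword p).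

Definition plazy v : qpath := exist _ (v, [::]) isT.

Fact parrow_subproof a : walk (qtgt a) [:: a].
Proof. by rewrite /= eqxx. Qed.
Definition parrow a : qpath := exist _ (qtgt a, [:: a]) (parrow_subproof a).

Definition pcat (p q : qpath) : option qpath :=
  if psrc p == ptgt q then insub (ptgt p, pword p ++ pword q) else None.

Lemma qpathP (p q : qpath) : ptgt p = ptgt q -> pword p = pword q -> p = q.
Proof.
by case: p q => [[v s] ?] [[w t] ?]; rewrite /ptgt /pword /= => ? ?; apply: val_inj => /=; congr pair.
Qed.

Lemma pwalk (p : qpath) : walk (ptgt p) (pword p).
Proof. exact: valP p. Qed.

Variant pcat_spec (p q : qpath) : option qpath -> Type :=
| PcatSome r of psrc p = ptgt q & ptgt r = ptgt p & pword r = pword p ++ pword q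
    & psrc r = psrc q : pcat_spec p q (Some r)
| PcatNone of psrc p != ptgt q : pcat_spec p q None.

Lemma pcatP p q : pcat_spec p q (pcat p q).
Proof.
rewrite /pcat; case: eqP => [e|/eqP ?]; last by constructor.
have W : walk (ptgt p) (pword p ++ pword q).
  by rewrite walk_cat pwalk -/(psrc p) e pwalk.
rewrite (insubT (fun p : qvert Q * seq (qarr Q) => walk p.1 p.2) (x := (_, _)) W).
constructor => //.
by rewrite /psrc /ptgt /pword /= wsrc_cat -/(ptgt p) -/(pword p) -/(psrc p) e.
Qed.

End Paths.

Definition pathAlg (K : fieldType) (Q : quiver) : Type := {malg K[qpath Q]}.
HB.instance Definition _ K Q := GRing.Lmodule.on (pathAlg K Q).

HB.lock Definition pbase (K : fieldType) (Q : quiver) (p : qpath Q) : pathAlg K Q :=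
  << p >>.
Arguments pbase K {Q} p.

Definition pmul_base (K : fieldType) (Q : quiver) (p q : qpath Q) : pathAlg K Q :=
  if pcat p q is Some r then pbase K r else 0.

HB.lock Definition pmul (K : fieldType) (Q : quiver) (x y : pathAlg K Q) : pathAlg K Q :=
  linext (fun p => linext (pmul_base K p) y) x.

Section PathAlgebra.
Context (K : fieldType) (Q : quiver).
Implicit Types (v w : qvert Q) (a : qarr Q) (p q r : qpath Q).
Implicit Types (x y z : pathAlg K Q).
Local Notation pathAlg := (pathAlg K Q).
Local Notation pbase := (pbase K).
Local Notation pmul_base := (pmul_base K).
Local Notation pmul := (@pmul K Q).

Lemma pbaseU p : pbase p = << p >>.
Proof. by rewrite pbase.unlock. Qed.

Lemma mcoeff_pbase p q : (pbase p)@_q = (p == q)%:R.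
Proof. by rewrite pbaseU mcoeffU. Qed.

Lemma path_basisE x :
  x = \sum_(p <- msupp (x : {malg K[qpath Q]})) x@_p *: pbase p.
Proof.
by rewrite {1}[x]malg_basisE; apply: eq_bigr => p _; rewrite pbaseU.
Qed.

Definition pone : pathAlg := \sum_v pbase (plazy v).

Lemma pmulUU p q : pmul (pbase p) (pbase q) = pmul_base p q.
Proof. by rewrite pmul.unlock !pbaseU !linextU. Qed.

Lemma pmulDl : left_distributive pmul +%R.
Proof. by move=> x y z; rewrite pmul.unlock linearD. Qed.

Lemma pmulZl c x y : pmul (c *: x) y = c *: pmul x y.
Proof. by rewrite pmul.unlock linearZ. Qed.

Lemma pmulDr : right_distributive pmul +%R.
Proof.
move=> x y z; rewrite pmul.unlock !linextE -big_split /=; apply: eq_bigr => p _.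
by rewrite linearD scalerDr.
Qed.

Lemma pmulZr c x y : pmul x (c *: y) = c *: pmul x y.
Proof.
rewrite pmul.unlock !linextE scaler_sumr; apply: eq_bigr => p _.
by rewrite linearZ /= !scalerA mulrC.
Qed.

Lemma pmul0l y : pmul 0 y = 0.
Proof. by rewrite pmul.unlock linear0. Qed.

Lemma pmul0r x : pmul x 0 = 0.
Proof. by rewrite -[X in pmul x X](scale0r (0 : pathAlg)) pmulZr scale0r. Qed.

Lemma path_ind_supp (P : pathAlg -> Prop) :
  (forall c x y, P x -> P y -> P (c *: x + y)) -> P 0 ->
  forall x, (forall p, p \in msupp (x : {malg K[qpath Q]}) -> P (pbase p)) -> P x.
Proof.
move=> PD P0 x Px; apply: (malg_ind (P := P)) => // p px.
by rewrite -pbaseU; apply: Px.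
Qed.

Lemma path_ind (P : pathAlg -> Prop) :
  (forall c x y, P x -> P y -> P (c *: x + y)) -> P 0 ->
  (forall p, P (pbase p)) -> forall x, P x.
Proof. by move=> PD P0 Pb x; apply: path_ind_supp. Qed.

Lemma pmulLl c x y z : pmul (c *: x + y) z = c *: pmul x z + pmul y z.
Proof. by rewrite pmulDl pmulZl. Qed.

Lemma pmulLr c x y z : pmul z (c *: x + y) = c *: pmul z x + pmul z y.
Proof. by rewrite pmulDr pmulZr. Qed.

Lemma pmulA : associative pmul.
Proof.
move=> x y z.
elim/path_ind: x => [c x x' e e'||p].
- by rewrite (pmulLl c x x' y) (pmulLl c x x') (pmulLl c (pmul x y)) e e'.
- by rewrite (pmul0l y) (pmul0l z) (pmul0l (pmul y z)).
elim/path_ind: y => [c y y' e e'||q].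
- rewrite (pmulLl c y y' z) (pmulLr c (pmul y z)) e e'.
  by rewrite (pmulLr c y y') (pmulLl c (pmul _ y)).
- by rewrite (pmul0l z) (pmul0r (pbase p)) (pmul0l z).
elim/path_ind: z => [c z z' e e'||r].
- by rewrite (pmulLr c z z' (pbase q)) (pmulLr c (pmul _ z)) (pmulLr c z z') e e'.
- by rewrite (pmul0r (pbase q)) (pmul0r (pbase p)) (pmul0r (pmul _ _)).
rewrite !pmulUU /pmul_base.
case: (pcatP q r) => [qr e1 t1 w1 s1|n1]; case: (pcatP p q) => [pq e2 t2 w2 s2|n2];
  rewrite ?pmulUU ?pmul0l ?pmul0r // /pmul_base.
- case: pcatP => [u f1 g1 h1 k1|]; last by rewrite e2 t1 eqxx.
  case: pcatP => [u' f2 g2 h2 k2|]; last by rewrite s2 e1 eqxx.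
  by congr pbase; apply: qpathP; rewrite ?g1 ?g2 ?t2 // h1 h2 w1 w2 catA.
- by case: pcatP => // u; rewrite t1 => e; rewrite e eqxx in n2.
- by case: pcatP => // u; rewrite s2 => e; rewrite e eqxx in n1.
Qed.

Lemma plazy_mull v p :
  pmul (pbase (plazy v)) (pbase p) = if v == ptgt p then pbase p else 0.
Proof.
rewrite pmulUU /pmul_base; case: pcatP => [r e t w s|n].
  by rewrite [v]e eqxx; congr pbase; apply: qpathP; rewrite // t.
by rewrite (negPf n).
Qed.

Lemma plazy_mulr v p :
  pmul (pbase p) (pbase (plazy v)) = if psrc p == v then pbase p else 0.
Proof.
rewrite pmulUU /pmul_base; case: pcatP => [r e t w s|n].
  by rewrite e eqxx; congr pbase; apply: qpathP; rewrite // w cats0.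
by rewrite (negPf n).
Qed.

Lemma pmul1l : left_id pone pmul.
Proof.
move=> x; elim/path_ind: x => [c x y e e'||p].
- by rewrite (pmulLr c x y) e e'.
- exact: pmul0r.
rewrite /pone (big_morph (pmul^~ (pbase p)) (fun x y => pmulDl x y _) (pmul0l _)).
rewrite (bigD1 (ptgt p)) //= plazy_mull eqxx big1 ?addr0 // => v.
by rewrite plazy_mull => /negPf ->.
Qed.

Lemma pmul1r : right_id pone pmul.
Proof.
move=> x; elim/path_ind: x => [c x y e e'||p].
- by rewrite (pmulLl c x y) e e'.
- exact: pmul0l.
rewrite /pone (big_morph (pmul (pbase p)) (fun x y => pmulDr _ x y) (pmul0r _)).
rewrite (bigD1 (psrc p)) //= plazy_mulr eqxx big1 ?addr0 // => v.
by rewrite plazy_mulr eq_sym => /negPf ->.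
Qed.

Lemma pone_neq0 : pone != 0.
Proof.
apply/eqP => /(congr1 (mcoeff (plazy (qpoint Q)))) /eqP.
rewrite /pone raddf_sum (bigD1 (qpoint Q)) //= mcoeff_pbase eqxx big1.
  by rewrite addr0 mcoeff0 oner_eq0.
by move=> v nv; rewrite mcoeff_pbase; case: eqP => // /(congr1 (@ptgt Q)) e; rewrite [v]e eqxx in nv.
Qed.

HB.instance Definition _ :=
  GRing.Zmodule_isNzRing.Build pathAlg pmulA pmul1l pmul1r pmulDl pmulDr pone_neq0.

Fact pscalerAl (c : K) x y : c *: (x * y) = (c *: x) * y.
Proof. by rewrite -[RHS]/(pmul _ _) pmulZl. Qed.
HB.instance Definition _ := GRing.Lmodule_isLalgebra.Build K pathAlg pscalerAl.

Fact pscalerAr (c : K) x y : c *: (x * y) = x * (c *: y).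
Proof. by rewrite -[RHS]/(pmul _ _) pmulZr. Qed.
HB.instance Definition _ := GRing.Lalgebra_isAlgebra.Build K pathAlg pscalerAr.

Definition pvert v : pathAlg := pbase (plazy v).
Definition parr a : pathAlg := pbase (parrow a).

End PathAlgebra.

Arguments pvert {K Q} v.
Arguments parr {K Q} a.

(* DG-algebras over k = \bigoplus_(v : V) K e_v; [dg_homog i] is the part of
   degree i. *)
Record dgAlgebra (K : fieldType) (V : finType) := DGAlgebra {
  dg_alg :> algType K;
  dg_idem : V -> dg_alg;
  dg_idemM : forall v w,
    dg_idem v * dg_idem w = if v == w then dg_idem v else 0;
  dg_idem_sum : \sum_v dg_idem v = 1;
  dg_homog : int -> pred dg_alg;
  dg_homog_submod : forall i, submod_closed (dg_homog i);
  dg_homog_span : forall x : dg_alg, exists (r : seq int) (c : int -> dg_alg),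
    (forall i, dg_homog i (c i)) /\ x = \sum_(i <- r) c i;
  dg_homog_direct : forall (r : seq int) (c : int -> dg_alg), uniq r ->
    (forall i, dg_homog i (c i)) -> \sum_(i <- r) c i = 0 ->
    forall i, i \in r -> c i = 0;
  dg_homogM : forall i j x y,
    dg_homog i x -> dg_homog j y -> dg_homog (i + j) (x * y);
  dg_homog_idem : forall v, dg_homog 0 (dg_idem v);
  dg_d : {linear dg_alg -> dg_alg};
  dg_d_idem : forall v, dg_d (dg_idem v) = 0;
  dg_d_homog : forall i x, dg_homog i x -> dg_homog (i + 1) (dg_d x);
  dg_d_leibniz : forall i x y, dg_homog i x ->
    dg_d (x * y) = dg_d x * y + (-1 : K) ^ i *: (x * dg_d y);
  dg_dd : forall x, dg_d (dg_d x) = 0 }.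

Arguments dg_idem {K V} d v.
Arguments dg_homog {K V} d i x.
Arguments dg_d {K V} d.

Record dgHom (K : fieldType) (V : finType) (A B : dgAlgebra K V) := DGHom {
  dg_fun :> {lrmorphism A -> B};
  dg_fun_idem : forall v, dg_fun (dg_idem A v) = dg_idem B v;
  dg_fun_homog : forall i x, dg_homog A i x -> dg_homog B i (dg_fun x);
  dg_fun_d : forall x, dg_fun (dg_d A x) = dg_d B (dg_fun x) }.

Section Cohomology.
Context (K : fieldType) (V : finType).
Implicit Types (A B : dgAlgebra K V).

Definition cocycle A (i : int) (x : A) : Prop := dg_homog A i x /\ dg_d A x = 0.

(* x and y represent the same class in H^i. *)
Definition cohomologous A (i : int) (x y : A) : Prop :=
  exists2 z, dg_homog A (i - 1) z & x - y = dg_d A z.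

(* H^i(f) is injective, resp. surjective, for every i. *)
Definition quasi_iso A B (f : dgHom A B) : Prop :=
  forall i : int,
    (forall x x', cocycle i x -> cocycle i x' ->
       cohomologous i (f x) (f x') -> cohomologous i x x') /\
    (forall y, cocycle i y -> exists2 x, cocycle i x & cohomologous i (f x) y).

End Cohomology.

Fact leibniz_linl (K : fieldType) (A : algType K) (c s : K) (a a' q w z z' : A) :
  c *: (a * q + s *: (z * w)) + (a' * q + s *: (z' * w)) =
  (c *: a + a') * q + s *: ((c *: z + z') * w).
Proof.
rewrite !mulrDl -!scalerAl !scalerDr !scalerA [s * c]mulrC.
by rewrite addrACA.
Qed.

Fact leibniz_linr (K : fieldType) (A : algType K) (c s : K) (x d y y' e e' : A) :
  c *: (d * y + s *: (x * e)) + (d * y' + s *: (x * e')) =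
  d * (c *: y + y') + s *: (x * (c *: e + e')).
Proof.
rewrite !mulrDr -!scalerAr !scalerDr !scalerA [s * c]mulrC.
by rewrite addrACA.
Qed.

Section PathDG.
Context (K : fieldType) (Q : quiver) (deg : qarr Q -> int).
Context (d0 : qarr Q -> pathAlg K Q).
Local Notation A := (pathAlg K Q).
Implicit Types (v w : qvert Q) (a : qarr Q) (s : seq (qarr Q)) (p q : qpath Q).
Implicit Types (x y z : A).

Definition wdeg s : int := \sum_(a <- s) deg a.

Definition phomog (i : int) : pred A :=
  [pred x | all (fun p => wdeg (pword p) == i) (msupp (x : {malg K[qpath Q]}))].

Definition wprod s : A := \prod_(a <- s) parr a.

(* The graded Leibniz rule, read off the leftmost arrow. *)
Fixpoint wdiff s : A :=
  if s is a :: s' then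
    d0 a * wprod s' + (-1 : K) ^ (deg a) *: (parr a * wdiff s')
  else 0.

Definition pdiff x : A := linext (fun p => wdiff (pword p)) x.

HB.instance Definition _ := GRing.Linear.copy pdiff
  (linext (fun p => wdiff (pword p))).

Lemma pvertM v w : pvert v * pvert w = if v == w then pvert v else 0 :> A.
Proof. by rewrite [LHS]plazy_mull; case: eqP => [->|]. Qed.

Lemma pvert_sum : \sum_v pvert v = 1 :> A.
Proof. by []. Qed.

Lemma pvertl v p : pvert v * pbase K p = if v == ptgt p then pbase K p else 0.
Proof. exact: plazy_mull. Qed.

Lemma pvertr v p : pbase K p * pvert v = if psrc p == v then pbase K p else 0.
Proof. exact: plazy_mulr. Qed.

Lemma pvert_arr a : pvert (qtgt a) * parr a = parr a :> A.
Proof. by rewrite pvertl eqxx. Qed.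

Lemma parr_vert a : parr a * pvert (qsrc a) = parr a :> A.
Proof. by rewrite pvertr eqxx. Qed.

Lemma pbaseM p q : pbase K p * pbase K q = pmul_base K p q.
Proof. exact: pmulUU. Qed.

Lemma pbaseE p : pbase K p = pvert (ptgt p) * wprod (pword p).
Proof.
case: p => [[v s] W]; rewrite /ptgt /pword /=.
elim: s v W => [|a s IH] v W.
  by rewrite /wprod big_nil mulr1; congr pbase; apply: qpathP.
case/andP: (W) => /= /eqP av W'; subst v.
have := IH (qsrc a) W'; rewrite /wprod big_cons mulrA pvert_arr => E.
rewrite -{1}[parr a]parr_vert -mulrA -E pbaseM /pmul_base.
case: pcatP => [r e t w' _|]; last by rewrite eqxx.
by congr pbase; apply: qpathP; rewrite ?t ?w'.
Qed.

Lemma wprod_cat s1 s2 : wprod (s1 ++ s2) = wprod s1 * wprod s2.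
Proof. by rewrite /wprod big_cat. Qed.

Lemma wprod_base p : pword p != [::] -> pbase K p = wprod (pword p).
Proof.
rewrite pbaseE; move: (pwalk p); case: (pword p) => [|a s] //= /andP[/eqP <- _] _.
by rewrite /wprod big_cons mulrA pvert_arr.
Qed.

Lemma wdeg_cat s1 s2 : wdeg (s1 ++ s2) = wdeg s1 + wdeg s2.
Proof. by rewrite /wdeg big_cat. Qed.

Lemma phomogP i x :
  reflect (forall p, x@_p != 0 -> wdeg (pword p) = i) (phomog i x).
Proof.
apply: (iffP allP) => H p.
  by rewrite mcoeff_neq0 => /H /eqP.
by rewrite -mcoeff_neq0 => /H /eqP.
Qed.

Lemma phomog_submod i : submod_closed (phomog i).
Proof.
split; first by apply/phomogP => p; rewrite mcoeff0 eqxx.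
move=> c x y /phomogP hx /phomogP hy; apply/phomogP => p.
rewrite mcoeffD mcoeffZ; have [->|/hx //] := eqVneq x@_p 0.
by rewrite mulr0 add0r => /hy.
Qed.

Lemma phomog0 i : phomog i 0.
Proof. by case: (phomog_submod i). Qed.

Lemma phomogD i x y : phomog i x -> phomog i y -> phomog i (x + y).
Proof.
by move=> hx hy; rewrite -[x]scale1r; case: (phomog_submod i) => _; apply.
Qed.

Lemma phomogZ i c x : phomog i x -> phomog i (c *: x).
Proof.
move=> hx; rewrite -[c *: x]addr0.
by case: (phomog_submod i) => h0 hD; apply: hD.
Qed.

Lemma phomogB i x y : phomog i x -> phomog i y -> phomog i (x - y).
Proof. by move=> hx hy; rewrite -scaleN1r; apply/phomogD/phomogZ. Qed.

Lemma phomog_sum i I (r : seq I) (P : pred I) (F : I -> A) :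
  (forall j, P j -> phomog i (F j)) -> phomog i (\sum_(j <- r | P j) F j).
Proof. by move=> h; elim/big_ind: _ => //; [apply: phomog0|apply: phomogD]. Qed.

Lemma phomog_base p : phomog (wdeg (pword p)) (pbase K p).
Proof.
by apply/phomogP => q; rewrite mcoeff_pbase; case: (p =P q) => [->|] //; rewrite eqxx.
Qed.

Lemma phomog_vert v : phomog 0 (pvert v).
Proof. by have := phomog_base (plazy v); rewrite /wdeg /= big_nil. Qed.

Lemma phomog_arr a : phomog (deg a) (parr a).
Proof. by have := phomog_base (parrow a); rewrite /wdeg /= big_seq1. Qed.

Lemma phomogM i j x y : phomog i x -> phomog j y -> phomog (i + j) (x * y).
Proof.
move=> hx hy; rewrite [x]path_basisE [y]path_basisE mulr_suml.
rewrite big_seq; apply: phomog_sum => p px.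
rewrite mulr_sumr big_seq; apply: phomog_sum => q qy.
rewrite -scalerAl -scalerAr; do 2!apply: phomogZ.
have <- := eqP (allP hx _ px); have <- := eqP (allP hy _ qy).
rewrite pbaseM /pmul_base.
case: pcatP => [r _ _ w _|_]; last exact: phomog0.
by rewrite -wdeg_cat -w; apply: phomog_base.
Qed.

Lemma phomog_word s : phomog (wdeg s) (wprod s).
Proof.
rewrite /wprod /wdeg; elim: s => [|a s IH].
  by rewrite !big_nil -pvert_sum; apply: phomog_sum => v _; apply: phomog_vert.
by rewrite !big_cons; apply: phomogM => //; apply: phomog_arr.
Qed.

Definition pcomp x i : A :=
  \sum_(p <- msupp (x : {malg K[qpath Q]}) | wdeg (pword p) == i) x@_p *: pbase K p.

Lemma phomog_span x : exists (r : seq int) (c : int -> A),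
  (forall i, phomog i (c i)) /\ x = \sum_(i <- r) c i.
Proof.
pose S := msupp (x : {malg K[qpath Q]}).
exists (undup [seq wdeg (pword p) | p <- S]), (pcomp x); split=> [i|].
  by apply: phomog_sum => p /eqP <-; apply/phomogZ/phomog_base.
rewrite {1}[x]path_basisE /pcomp (exchange_big_dep xpredT) //=.
rewrite big_seq [RHS]big_seq; apply: eq_bigr => p px.
rewrite -big_filter (_ : [seq _ <- _ | _] = [:: wdeg (pword p)]) ?big_seq1 //.
apply: perm_small_eq => //; apply: uniq_perm; rewrite ?filter_uniq ?undup_uniq //.
move=> i; rewrite mem_filter mem_undup mem_seq1.
have [<-|ne] := eqVneq (wdeg (pword p)) i.
  by rewrite !eqxx (map_f (fun q => wdeg (pword q))).
by rewrite -[natsum_of_int _ == _]/(wdeg (pword p) == i) (negPf ne).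
Qed.

Lemma phomog_direct (r : seq int) (c : int -> A) : uniq r ->
  (forall i, phomog i (c i)) -> \sum_(i <- r) c i = 0 ->
  forall i, i \in r -> c i = 0.
Proof.
move=> ur hc s0 i ir; apply/malgP => p; rewrite mcoeff0.
apply/eqP; apply: contraT => np; have ei := phomogP _ _ (hc i) _ np.
have := congr1 (mcoeff p) s0; rewrite mcoeff0 raddf_sum (bigD1_seq i) //=.
rewrite big1_seq ?addr0 => [e|j /andP[ji _]]; first by rewrite e eqxx in np.
apply/eqP; apply: contraT => nj; have := phomogP _ _ (hc j) _ nj.
by rewrite ei => e; rewrite e eqxx in ji.
Qed.

Lemma pdiff_base p : pdiff (pbase K p) = wdiff (pword p).
Proof. by rewrite pbaseU [LHS]linextU. Qed.

Lemma pdiff_vert v : pdiff (pvert v) = 0.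
Proof. by rewrite pdiff_base. Qed.

Lemma pdiff_arr a : pdiff (parr a) = d0 a.
Proof. by rewrite pdiff_base /= /wprod big_nil mulr1 mulr0 scaler0 addr0. Qed.

Context (d0_tgt : forall a, pvert (qtgt a) * d0 a = d0 a).
Context (d0_src : forall a, d0 a * pvert (qsrc a) = d0 a).
Context (d0_homog : forall a, phomog (deg a + 1) (d0 a)).

Lemma wdiff_cat s1 s2 :
  wdiff (s1 ++ s2) =
  wdiff s1 * wprod s2 + (-1 : K) ^ (wdeg s1) *: (wprod s1 * wdiff s2).
Proof.
elim: s1 => [|a s1 IH] /=.
  by rewrite /wdeg /wprod !big_nil mul0r add0r expr0z scale1r mul1r.
rewrite IH wprod_cat mulrDr mulrDl scalerDr -addrA.
have -> : wprod (a :: s1) = parr a * wprod s1 by rewrite /wprod big_cons.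
have -> : wdeg (a :: s1) = deg a + wdeg s1 by rewrite /wdeg big_cons.
by rewrite (exprzDr (unitrN1 K)) -scalerAl -scalerAr scalerA !mulrA.
Qed.

Lemma wdiff_tgt p : pvert (ptgt p) * wdiff (pword p) = wdiff (pword p).
Proof.
move: (pwalk p); case: (pword p) => [|a s] /=; first by rewrite mulr0.
by case/andP=> /eqP <- _; rewrite mulrDr -scalerAr !mulrA d0_tgt pvert_arr.
Qed.

Lemma wdiff_src p : wdiff (pword p) * pvert (psrc p) = wdiff (pword p).
Proof.
rewrite /psrc; case: p => [[v s] W]; rewrite /ptgt /pword /=.
elim: s v W => [|a s IH] v /=; first by rewrite mul0r.
case/andP=> _ W; rewrite mulrDl -scalerAl -!mulrA IH //; congr (_ + _).
have := pbaseE (exist _ (qsrc a, s) W); rewrite /ptgt /pword /= => E.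
rewrite -{1}[d0 a]d0_src -{2}[d0 a]d0_src -!mulrA -E; congr (_ * _).
by rewrite mulrA -E pvertr eqxx.
Qed.

Lemma wdiffM p q :
  pdiff (pbase K p * pbase K q) = wdiff (pword p) * pbase K q
    + (-1 : K) ^ (wdeg (pword p)) *: (pbase K p * wdiff (pword q)).
Proof.
rewrite pbaseM /pmul_base; case: pcatP => [r e t w s|n].
  rewrite pdiff_base w wdiff_cat; congr (_ + _ *: _).
    by rewrite [pbase K q]pbaseE mulrA -e wdiff_src.
  have [p0|pn] := eqVneq (pword p) [::]; last by rewrite -wprod_base.
  rewrite [pbase K p]pbaseE p0 /wprod big_nil mulr1 mul1r.
  by rewrite -[in LHS]wdiff_tgt -e /psrc p0.
rewrite linear0 -[in RHS]wdiff_src -[X in _ *: (_ * X)]wdiff_tgt.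
by rewrite -mulrA pvertl (negPf n) mulr0 mulrA pvertr (negPf n) mul0r scaler0 addr0.
Qed.

Lemma pdiffD x y : pdiff (x + y) = pdiff x + pdiff y.
Proof. exact: linearD. Qed.

Lemma pdiffZ c x : pdiff (c *: x) = c *: pdiff x.
Proof. exact: linearZ. Qed.

Lemma pdiff_leibniz i x y : phomog i x ->
  pdiff (x * y) = pdiff x * y + (-1 : K) ^ i *: (x * pdiff y).
Proof.
move=> hx; elim/path_ind: y => [c y y' e e'||q].
- rewrite mulrDr -scalerAr pdiffD pdiffZ e e' pdiffD pdiffZ; exact: leibniz_linr.
- by rewrite mulr0 !linear0 !mulr0 scaler0 addr0.
rewrite pdiff_base.
apply: (path_ind_supp (P := fun z : A => pdiff (z * pbase K q) =
  pdiff z * pbase K q + (-1 : K) ^ i *: (z * wdiff (pword q)))).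
- move=> c z z' e e'; rewrite mulrDl -scalerAl pdiffD pdiffZ e e' pdiffD pdiffZ.
  exact: leibniz_linl.
- by rewrite !mul0r linear0 mul0r scaler0 addr0.
move=> p px; rewrite wdiffM pdiff_base (eqP (allP hx _ px)); reflexivity.
Qed.

Lemma wdiff_homog s : phomog (wdeg s + 1) (wdiff s).
Proof.
elim: s => [|a s IH] /=; first exact: phomog0.
rewrite /wdeg big_cons -/(wdeg s); apply: phomogD.
  rewrite addrAC; apply: phomogM => //; exact: phomog_word.
by apply: phomogZ; rewrite -addrA; apply: phomogM => //; apply: phomog_arr.
Qed.

Lemma pdiff_homog i x : phomog i x -> phomog (i + 1) (pdiff x).
Proof.
move=> hx; rewrite [x]path_basisE linear_sum /= big_seq.
apply: phomog_sum => p px; rewrite linearZ /=; apply: phomogZ.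
rewrite pdiff_base -(eqP (allP hx _ px)); exact: wdiff_homog.
Qed.

Lemma pdiff_word s : pdiff (wprod s) = wdiff s.
Proof.
elim: s => [|a s IH]; rewrite /wprod.
  by rewrite big_nil -pvert_sum linear_sum big1 // => v _; apply: pdiff_vert.
by rewrite big_cons (pdiff_leibniz _ (phomog_arr a)) pdiff_arr IH.
Qed.

Context (d0_closed : forall a, pdiff (d0 a) = 0).

Lemma pdiffK x : pdiff (pdiff x) = 0.
Proof.
elim/path_ind: x => [c x y e e'||p].
- by rewrite !(linearD, linearZ) /= e e' scaler0 addr0.
- by rewrite !linear0.
rewrite pdiff_base; elim: (pword p) => [|a s IH] /=; first by rewrite linear0.
rewrite linearD linearZ /= (pdiff_leibniz _ (d0_homog a)) d0_closed mul0r add0r.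
rewrite (pdiff_leibniz _ (phomog_arr a)) pdiff_arr IH mulr0 scaler0 addr0 pdiff_word.
by rewrite exprzDr ?unitrN1 // expr1z mulrN1 scaleNr addNr.
Qed.

Definition pathDG : dgAlgebra K (qvert Q) :=
  @DGAlgebra K (qvert Q) A pvert pvertM pvert_sum phomog phomog_submod
    phomog_span phomog_direct phomogM phomog_vert pdiff pdiff_vert pdiff_homog
    pdiff_leibniz pdiffK.

End PathDG.

Record rootedTree := RootedTree {
  tvert :> finType;
  tadj : rel tvert;
  tadj_sym : symmetric tadj;
  tadj_irr : irreflexive tadj;
  tree_connected : forall v w, connect tadj v w;
  tree_acyclic : forall c : seq tvert, (2 < size c)%N -> ~ ucycle tadj c;
  troot : tvert }.

Section RootedTree.
Context (T : rootedTree).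
Implicit Types (v w : T).

(* There is an arrow g_{wv} : v -> w iff v and w are adjacent and v lies on the
   root side of the edge, i.e. v can be reached from the root avoiding w. *)
Definition away v w : bool :=
  tadj v w &&
  connect [rel x y | [&& tadj x y, x != w & y != w]] (troot T) v.

(* Pairs are written like indices: (w, v) stands for the arrow from v to w. *)
Definition tarrow : finType := {p : T * T | away p.2 p.1}.
Definition tdart : finType := {p : T * T | tadj p.1 p.2}.

End RootedTree.

Record childOrder (T : rootedTree) := ChildOrder {
  child_lt :> T -> rel T;
  child_lt_irr : forall v, {in away v, irreflexive (child_lt v)};
  child_lt_trans : forall v, {in away v & &, transitive (child_lt v)};
  child_lt_total : forall v, {in away v &, forall w1 w2,
    w1 != w2 -> child_lt v w1 w2 || child_lt v w2 w1 } }.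

Section Ginzburg.
Context (K : fieldType) (T : rootedTree).

(* In this order: the arrows g, the opposite arrows g^*, the loops h_v. *)
Definition ginz_arr : finType := (tarrow T + tarrow T + T)%type.

Definition ginz_src (a : ginz_arr) : T :=
  match a with
  | inl (inl g) => (val g).2
  | inl (inr g) => (val g).1
  | inr v => v
  end.

Definition ginz_tgt (a : ginz_arr) : T :=
  match a with
  | inl (inl g) => (val g).1
  | inl (inr g) => (val g).2
  | inr v => v
  end.

Definition ginz_quiver : quiver := Quiver ginz_src ginz_tgt (troot T).

Definition ginz_bideg (a : ginz_arr) : int * int :=
  if a is inr _ then (1, - 2%:Z) else (1, - 1%:Z).

(* Internal degree -1 for g and g^*, -2 for h_v; the DG degree is the total
   degree. *)
Definition ginz_deg (a : qarr ginz_quiver) : int :=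
  (ginz_bideg a).1 + (ginz_bideg a).2.

Local Notation A := (pathAlg K ginz_quiver).

Definition ginz_g (g : tarrow T) : A := parr (inl (inl g) : qarr ginz_quiver).
Definition ginz_gs (g : tarrow T) : A := parr (inl (inr g) : qarr ginz_quiver).

(* dh for h = \sum_v h_v; by k-linearity, d h_v = e_v (dh) e_v. *)
Definition ginz_dh : A :=
  \sum_(g : tarrow T) (ginz_gs g * ginz_g g - ginz_g g * ginz_gs g).

Definition ginz_d (a : qarr ginz_quiver) : A :=
  if a is inr v then
    let e : A := pvert (v : qvert ginz_quiver) in e * ginz_dh * e
  else 0.

Lemma pvertl_idem (Q : quiver) (v : qvert Q) (x : pathAlg K Q) :
  pvert v * (pvert v * x) = pvert v * x.
Proof. by rewrite mulrA pvertM eqxx. Qed.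

Lemma pvertr_idem (Q : quiver) (v : qvert Q) (x : pathAlg K Q) :
  x * pvert v * pvert v = x * pvert v.
Proof. by rewrite -mulrA pvertM eqxx. Qed.

Fact ginz_d_tgt a : pvert (qtgt a) * ginz_d a = ginz_d a.
Proof. by case: a => [a|v]; rewrite /ginz_d ?mulr0 // -mulrA pvertl_idem. Qed.

Fact ginz_d_src a : ginz_d a * pvert (qsrc a) = ginz_d a.
Proof. by case: a => [a|v]; rewrite /ginz_d ?mul0r // pvertr_idem. Qed.

Lemma ginz_dh_homog : phomog ginz_deg 0 ginz_dh.
Proof.
apply: phomog_sum => g _; rewrite -[0]addr0.
by apply: phomogB; apply: phomogM; apply: phomog_arr.
Qed.

Fact ginz_d_homog a : phomog ginz_deg (ginz_deg a + 1) (ginz_d a).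
Proof.
case: a => [a|v]; first exact: phomog0.
rewrite -[ginz_deg _ + 1]/(0 + 0 + 0 : int).
apply: phomogM; last exact: phomog_vert.
by apply: phomogM; [exact: phomog_vert | exact: ginz_dh_homog].
Qed.

Fact ginz_d_closed a : pdiff ginz_deg ginz_d (ginz_d a) = 0.
Proof.
have L := pdiff_leibniz (deg := ginz_deg) ginz_d_tgt ginz_d_src.
have gg b c (x := parr (inl b : qarr ginz_quiver) : A)
    (y := parr (inl c : qarr ginz_quiver) : A) : pdiff ginz_deg ginz_d (x * y) = 0.
  rewrite (L _ _ _ (phomog_arr _ _ _)) !pdiff_arr.
  by rewrite mul0r mulr0 scaler0 addr0.
case: a => [a|v]; first by rewrite linear0.
have dh0 : pdiff ginz_deg ginz_d ginz_dh = 0.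
  rewrite linear_sum big1 // => g _.
  by rewrite linearB /= !gg subrr.
rewrite /ginz_d -mulrA (L _ _ _ (phomog_vert _ _ _)) pdiff_vert mul0r add0r.
rewrite (L _ _ _ ginz_dh_homog) dh0 pdiff_vert mul0r mulr0 scaler0 addr0.
by rewrite mulr0 scaler0.
Qed.

Definition ginzburg : dgAlgebra K T :=
  pathDG ginz_d_tgt ginz_d_src ginz_d_homog ginz_d_closed.

End Ginzburg.

Section Legendrian.
Context (K : fieldType) (T : rootedTree) (lt : childOrder T).

(* [inl v] stands for c_v and [inr (w, v)] for c_{wv}. *)
Definition leg_arr : finType := (T + tdart T)%type.

Definition leg_src (a : leg_arr) : T :=
  match a with inl v => v | inr p => (val p).2 end.

Definition leg_tgt (a : leg_arr) : T :=
  match a with inl v => v | inr p => (val p).1 end.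

Definition leg_quiver : quiver := Quiver leg_src leg_tgt (troot T).

Definition leg_deg (a : qarr leg_quiver) : int :=
  match a : leg_arr with inl _ => - 1%:Z | inr _ => 0 end.

Local Notation A := (pathAlg K leg_quiver).

(* c_{wv}; the value 0 for non-adjacent w and v is never used. *)
Definition leg_c (w v : T) : A :=
  if insub (w, v) is Some p then parr (inr p : qarr leg_quiver) else 0.

(* In the last sum w = (w_1, ..., w_{i+1}); since children of v are linearly
   ordered, an increasing sequence of them has length at most #|T|. *)
Definition leg_Dc (v : T) : A :=
  - (\sum_(u | away u v) leg_c v u * leg_c u v)
  + \sum_(i < #|T|)
      \sum_(w : i.+1.-tuple T | sorted (lt v) w && all (away v) w)
        \prod_(x <- w) (leg_c v x * leg_c x v).

Definition leg_d (a : qarr leg_quiver) : A :=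
  match a : leg_arr with inl v => leg_Dc v | inr _ => 0 end.

Lemma leg_c_tgt w v : pvert (w : qvert leg_quiver) * leg_c w v = leg_c w v.
Proof.
rewrite /leg_c; case: insubP => [p _ e|_]; last by rewrite mulr0.
by have := pvert_arr K (inr p : qarr leg_quiver); rewrite /= e.
Qed.

Lemma leg_c_src w v : leg_c w v * pvert (v : qvert leg_quiver) = leg_c w v.
Proof.
rewrite /leg_c; case: insubP => [p _ e|_]; last by rewrite mul0r.
by have := parr_vert K (inr p : qarr leg_quiver); rewrite /= e.
Qed.

Lemma leg_c_homog w v : phomog leg_deg 0 (leg_c w v).
Proof.
rewrite /leg_c; case: insubP => [p _ e|_]; last exact: phomog0.
exact: phomog_arr.
Qed.

Lemma leg_Dc_ind (v : T) (P : A -> Prop) :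
  P 0 -> (forall x y, P x -> P y -> P (x + y)) -> (forall x, P x -> P (- x)) ->
  (forall x y, P x -> P y -> P (x * y)) ->
  (forall w, P (leg_c v w * leg_c w v)) -> P (leg_Dc v).
Proof.
move=> P0 PD PN PM Pc; apply: (PD).
  by apply: PN; apply: (big_ind P) => // u _; apply: Pc.
apply: (big_ind P) => // i _; apply: (big_ind P) => // -[s /= hs] _.
case: s hs => // a s _.
elim: s a => [|b s IH] a; first by rewrite big_seq1.
by rewrite big_cons; apply: PM.
Qed.

Fact leg_d_tgt a : pvert (qtgt a) * leg_d a = leg_d a.
Proof.
case: a => [v|p]; last by rewrite mulr0.
apply: (leg_Dc_ind (P := fun x : A => pvert (v : qvert leg_quiver) * x = x)) => [|x y ex ey|x ex|x y ex ey|w].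
- by rewrite mulr0.
- by rewrite mulrDr ex ey.
- by rewrite mulrN ex.
- by rewrite mulrA ex.
- by rewrite mulrA leg_c_tgt.
Qed.

Fact leg_d_src a : leg_d a * pvert (qsrc a) = leg_d a.
Proof.
case: a => [v|p]; last by rewrite mul0r.
apply: (leg_Dc_ind (P := fun x : A => x * pvert (v : qvert leg_quiver) = x)) => [|x y ex ey|x ex|x y ex ey|w].
- by rewrite mul0r.
- by rewrite mulrDl ex ey.
- by rewrite mulNr ex.
- by rewrite -mulrA ey.
- by rewrite -mulrA leg_c_src.
Qed.

Fact leg_d_homog a : phomog leg_deg (leg_deg a + 1) (leg_d a).
Proof.
case: a => [v|p]; last exact: phomog0.
rewrite -[leg_deg _ + 1]/(0 : int).
apply: (leg_Dc_ind (P := fun x : A => phomog leg_deg 0 x)) => [|x y|x|x y ex ey|w].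
- exact: phomog0.
- exact: phomogD.
- by move=> ex; rewrite -[- x]add0r; apply: phomogB => //; apply: phomog0.
- by rewrite -[0]addr0; apply: phomogM.
- by rewrite -[0]addr0; apply: phomogM; apply: leg_c_homog.
Qed.

Fact leg_d_closed a : pdiff leg_deg leg_d (leg_d a) = 0.
Proof.
have L := pdiff_leibniz (deg := leg_deg) leg_d_tgt leg_d_src.
have c0 w v : pdiff leg_deg leg_d (leg_c w v) = 0.
  rewrite /leg_c; case: insubP => [p _ e|_]; last by rewrite linear0.
  by rewrite pdiff_arr.
case: a => [v|p]; last by rewrite linear0.
pose P (x : A) := phomog leg_deg 0 x /\ pdiff leg_deg leg_d x = 0.
suff [] : P (leg_d (inl v)) by [].
apply: (leg_Dc_ind (P := P)) => [|x y [hx ex] [hy ey]|x [hx ex]|x y [hx ex] [hy ey]|w].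
- by split; [exact: phomog0 | rewrite linear0].
- by split; [exact: phomogD | rewrite linearD /= ex ey addr0].
- split; last by rewrite linearN /= ex oppr0.
  by rewrite -[- x]add0r; apply: phomogB => //; apply: phomog0.
- split; first by rewrite -[0]addr0; apply: phomogM.
  by rewrite (L _ _ _ hx) ex ey mul0r mulr0 scaler0 addr0.
- split; first by rewrite -[0]addr0; apply: phomogM; apply: leg_c_homog.
  by rewrite (L _ _ _ (leg_c_homog _ _)) !c0 mul0r mulr0 scaler0 addr0.
Qed.

Definition legendrian : dgAlgebra K T :=
  pathDG leg_d_tgt leg_d_src leg_d_homog leg_d_closed.

End Legendrian.

Arguments ginzburg K T : clear implicits.
Arguments legendrian K {T} lt.

Definition graph_iso (V W : finType) (e : rel V) (e' : rel W) : Prop :=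
  exists2 f : V -> W, bijective f & forall x y, e' (f x) (f y) = e x y.

Definition dynkinA (n : nat) : rel 'I_n :=
  fun i j => (i.+1 == j) || (j.+1 == i).

(* Vertices 0, ..., n-2 form a path, and n-1 is joined to n-3. *)
Definition dynkinD (n : nat) : rel 'I_n :=
  let edge (i j : nat) :=
    (i.+1 == j) && (j < n.-1)%N || (i == n - 3)%N && (j == n.-1) in
  fun i j => edge i j || edge j i.

Definition type_A (T : rootedTree) (n : nat) : Prop :=
  (1 <= n)%N /\ graph_iso (@tadj T) (@dynkinA n).

Definition type_D (T : rootedTree) (n : nat) : Prop :=
  (4 <= n)%N /\ graph_iso (@tadj T) (@dynkinD n).

(* Main.v *)
From Stdlib Require Import ClassicalEpsilon Ncring Ncring_tac.
From HB Require Import structures.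
Require Import Defs.
From mathcomp Require Import all_boot all_order all_algebra.
From mathcomp Require Import finmap generic_quotient zify.
From mathcomp.multinomials Require Import monalg.

Set Implicit Arguments.
Unset Strict Implicit.
Unset Printing Implicit Defensive.

Import Order.TTheory GRing.Theory Num.Theory.
Local Open Scope ring_scope.

(** Both algebras are path algebras, over the double quiver of the tree with a
    loop of degree -1 added at each vertex, and both differentials send the loop
    at v to a moment map.  Write x_vw for the closed path from v to its
    neighbour w and back.  The Ginzburg differential gives the additive relation
    (sum of x_vw over the children w) - x_vu, where u is the parent of v; the
    Legendrian one gives the multiplicative relation
    (ordered product of the 1 + x_vw) - 1 - x_vu.  The two have the same terms
    of path length 2.

    A homomorphism that is the identity to first order in path length need not
    be a quasi-isomorphism, since path algebras are not complete.  It is one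
    when, on both sides, every cocycle of large path length bounds an element of
    large path length (filtered_quasi_iso).  By an induction that strips one
    letter at a time (deep_exactP), this holds once all long words in the
    arrows of degree 0 are exact, that is, once the arrows generate a nilpotent
    ideal in cohomology in degree 0.

    This cohomology is the additive, or the multiplicative, preprojective
    algebra.  Its nilpotency is proved for both at once (coordA_Ann, coordD_Ann)
    by writing the relations in terms of the formal sum gl, which is x + y or
    x + y + xy.  From the end of a tail inwards, all loops along the tail are
    nilpotent; at the trivalent vertex of D_n the two loops a, b at the short
    legs square to zero, and ab + ba is nilpotent because the third loop is.

    It remains to find the homomorphism.  Its values on the arrows must satisfy
    the multiplicative relations in the additive preprojective algebra; each
    multiplicative moment map then bounds, and new_loop chooses the image of c_v.
    On a tail it is enough to multiply one arrow of each edge by a power series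
    in the loop there.  For A_n one uses x/(1 - x) on one side of the root and x
    on the other, as the inverse of 1 + x/(1 - x) is 1 - x.  For D_n, up to
    signs and order, C = A + B at the trivalent vertex has to be turned into
    1 + C' = (1 + A')(1 + B') with A' and B' of square zero.  This is the
    identity of unipotent_product: if a' and b' are suitable conjugates of
    a = A/4 and b = B/4, rescaled by a factor commuting with a and b, then
    (1 + 4a')(1 + 4b') is the square of the Cayley transform (1 + c)/(1 - c) of
    c = a + b.  Hence C' is C/(1 - C/4)^2, a series which also works along the
    tail and across the root.  The division by 4 is where characteristic 2 is
    excluded.  The two cases are coordA_deformation and coordD_deformation. *)

(** * Quotients by two-sided ideals *)

Definition pbool (P : Prop) : bool := if excluded_middle_informative P then true else false.

Lemma pboolP (P : Prop) : reflect P (pbool P).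
Proof. by rewrite /pbool; case: excluded_middle_informative => h; constructor. Qed.

Record ideal2 (A : pzRingType) := Ideal2 {
  in_ideal2 :> A -> Prop;
  ideal2_0 : in_ideal2 0;
  ideal2B : forall x y, in_ideal2 x -> in_ideal2 y -> in_ideal2 (x - y);
  ideal2Ml : forall x y, in_ideal2 y -> in_ideal2 (x * y);
  ideal2Mr : forall x y, in_ideal2 x -> in_ideal2 (x * y) }.

Section Quotient2.
Context (A : pzRingType) (I : ideal2 A).

Definition eqmod2 (x y : A) : bool := pbool (I (x - y)).

Fact eqmod2_refl : reflexive eqmod2.
Proof. by move=> x; apply/pboolP; rewrite subrr; apply: ideal2_0. Qed.
Fact eqmod2_symm : symmetric eqmod2.
Proof.
have h x y : eqmod2 x y -> eqmod2 y x.
  move=> /pboolP e; apply/pboolP; rewrite -opprB -[- _]sub0r.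
  by apply: ideal2B => //; apply: ideal2_0.
by move=> x y; apply/idP/idP; apply: h.
Qed.
Fact eqmod2_transi : transitive eqmod2.
Proof.
move=> y x z /pboolP e; rewrite eqmod2_symm => /pboolP e'; apply/pboolP.
by have := ideal2B e e'; rewrite opprB addrA subrK.
Qed.

Definition eqmod2_equiv := EquivRel eqmod2 eqmod2_refl eqmod2_symm eqmod2_transi.

Definition quot2 := {eq_quot eqmod2_equiv}%qT.
HB.instance Definition _ := Choice.on quot2.

Definition qpi (x : A) : quot2 := (\pi_quot2 x)%qT.

Lemma qpiP x y : qpi x = qpi y <-> I (x - y).
Proof.
by split=> [/eqmodP/pboolP//|e]; apply/eqmodP; apply/pboolP.
Qed.

Definition qadd (x y : quot2) : quot2 := qpi (repr x + repr y).
Definition qopp (x : quot2) : quot2 := qpi (- repr x).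
Definition qmul (x y : quot2) : quot2 := qpi (repr x * repr y).

Lemma qpiK (x : quot2) : qpi (repr x) = x.
Proof. exact: reprK. Qed.

Lemma ideal2N x : I x -> I (- x).
Proof. by move=> h; rewrite -sub0r; apply: ideal2B => //; apply: ideal2_0. Qed.

Lemma ideal2D x y : I x -> I y -> I (x + y).
Proof. by move=> hx hy; rewrite -[y]opprK; apply: ideal2B => //; apply: ideal2N. Qed.

Lemma repr_qpi x : I (repr (qpi x) - x).
Proof. by apply/qpiP; rewrite qpiK. Qed.

Lemma qaddE x y : qadd (qpi x) (qpi y) = qpi (x + y).
Proof.
apply/qpiP; rewrite opprD addrACA; apply: ideal2D; exact: repr_qpi.
Qed.

Lemma qoppE x : qopp (qpi x) = qpi (- x).
Proof. by apply/qpiP; rewrite -opprD; apply: ideal2N; apply: repr_qpi. Qed.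

Lemma qmulE x y : qmul (qpi x) (qpi y) = qpi (x * y).
Proof.
apply/qpiP; set x' := repr _; set y' := repr _.
have -> : x' * y' - x * y = (x' - x) * y' + x * (y' - y).
  by rewrite mulrBl mulrBr addrA subrK.
by apply: ideal2D; [apply: ideal2Mr | apply: ideal2Ml]; apply: repr_qpi.
Qed.

Fact qaddA : associative qadd.
Proof. by move=> x y z; rewrite -[x]qpiK -[y]qpiK -[z]qpiK !qaddE addrA. Qed.
Fact qaddC : commutative qadd.
Proof. by move=> x y; rewrite -[x]qpiK -[y]qpiK !qaddE addrC. Qed.
Fact qadd0 : left_id (qpi 0) qadd.
Proof. by move=> x; rewrite -[x]qpiK !qaddE add0r. Qed.
Fact qaddN : left_inverse (qpi 0) qopp qadd.
Proof. by move=> x; rewrite -[x]qpiK qoppE qaddE addNr. Qed.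
HB.instance Definition _ := GRing.isZmodule.Build quot2 qaddA qaddC qadd0 qaddN.

Fact qmulA : associative qmul.
Proof. by move=> x y z; rewrite -[x]qpiK -[y]qpiK -[z]qpiK !qmulE mulrA. Qed.
Fact qmul1l : left_id (qpi 1) qmul.
Proof. by move=> x; rewrite -[x]qpiK !qmulE mul1r. Qed.
Fact qmul1r : right_id (qpi 1) qmul.
Proof. by move=> x; rewrite -[x]qpiK !qmulE mulr1. Qed.
Fact qmulDl : left_distributive qmul +%R.
Proof.
move=> x y z; rewrite -[x]qpiK -[y]qpiK -[z]qpiK.
by rewrite -[X in qmul X _]/(qadd _ _) qaddE !qmulE mulrDl -qaddE.
Qed.
Fact qmulDr : right_distributive qmul +%R.
Proof.
move=> x y z; rewrite -[x]qpiK -[y]qpiK -[z]qpiK.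
by rewrite -[X in qmul _ X]/(qadd _ _) qaddE !qmulE mulrDr -qaddE.
Qed.
HB.instance Definition _ := GRing.Zmodule_isPzRing.Build quot2
  qmulA qmul1l qmul1r qmulDl qmulDr.

Fact qpi_is_zmod_morphism : zmod_morphism qpi.
Proof. by move=> x y; rewrite -qaddE -qoppE. Qed.
HB.instance Definition _ := GRing.isZmodMorphism.Build A quot2 qpi qpi_is_zmod_morphism.
Fact qpi_is_monoid_morphism : monoid_morphism qpi.
Proof. by split=> // x y; rewrite -qmulE. Qed.
HB.instance Definition _ :=
  GRing.isMonoidMorphism.Build A quot2 qpi qpi_is_monoid_morphism.

Lemma qpi_eq0 x : qpi x = 0 <-> I x.
Proof. by rewrite -(rmorph0 qpi) qpiP subr0. Qed.

End Quotient2.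

(** * Filtrations, projections and left quotients of path algebras *)

Section PathTools.
Context (K : fieldType) (Q : quiver).
Local Notation A := (pathAlg K Q).
Implicit Types (a b : qarr Q) (v : qvert Q) (s : seq (qarr Q)) (p q : qpath Q).
Implicit Types (x y z : A) (om : qarr Q -> nat) (k l : nat).

(** The decreasing filtration by the weight om.  With om = 1 it is the filtration
    by path length; with om the indicator of negative degree, its first step is
    the ideal of all elements of negative degree. *)
Definition fil om k : pred A :=
  [pred x | all (fun p => (k <= \sum_(a <- pword p) om a)%N)
                (msupp (x : {malg K[qpath Q]}))].

Lemma filP om k x :
  reflect (forall p, x@_p != 0 -> (k <= \sum_(a <- pword p) om a)%N) (fil om k x).
Proof.
by apply: (iffP allP) => H p; [rewrite mcoeff_neq0 | rewrite -mcoeff_neq0] => /H.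
Qed.

Lemma fil0 om k : fil om k 0.
Proof. by apply/filP => p; rewrite mcoeff0 eqxx. Qed.

Lemma filL om k c x y : fil om k x -> fil om k y -> fil om k (c *: x + y).
Proof.
move=> /filP hx /filP hy; apply/filP => p.
rewrite mcoeffD mcoeffZ; have [e|/hx //] := eqVneq x@_p 0.
by rewrite e mulr0 add0r => /hy.
Qed.

Lemma filD om k x y : fil om k x -> fil om k y -> fil om k (x + y).
Proof. by move=> hx hy; rewrite -[x]scale1r; apply: filL. Qed.

Lemma filZ om k c x : fil om k x -> fil om k (c *: x).
Proof. by move=> hx; rewrite -[c *: x]addr0; apply: filL => //; apply: fil0. Qed.

Lemma filN om k x : fil om k x -> fil om k (- x).
Proof. by move=> hx; rewrite -scaleN1r; apply: filZ. Qed.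

Lemma filB om k x y : fil om k x -> fil om k y -> fil om k (x - y).
Proof. by move=> hx hy; apply: filD => //; apply: filN. Qed.

Lemma fil_sum om k I (r : seq I) (P : pred I) (F : I -> A) :
  (forall i, P i -> fil om k (F i)) -> fil om k (\sum_(i <- r | P i) F i).
Proof. by move=> h; elim/big_ind: _ => //; [apply: fil0|apply: filD]. Qed.

Lemma fil_le om k l x : fil om k x -> (l <= k)%N -> fil om l x.
Proof. by move=> /filP h lk; apply/filP => p /h; apply: leq_trans. Qed.

Lemma filT om x : fil om 0 x.
Proof. exact/filP. Qed.

Lemma fil_base om p : fil om (\sum_(a <- pword p) om a) (pbase K p).
Proof.
by apply/filP => q; rewrite mcoeff_pbase; case: (p =P q) => [->|] //; rewrite eqxx.
Qed.

Lemma fil_ind om k (P : A -> Prop) :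
  (forall c x y, P x -> P y -> P (c *: x + y)) -> P 0 ->
  (forall p, (k <= \sum_(a <- pword p) om a)%N -> P (pbase K p)) ->
  forall x, fil om k x -> P x.
Proof.
move=> PD P0 Pb x hx; apply: path_ind_supp => // p px; apply: Pb.
exact: (allP hx).
Qed.

Lemma filM om k l x y : fil om k x -> fil om l y -> fil om (k + l) (x * y).
Proof.
move=> hx hy; move: x hx; apply: fil_ind => [c x x' e e'||p hp].
- by rewrite mulrDl -scalerAl; apply: filL.
- by rewrite mul0r; apply: fil0.
move: y hy; apply: fil_ind => [c x x' e e'||q hq].
- by rewrite mulrDr -scalerAr; apply: filL.
- by rewrite mulr0; apply: fil0.
rewrite pbaseM /pmul_base; case: pcatP => [r _ _ w _|_]; last exact: fil0.
apply: (fil_le (fil_base om r)); rewrite w big_cat /=; exact: leq_add.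
Qed.

Lemma fil_arr om a : fil om (om a) (parr a : A).
Proof. by have := fil_base om (parrow a); rewrite /= big_seq1. Qed.

Lemma fil_word om s : fil om (\sum_(a <- s) om a) (wprod K s).
Proof.
rewrite /wprod; elim: s => [|a s IH]; first by rewrite !big_nil; apply: filT.
by rewrite !big_cons; apply: filM => //; apply: fil_arr.
Qed.

Definition lenf k : pred A := fil (fun=> 1%N) k.

Lemma lenfP k x : reflect (forall p, x@_p != 0 -> (k <= size (pword p))%N) (lenf k x).
Proof. by apply: (iffP (filP _ _ _)) => h p /h; rewrite sum1_size. Qed.

Definition pproj (P : pred (qpath Q)) x : A :=
  linext (fun p => if P p then pbase K p else 0) x.
HB.instance Definition _ P := GRing.Linear.copy (pproj P)
  (linext (fun p => if P p then pbase K p else 0)).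

Lemma pproj_base (P : pred (qpath Q)) p : pproj P (pbase K p) = if P p then pbase K p else 0.
Proof. by rewrite {1}pbaseU [LHS]linextU. Qed.

Lemma mcoeff_pproj (P : pred (qpath Q)) x p : (pproj P x)@_p = if P p then x@_p else 0.
Proof.
elim/path_ind: x => [c x y e e'||q].
- rewrite linearP [LHS]mcoeffD mcoeffZ e e' [in RHS]mcoeffD mcoeffZ.
  by case: (P p) => //; rewrite mulr0 addr0.
- by rewrite linear0 mcoeff0 if_same.
rewrite pproj_base mcoeff_pbase; case: (q =P p) => [->|/eqP n].
  by case: (P p); rewrite ?mcoeff_pbase ?eqxx // mcoeff0.
by rewrite if_same; case: (P q); rewrite ?mcoeff0 // mcoeff_pbase (negPf n).
Qed.

Lemma pproj_id (P : pred (qpath Q)) x : (forall p, x@_p != 0 -> P p) -> pproj P x = x.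
Proof.
move=> h; apply/malgP => p; rewrite mcoeff_pproj.
by case: ifP => // n; apply/eqP; rewrite eq_sym; apply: contraFT n => /h.
Qed.

Lemma pproj_eq0 (P : pred (qpath Q)) x : (forall p, x@_p != 0 -> ~~ P p) -> pproj P x = 0.
Proof.
move=> h; apply/malgP => p; rewrite mcoeff_pproj mcoeff0.
by case: ifP => // n; apply/eqP; apply: contraTT n => /h.
Qed.

Definition pquo_base a p : A :=
  if pword p is b :: s then if b == a then pvert (qsrc a) * wprod K s else 0 else 0.

(** A left inverse of left multiplication by the arrow a: it strips a leading a
    and kills all paths that start otherwise. *)
Definition pquo a x : A := linext (pquo_base a) x.
HB.instance Definition _ a := GRing.Linear.copy (pquo a) (linext (pquo_base a)).

Lemma pquoU a p : pquo a (pbase K p) = pquo_base a p.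
Proof. by rewrite pbaseU [LHS]linextU. Qed.

Lemma pquo_src a x : pvert (qsrc a) * pquo a x = pquo a x.
Proof.
elim/path_ind: x => [c x y e e'||p].
- by rewrite linearP mulrDr -scalerAr e e'.
- by rewrite linear0 mulr0.
rewrite pquoU /pquo_base; case: (pword p) => [|b s]; first by rewrite mulr0.
by case: ifP; rewrite ?mulr0 // mulrA pvertM eqxx.
Qed.

Lemma pquo_arr a b x :
  pquo a (parr b * x) = if b == a then pvert (qsrc a) * x else 0.
Proof.
elim/path_ind: x => [c x y e e'||p].
- rewrite mulrDr -scalerAr linearP [in LHS]/= e e'; case: ifP => _.
    by rewrite mulrDr -scalerAr.
  by rewrite scaler0 addr0.
- by rewrite mulr0 linear0 mulr0 if_same.
rewrite pbaseM /pmul_base; case: pcatP => [r e t w _|n].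
  rewrite pquoU /pquo_base w /=; case: eqP => // ab; subst b.
  have {}e : qsrc a = ptgt p := e.
  by rewrite pvertl e eqxx [in RHS]pbaseE.
rewrite linear0; case: eqP => // ab; subst b.
have {}n : qsrc a != ptgt p := n.
by rewrite pvertl (negPf n).
Qed.

Lemma pquoE x : lenf 1 x -> x = \sum_a parr a * pquo a x.
Proof.
move: x; apply: fil_ind => [c x y e e'||p].
- rewrite {1}e {1}e' scaler_sumr -big_split; apply: eq_bigr => a _ /=.
  by rewrite linearP mulrDr -scalerAr.
- by rewrite big1 // => a _; rewrite linear0 mulr0.
rewrite sum1_size; case w: (pword p) => [//|b s] _.
rewrite (bigD1 b) //= big1 ?addr0 => [|a ab]; rewrite pquoU /pquo_base w.
  rewrite eqxx mulrA parr_vert pbaseE w /wprod big_cons mulrA.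
  by move: (pwalk p); rewrite w /= => /andP[/eqP <- _]; rewrite pvert_arr.
by rewrite eq_sym (negPf ab) mulr0.
Qed.

Lemma pquoM a x y : lenf 1 x -> pquo a (x * y) = pquo a x * y.
Proof.
move=> h; rewrite {1}(pquoE h) mulr_suml linear_sum (bigD1 a) //= big1 => [|b ab].
  by rewrite addr0 -mulrA pquo_arr eqxx mulrA pquo_src.
by rewrite -mulrA pquo_arr (negPf ab).
Qed.

Lemma fil_quo om k a x : fil om k x -> fil om (k - om a) (pquo a x).
Proof.
move: x; apply: fil_ind => [c x y e e'||p].
- by rewrite linearP; apply: filL.
- by rewrite linear0; apply: fil0.
rewrite pquoU /pquo_base; case: (pword p) => [_|b s]; first exact: fil0.
rewrite big_cons; case: eqP => [-> h|_ _]; last exact: fil0.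
have := filM (filT om (pvert (qsrc a))) (fil_word om s); rewrite add0n.
by move=> f; apply: (fil_le f); rewrite leq_subLR.
Qed.

Lemma phomog_ind (deg : qarr Q -> int) (i : int) (P : A -> Prop) :
  (forall c x y, P x -> P y -> P (c *: x + y)) -> P 0 ->
  (forall p, wdeg deg (pword p) = i -> P (pbase K p)) ->
  forall x, phomog deg i x -> P x.
Proof.
move=> PD P0 Pb x hx; apply: path_ind_supp => // p px; apply: Pb.
by apply/eqP/(allP hx).
Qed.

Lemma phomogL (deg : qarr Q -> int) (i : int) c x y :
  phomog deg i x -> phomog deg i y -> phomog deg i (c *: x + y).
Proof. by move=> hx hy; apply: phomogD => //; apply: phomogZ. Qed.

Lemma phomog_quo (deg : qarr Q -> int) (i : int) a x :
  phomog deg i x -> phomog deg (i - deg a) (pquo a x).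
Proof.
move: x; apply: phomog_ind => [c x y e e'||p <-].
- by rewrite linearP; apply: phomogL.
- by rewrite linear0; apply: phomog0.
rewrite pquoU /pquo_base; case: (pword p) => [|b s]; first exact: phomog0.
case: eqP => [->|_]; last exact: phomog0.
rewrite /wdeg big_cons addrC addKr -[X in phomog _ X]add0r.
by apply: phomogM; [apply: phomog_vert | apply: phomog_word].
Qed.

End PathTools.

(** * Homomorphisms out of a path algebra *)

Record pathRep (K : fieldType) (Q : quiver) (B : algType K) := PathRep {
  rep_v : qvert Q -> B;
  rep_a : qarr Q -> B;
  rep_vM : forall v w, rep_v v * rep_v w = if v == w then rep_v v else 0;
  rep_v_sum : \sum_v rep_v v = 1;
  rep_tgt : forall a, rep_v (qtgt a) * rep_a a = rep_a a;
  rep_src : forall a, rep_a a * rep_v (qsrc a) = rep_a a }.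

Section PathExt.
Context (K : fieldType) (Q : quiver) (B : algType K) (r : pathRep Q B).
Local Notation A := (pathAlg K Q).
Implicit Types (a b : qarr Q) (v : qvert Q) (s : seq (qarr Q)) (p q : qpath Q).
Implicit Types (x y z : A).

Definition rep_w s : B := \prod_(a <- s) rep_a r a.

Definition pext x : B := linext (fun p => rep_v r (ptgt p) * rep_w (pword p)) x.
HB.instance Definition _ := GRing.Linear.copy pext
  (linext (fun p => rep_v r (ptgt p) * rep_w (pword p))).

Lemma pext_base p : pext (pbase K p) = rep_v r (ptgt p) * rep_w (pword p).
Proof. by rewrite pbaseU [LHS]linextU. Qed.

Lemma pext_vert v : pext (pvert v) = rep_v r v.
Proof. by rewrite pext_base /rep_w big_nil mulr1. Qed.

Lemma pext_arr a : pext (parr a) = rep_a r a.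
Proof. by rewrite pext_base /rep_w big_seq1 rep_tgt. Qed.

Lemma rep_walk v s : walk v s ->
  rep_v r v * rep_w s = rep_v r v * rep_w s * rep_v r (wsrc v s).
Proof.
rewrite /rep_w; elim: s v => [|a s IH] v /=.
  by rewrite big_nil mulr1 rep_vM eqxx.
case/andP=> _ w; rewrite big_cons -(rep_src r a) -!mulrA.
congr (_ * (_ * _)); rewrite mulrA; exact: IH.
Qed.

Fact pext_is_monoid_morphism : monoid_morphism pext.
Proof.
split.
  rewrite -pvert_sum linear_sum /= -(rep_v_sum r).
  by apply: eq_bigr => v _; rewrite pext_vert.
move=> x y; elim/path_ind: x => [c x x' e e'||p].
- by rewrite mulrDl -scalerAl !linearP /= mulrDl -scalerAl e e'.
- by rewrite mul0r linear0 mul0r.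
elim/path_ind: y => [c x x' e e'||q].
- by rewrite mulrDr -scalerAr !linearP /= mulrDr -scalerAr e e'.
- by rewrite mulr0 linear0 mulr0.
rewrite pbaseM /pmul_base !pext_base (rep_walk (pwalk p)) -/(psrc p).
case: pcatP => [u e t w _|n].
  rewrite pext_base t w -e /rep_w big_cat /= -!/(rep_w _) mulrA [in LHS](rep_walk (pwalk p)).
  rewrite -/(psrc p) [RHS]mulrA -[in RHS](mulrA _ (rep_v r (psrc p)) (rep_v r (psrc p))).
  by rewrite rep_vM eqxx.
by rewrite linear0 -!mulrA [X in _ * (_ * X)]mulrA rep_vM (negPf n) mul0r !mulr0.
Qed.
HB.instance Definition _ :=
  GRing.isMonoidMorphism.Build A B pext pext_is_monoid_morphism.

Lemma pext_word s : pext (wprod K s) = rep_w s.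
Proof. by rewrite rmorph_prod /=; apply: eq_bigr => a _; rewrite pext_arr. Qed.

End PathExt.

Section PathDGHom.
Context (K : fieldType) (Q : quiver) (deg : qarr Q -> int).
Context (d0 : qarr Q -> pathAlg K Q).
Context (d0_tgt : forall a, pvert (qtgt a) * d0 a = d0 a).
Context (d0_src : forall a, d0 a * pvert (qsrc a) = d0 a).
Context (d0_homog : forall a, phomog deg (deg a + 1) (d0 a)).
Context (d0_closed : forall a, pdiff deg d0 (d0 a) = 0).
Context (B : dgAlgebra K (qvert Q)) (r : pathRep Q B).
Context (rv : forall v, rep_v r v = dg_idem B v).
Context (ra_homog : forall a, dg_homog B (deg a) (rep_a r a)).
Context (ra_d : forall a, dg_d B (rep_a r a) = pext r (d0 a)).

Lemma dg_homog1 : dg_homog B 0 1.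
Proof.
rewrite -(dg_idem_sum B); have [h0 hD] := dg_homog_submod B 0.
elim/big_ind: _ => [||v _] //; last exact: dg_homog_idem.
by move=> x y hx hy; rewrite -[x]scale1r; apply: hD.
Qed.

Lemma rep_w_homog s : dg_homog B (wdeg deg s) (rep_w r s).
Proof.
rewrite /rep_w /wdeg; elim: s => [|a s IH]; rewrite ?big_nil ?big_cons.
  exact: dg_homog1.
exact: dg_homogM.
Qed.

Lemma pext_homog i x : phomog deg i x -> dg_homog B i (pext r x).
Proof.
have [h0 hD] := dg_homog_submod B i.
move: x; apply: phomog_ind => [c x y e e'||p <-].
- by rewrite linearP; apply: hD.
- by rewrite linear0.
rewrite pext_base rv -[wdeg _ _]add0r.
by apply: dg_homogM; [apply: dg_homog_idem | apply: rep_w_homog].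
Qed.

Lemma dg_d1 : dg_d B 1 = 0.
Proof.
by rewrite -(dg_idem_sum B) linear_sum big1 // => v _; apply: dg_d_idem.
Qed.

Lemma pext_d x : pext r (pdiff deg d0 x) = dg_d B (pext r x).
Proof.
elim/path_ind: x => [c x y e e'||p].
- by rewrite !linearP /= e e'.
- by rewrite !linear0.
rewrite pdiff_base -(wdiff_tgt deg d0_tgt) rmorphM /= pext_vert pext_base rv.
rewrite (dg_d_leibniz _ (dg_homog_idem B _)) dg_d_idem mul0r add0r expr0z scale1r.
congr (_ * _); elim: (pword p) => [|a s IH] /=.
  by rewrite linear0 /rep_w big_nil dg_d1.
rewrite /rep_w big_cons (dg_d_leibniz _ (ra_homog a)) -/(rep_w r s) -IH ra_d.
by rewrite linearD linearZ /= !rmorphM /= pext_arr pext_word.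
Qed.

Definition path_dgHom :
    dgHom (pathDG d0_tgt d0_src d0_homog d0_closed) B :=
  @DGHom K (qvert Q) (pathDG d0_tgt d0_src d0_homog d0_closed) B
    (pext r : {lrmorphism pathAlg K Q -> B})
    (fun v => etrans (pext_vert r v) (rv v)) pext_homog pext_d.

End PathDGHom.

(** * Cocycles deep in the path-length filtration are coboundaries *)

Section Connective.
Context (K : fieldType) (Q : quiver) (deg : qarr Q -> int).
Context (d0 : qarr Q -> pathAlg K Q).
Context (d0_tgt : forall a, pvert (qtgt a) * d0 a = d0 a).
Context (d0_src : forall a, d0 a * pvert (qsrc a) = d0 a).
Context (d0_homog : forall a, phomog deg (deg a + 1) (d0 a)).
Context (d0_closed : forall a, pdiff deg d0 (d0 a) = 0).
Context (deg01 : forall a, (deg a == 0) || (deg a == -1)).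
Context (d0_len : forall a, lenf 1 (d0 a)).
Local Notation A := (pathAlg K Q).
Local Notation d := (pdiff deg d0).
Local Notation homog := (phomog deg).
Implicit Types (a b c : qarr Q) (q s : seq (qarr Q)) (x y z : A) (i : int).

Lemma deg_neg a : deg a != 0 -> deg a = -1.
Proof. by case/orP: (deg01 a) => /eqP ->. Qed.

Lemma wdeg_le0 s : (wdeg deg s <= 0)%R.
Proof.
rewrite /wdeg; elim: s => [|a s IH]; rewrite ?big_nil // big_cons.
by rewrite -[0]addr0 lerD //; case/orP: (deg01 a) => /eqP ->.
Qed.

Lemma homog_pos i x : homog i x -> (0 < i)%R -> x = 0.
Proof.
move=> /phomogP h i0; apply/malgP => p; rewrite mcoeff0; apply/eqP.
by apply: contraTT i0 => /h <-; rewrite -leNgt wdeg_le0.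
Qed.

Lemma d0_deg0 a : deg a = 0 -> d0 a = 0.
Proof. by move=> e; apply: (homog_pos (d0_homog a)); rewrite e. Qed.

Lemma leibniz i x y : homog i x -> d (x * y) = d x * y + (-1 : K) ^ i *: (x * d y).
Proof. by move=> h; apply: (pdiff_leibniz d0_tgt d0_src). Qed.

Lemma d_homog i x : homog i x -> homog (i + 1) (d x).
Proof. exact: pdiff_homog. Qed.

Lemma d_d x : d (d x) = 0.
Proof. exact: pdiffK. Qed.

Lemma d_deg0 x : homog 0 x -> d x = 0.
Proof. by move=> /d_homog h; apply: (homog_pos h). Qed.

Lemma d_mul0 x y : homog 0 x -> d (x * y) = x * d y.
Proof. by move=> h; rewrite (leibniz _ h) d_deg0 // mul0r add0r expr0z scale1r. Qed.

Lemma d_lenf k x : lenf k x -> lenf k (d x).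
Proof.
move: x; apply: fil_ind => [c x y e e'||p].
- by rewrite linearP; apply: filL.
- by rewrite linear0; apply: fil0.
rewrite sum1_size pdiff_base => h; apply: fil_le _ h.
elim: (pword p) => [|a s IH] /=; first exact: fil0.
apply: filD; rewrite -[(size s).+1]add1n.
  apply: filM; first exact: d0_len.
  by have := fil_word K (fun=> 1%N) s; rewrite sum1_size.
by apply: filZ; apply: filM; first exact: fil_arr.
Qed.

Lemma lenf1_homog i x : homog i x -> i != 0 -> lenf 1 x.
Proof.
move=> /phomogP h i0; apply/lenfP => p /h; case: (pword p) => //.
by rewrite /wdeg big_nil => e; rewrite -e eqxx in i0.
Qed.

(** The left quotients of a cocycle are cocycles, up to the contribution of the
    differentials of its first letters. *)
Lemma pquo_d z a : lenf 1 z ->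
  pquo a (d z) = \sum_b pquo a (d0 b) * pquo b z + (-1 : K) ^ deg a *: d (pquo a z).
Proof.
move=> h; rewrite {1}(pquoE h) !linear_sum /=.
under eq_bigr => b _ do rewrite (leibniz _ (phomog_arr K deg b)) pdiff_arr
  linearD linearZ /= pquo_arr (pquoM _ _ (d0_len b)).
rewrite big_split /=; congr (_ + _).
rewrite (bigD1 a) //= eqxx big1 ?addr0 => [|b /negPf ->]; last by rewrite scaler0.
rewrite -(d_mul0 _ (phomog_vert _ _ _)) pquo_src //.
Qed.

(** Path length is allowed to drop, by an amount that only depends on the degree
    and on the length wanted for y. *)
Definition deep_exact i : Prop := forall k, exists m, forall z,
  homog i z -> lenf m z -> d z = 0 ->
  exists y, [/\ homog (i - 1) y, lenf k y & d y = z].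

Context (N : nat).
Context (long_exact : forall s, all (fun a => deg a == 0) s -> size s = N ->
  exists2 y, homog (-1) y & d y = wprod K s).

Lemma word_homog0 q : all (fun a => deg a == 0) q -> homog 0 (wprod K q).
Proof.
move=> h; suff <- : wdeg deg q = 0 by apply: phomog_word.
by rewrite /wdeg; elim: q h => [|a q IH] /=; rewrite ?big_nil // big_cons => /andP[/eqP -> /IH ->].
Qed.

(** A prefix q of length N is exact, so q z is too.  A shorter one is
    lengthened: the components of z that start with an arrow of degree -1 are
    cocycles of degree i + 1, hence removable, and the others start with an arrow
    of degree 0 that joins the prefix. *)
Lemma deep_exact_prefix i : deep_exact (i + 1) ->
  forall j k, exists m, forall q z, all (fun a => deg a == 0) q -> (size q + j = N)%N ->
  homog i z -> lenf m z -> d z = 0 ->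
  exists y, [/\ homog (i - 1) y, lenf k y & d y = wprod K q * z].
Proof.
move=> IHi; elim=> [|j IHj] k.
  exists k => q z q0; rewrite addn0 => /(long_exact q0)[s hs ds] hz lz dz.
  exists (s * z); split; first by rewrite addrC; apply: phomogM.
    by rewrite -[k]add0n; apply: filM => //; apply: filT.
  by rewrite (leibniz _ hs) dz mulr0 scaler0 addr0 ds.
have [m1 P1] := IHj k; have [m2 P2] := IHi (maxn m1 k).
exists (maxn m1 m2).+1 => q z q0 eq hz lz dz.
have lz1 : lenf 1 z by apply: fil_le lz _.
have dquo c : deg c != 0 -> d (pquo c z) = 0.
  move=> /deg_neg dc; have := pquo_d c lz1; rewrite dz linear0 big1 => [|b _].
    rewrite add0r => /esym/eqP; rewrite scaler_eq0 expfz_eq0 oppr_eq0 oner_eq0 andbF /=.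
    by move/eqP.
  rewrite (homog_pos (phomog_quo c (d0_homog b))) ?mul0r //.
  by rewrite dc; case/orP: (deg01 b) => /eqP ->.
have /fin_all_exists[Y hY] c : exists y, deg c != 0 ->
    [/\ homog i y, lenf (maxn m1 k) y & d y = pquo c z].
  case: (eqVneq (deg c) 0) => [_|nc]; first by exists 0.
  have [|||y] := P2 (pquo c z).
  - by have := phomog_quo c hz; rewrite (deg_neg nc) opprK.
  - by apply: fil_le (fil_quo c lz) _; lia.
  - exact: dquo.
  by rewrite addrK => hy; exists y.
(* Adding d S trades the leading letters of degree -1 for their differentials,
   which start with letters of degree 0. *)
pose S := \sum_(c | deg c != 0) parr c * Y c.
have dS : d S = \sum_(c | deg c != 0) (d0 c * Y c - parr c * pquo c z).
  rewrite linear_sum; apply: eq_bigr => c nc /=; have [_ _ e] := hY c nc.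
  rewrite (leibniz _ (phomog_arr K deg c)) pdiff_arr e.
  by rewrite (deg_neg nc) exprN1 invrN1 scaleN1r.
have hS : homog (i - 1) S.
  apply: phomog_sum => c nc; rewrite addrC -(deg_neg nc).
  by apply: phomogM; [apply: phomog_arr | case: (hY c nc)].
have lS : lenf k S.
  apply: fil_sum => c nc; have [_ l _] := hY c nc.
  by apply: fil_le (filM (fil_arr K _ c) l) _; lia.
pose z' := z + d S.
have hz' : homog i z'.
  by apply: phomogD => //; have := d_homog hS; rewrite subrK.
have dz' : d z' = 0 by rewrite linearD /= dz d_d addr0.
have quoz' a : pquo a z' = (if deg a == 0 then pquo a z else 0)
    + \sum_(c | deg c != 0) pquo a (d0 c) * Y c.
  rewrite linearD dS linear_sum; under eq_bigr => c _ do
    rewrite linearB /= (pquoM _ _ (d0_len c)) pquo_arr.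
  rewrite sumrB addrCA [RHS]addrC; congr (_ + _); case: ifP => a0.
    by rewrite big1 ?subr0 // => c nc; case: eqP => // e; rewrite e a0 in nc.
  rewrite (bigD1 a) ?a0 //= eqxx big1 ?addr0 ?pquo_src ?subrr //.
  by move=> c /andP[_ /negPf ->].
have quo_neg a : deg a != 0 -> pquo a z' = 0.
  move=> na; rewrite quoz' (negPf na) add0r big1 // => c nc.
  rewrite (homog_pos (phomog_quo a (d0_homog c))) ?mul0r //.
  by rewrite (deg_neg na) (deg_neg nc).
have lz'1 : lenf 1 z'.
  apply: filD => //; rewrite dS; apply: fil_sum => c _.
  apply: filB; first exact: (filM (d0_len c) (filT _ _)).
  exact: (filM (fil_arr K (fun=> 1%N) c) (filT _ _)).
have /fin_all_exists[W hW] a : exists w, deg a == 0 ->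
    [/\ homog (i - 1) w, lenf k w & d w = wprod K q * (parr a * pquo a z')].
  case: (boolP (deg a == 0)) => [a0|_]; last by exists 0.
  have [|||||w] := P1 (rcons q a) (pquo a z').
  - by rewrite all_rcons a0.
  - by rewrite size_rcons addSnnS.
  - by have := phomog_quo a hz'; rewrite (eqP a0) subr0.
  - rewrite quoz' a0; apply: filD.
      by apply: fil_le (fil_quo a lz) _; lia.
    apply: fil_sum => c nc; have [_ l _] := hY c nc.
    by apply: fil_le (filM (filT _ _) l) _; lia.
  - have := pquo_d a lz'1; rewrite dz' linear0 big1 => [|b _].
      by rewrite (eqP a0) expr0z scale1r add0r.
    have [b0|nb] := eqVneq (deg b) 0; first by rewrite d0_deg0 // linear0 mul0r.
    by rewrite quo_neg // mulr0.
  move=> [hw lw dw]; exists w => _; split=> //.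
  by rewrite dw /wprod -cats1 big_cat big_seq1 /= mulrA.
exists (\sum_(a | deg a == 0) W a - wprod K q * S); split.
- apply: phomogB; first by apply: phomog_sum => a a0; case: (hW a a0).
  by rewrite -[i - 1]add0r; apply: phomogM => //; apply: word_homog0.
- apply: filB; first by apply: fil_sum => a a0; case: (hW a a0).
  by rewrite -[k]add0n; apply: filM => //; apply: filT.
rewrite linearB linear_sum /= (d_mul0 _ (word_homog0 q0)).
under eq_bigr => a a0 do have [_ _ ->] := hW a a0.
rewrite -mulr_sumr -mulrBr; congr (_ * _); apply/eqP; rewrite subr_eq -/z'; apply/eqP.
rewrite [RHS](pquoE lz'1) [RHS](bigID (fun a => deg a == 0)) /=.
by rewrite [X in _ + X]big1 ?addr0 // => a na; rewrite quo_neg // mulr0.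
Qed.

Lemma deep_exactP i : deep_exact i.
Proof.
suff h n : deep_exact (1 - n%:Z).
  case: (lerP i 0) => [i0|i0] k.
    have -> : i = 1 - (`|1 - i|%N)%:Z by lia.
    exact: h.
  exists 0%N => z hz _ _; exists 0; rewrite linear0 (homog_pos hz i0).
  by split=> //; [apply: phomog0 | apply: fil0].
elim: n => [|n IH] k.
  exists 0%N => z hz _ _; exists 0; rewrite linear0 (homog_pos hz) //.
  by split=> //; [apply: phomog0 | apply: fil0].
have e : 1 - n.+1%:Z + 1 = 1 - n%:Z by lia.
rewrite -e in IH; have [m P] := deep_exact_prefix IH N k.
exists m => z hz lz dz; have [y [h1 h2 h3]] := P [::] z isT erefl hz lz dz.
by exists y; split=> //; rewrite h3 /wprod big_nil mul1r.
Qed.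

End Connective.

(** * A filtered approximation to the identity is a quasi-isomorphism *)

Section Comparison.
Context (K : fieldType) (V : finType) (A B : dgAlgebra K V) (f : dgHom A B).
Context (j : {linear B -> A}) (FA : nat -> pred A) (FB : nat -> pred B).
Context (FA0 : forall x, FA 0 x) (FB0 : forall y, FB 0 y).
Context (FAB : forall k x y, FA k x -> FA k y -> FA k (x - y)).
Context (FBB : forall k x y, FB k x -> FB k y -> FB k (x - y)).
Context (FAle : forall k l x, FA k x -> (l <= k)%N -> FA l x).
Context (FBle : forall k l x, FB k x -> (l <= k)%N -> FB l x).
Context (dFB : forall k y, FB k y -> FB k (dg_d B y)).
Context (fF : forall k x, FA k x -> FB k (f x)).
Context (jF : forall k y, FB k y -> FA k (j y)).
Context (j_homog : forall i y, dg_homog B i y -> dg_homog A i (j y)).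
Context (jf : forall k x, FA k x -> FA k.+1 (j (f x) - x)).
Context (fj : forall k y, FB k y -> FB k.+1 (f (j y) - y)).

Definition deep_exact_dg (C : dgAlgebra K V) (F : nat -> pred C) : Prop :=
  forall i k, exists m, forall z, dg_homog C i z -> F m z -> dg_d C z = 0 ->
  exists y, [/\ dg_homog C (i - 1) y, F k y & dg_d C y = z].

Context (exA : deep_exact_dg FA) (exB : deep_exact_dg FB).

Lemma dg_homogD (C : dgAlgebra K V) i (x y : C) :
  dg_homog C i x -> dg_homog C i y -> dg_homog C i (x + y).
Proof.
by have [_ hD] := dg_homog_submod C i => hx hy; rewrite -[x]scale1r; apply: hD.
Qed.

Lemma dg_homogB (C : dgAlgebra K V) i (x y : C) :
  dg_homog C i x -> dg_homog C i y -> dg_homog C i (x - y).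
Proof.
have [_ hD] := dg_homog_submod C i => hx hy.
by rewrite addrC -scaleN1r; apply: hD.
Qed.

(** Successive approximation: the error y - f x is corrected by its own image
    under j, which is an inverse of f up to higher filtration. *)
Lemma filtered_approx i m y : dg_homog B i y ->
  exists2 x, dg_homog A i x & FB m (f x - y).
Proof.
move=> hy; elim: m => [|m [x hx lx]].
  by exists 0; [case: (dg_homog_submod A i) | apply: FB0].
have l : FB m (y - f x).
  by have := FBB (FBB lx lx) lx; rewrite subrr sub0r opprB.
exists (x + j (y - f x)).
  by apply: dg_homogD => //; apply: j_homog; apply: dg_homogB => //; apply: dg_fun_homog.
by have := fj l; rewrite rmorphD /= opprB addrA [f (j _) + _]addrC.
Qed.

Lemma filtered_reflect m x : FB m (f x) -> FA m x.
Proof.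
move=> h; suff: forall k, (k <= m)%N -> FA k x by apply.
elim=> [|k IH] km; first exact: FA0.
have := FAB (FAle (jF h) km) (jf (IH (ltnW km))).
by rewrite opprB addrC subrK.
Qed.

(** A cocycle y of B is close to some f x.  Then the differential of x is a deep
    cocycle, which is removed by a deep correction of x; after that, f x - y is a
    deep cocycle and bounds.  Injectivity is the same argument, applied to an
    element that f x - f x' bounds. *)
Lemma filtered_quasi_iso : quasi_iso f.
Proof.
move=> i; split=> [x x' [hx dx] [hx' dx'] [w hw e]|y [hy dy]].
  have [m P] := exA i 0; have [u hu lu] := filtered_approx m hw.
  have du : dg_homog A i (dg_d A u).
    by have := dg_d_homog hu; rewrite subrK.
  have [|||v [hv _ dv]] := P (x - x' - dg_d A u).
  - by apply: dg_homogB => //; apply: dg_homogB.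
  - apply: filtered_reflect; rewrite !rmorphB /= e dg_fun_d -opprB -linearB /=.
    rewrite -sub0r; apply: FBB; last exact: dFB.
    by rewrite -[0](subrr (f u - w)); apply: FBB.
  - by rewrite !linearB /= dx dx' dg_dd !subr0.
  exists (u + v); first exact: dg_homogD.
  by rewrite linearD /= dv [RHS]addrC subrK.
have [mB PB] := exB i 0; have [mA PA] := exA (i + 1) mB.
have [x hx lx] := filtered_approx (maxn mA mB) hy.
have [|||u [hu lu du]] := PA (dg_d A x); first exact: dg_d_homog.
- apply: filtered_reflect; rewrite dg_fun_d.
  have -> : dg_d B (f x) = dg_d B (f x - y) by rewrite linearB /= dy subr0.
  by apply: dFB; apply: FBle lx _; rewrite leq_maxl.
- exact: dg_dd.
rewrite addrK in hu.
have hxu : dg_homog A i (x - u) by apply: dg_homogB.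
have dxu : dg_d A (x - u) = 0 by rewrite linearB /= du subrr.
exists (x - u) => //.
have [|||w [hw _ dw]] := PB (f (x - u) - y).
- by apply: dg_homogB => //; apply: dg_fun_homog.
- rewrite rmorphB addrAC; apply: FBB; last exact: fF.
  by apply: FBle lx _; rewrite leq_maxr.
- by rewrite linearB /= -dg_fun_d dxu linear0 dy subrr.
by exists w.
Qed.

End Comparison.

(** * Cohomology in degree zero as a quotient ring *)

Section H0.
Context (K : fieldType) (Q : quiver) (deg : qarr Q -> int).
Context (d0 : qarr Q -> pathAlg K Q).
Context (d0_tgt : forall a, pvert (qtgt a) * d0 a = d0 a).
Context (d0_src : forall a, d0 a * pvert (qsrc a) = d0 a).
Context (d0_homog : forall a, phomog deg (deg a + 1) (d0 a)).
Context (deg01 : forall a, (deg a == 0) || (deg a == -1)).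
Local Notation A := (pathAlg K Q).
Local Notation d := (pdiff deg d0).
Local Notation homog := (phomog deg).
Implicit Types (a b : qarr Q) (s : seq (qarr Q)) (x y z : A) (i : int).

Definition negw a : nat := deg a != 0.

Lemma wdeg_negw s : wdeg deg s = - (\sum_(a <- s) negw a)%N%:Z.
Proof.
elim: s => [|a s IH]; rewrite /wdeg ?big_nil // !big_cons -/(wdeg deg s) IH PoszD opprD.
by rewrite /negw; congr (_ + _); case/orP: (deg01 a) => /eqP ->.
Qed.

Lemma base_negw p : homog 0 (pbase K p) \/ fil negw 1 (pbase K p).
Proof.
have [e|n] := eqVneq (\sum_(a <- pword p) negw a)%N 0%N; [left|right].
  by have := phomog_base K deg p; rewrite wdeg_negw e.
by apply: (fil_le (fil_base K negw p)); rewrite lt0n.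
Qed.

(** Everything of negative degree, together with the boundaries: since the
    algebra lives in nonpositive degrees, this is a two-sided ideal, and the
    quotient is cohomology in degree 0. *)
Definition H0_rel x : Prop := exists n y, fil negw 1 n /\ x = n + d y.

Lemma H0_relL c x y : H0_rel x -> H0_rel y -> H0_rel (c *: x + y).
Proof.
move=> [n [u [hn ->]]] [m [w [hm ->]]]; exists (c *: n + m), (c *: u + w).
by split; [apply: filL | rewrite linearP /= scalerDr addrACA].
Qed.

Lemma H0_rel_neg x : fil negw 1 x -> H0_rel x.
Proof. by move=> h; exists x, 0; rewrite linear0 addr0. Qed.

Lemma H0_rel_d x : H0_rel (d x).
Proof. by exists 0, x; rewrite add0r; split=> //; apply: fil0. Qed.

Lemma H0_rel0 : H0_rel 0.
Proof. by apply: H0_rel_neg; apply: fil0. Qed.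

Lemma H0_relB x y : H0_rel x -> H0_rel y -> H0_rel (x - y).
Proof. by move=> hx hy; rewrite addrC -scaleN1r; apply: H0_relL. Qed.

Lemma H0_relMl x y : H0_rel y -> H0_rel (x * y).
Proof.
case=> n [z [hn ->]]; elim/path_ind: x => [c x x' e e'||p].
- by rewrite mulrDl -scalerAl; apply: H0_relL.
- by rewrite mul0r; apply: H0_rel0.
rewrite mulrDr -[X in X + _]scale1r; apply: H0_relL.
  by apply: H0_rel_neg; rewrite -[1%N]add0n; apply: filM => //; apply: filT.
have [h|h] := base_negw p.
  by rewrite -(d_mul0 d0_tgt d0_src d0_homog deg01) //; apply: H0_rel_d.
by apply: H0_rel_neg; rewrite -[1%N]addn0; apply: filM => //; apply: filT.
Qed.

Lemma H0_relMr x y : H0_rel x -> H0_rel (x * y).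
Proof.
case=> n [z [hn ->]]; elim/path_ind: y => [c x' y e e'||p].
- by rewrite mulrDr -scalerAr; apply: H0_relL.
- by rewrite mulr0; apply: H0_rel0.
rewrite mulrDl -[X in X + _]scale1r; apply: H0_relL.
  by apply: H0_rel_neg; rewrite -[1%N]addn0; apply: filM => //; apply: filT.
have [h|h] := base_negw p; last first.
  by apply: H0_rel_neg; rewrite -[1%N]add0n; apply: filM => //; apply: filT.
suff -> : d z * pbase K p = d (z * pbase K p) by apply: H0_rel_d.
elim/path_ind: z => [c x' y e e'||q].
- by rewrite pdiffD pdiffZ mulrDl -scalerAl e e' mulrDl -scalerAl pdiffD pdiffZ.
- by rewrite linear0 !mul0r linear0.
rewrite (leibniz d0_tgt d0_src _ (phomog_base K deg q)).
by rewrite (d_deg0 d0_homog deg01 h) mulr0 scaler0 addr0.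
Qed.

Definition H0_ideal : ideal2 A := Ideal2 H0_rel0 H0_relB H0_relMl H0_relMr.
Definition H0 : pzRingType := quot2 H0_ideal.
Definition piH : {rmorphism A -> H0} := @qpi _ H0_ideal.

Lemma piH_d x : piH (d x) = 0.
Proof. by apply/qpi_eq0; apply: H0_rel_d. Qed.

Lemma piH_scale (c : K) : forall x : H0, GRing.comm x (piH c%:A).
Proof.
move=> x; have -> : x = piH (generic_quotient.repr x) by rewrite -[LHS]qpiK.
rewrite /GRing.comm -!rmorphM /=; congr qpi; by rewrite -scalerAr -scalerAl mulr1 mul1r.
Qed.

Lemma pproj_d i y : pproj (fun p => wdeg deg (pword p) == i + 1) (d y)
  = d (pproj (fun p => wdeg deg (pword p) == i) y).
Proof.
elim/path_ind: y => [c x y e e'||p]; first by rewrite !linearP /= e e'.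
  by rewrite !linear0.
have /phomogP h := wdiff_homog d0_homog (pword p).
rewrite pproj_base pdiff_base; case: ifP => [/eqP <-|n].
  by rewrite pdiff_base; apply: pproj_id => q /h ->.
rewrite linear0; apply: pproj_eq0 => q /h ->.
by rewrite (can_eq (addrK _)) n.
Qed.

(** Projecting to degrees 0 and -1 removes the part of negative degree and makes
    the bounding element homogeneous. *)
Lemma piH_eq0 x : homog 0 x -> piH x = 0 -> exists2 y, homog (-1) y & d y = x.
Proof.
move=> /phomogP hx /qpi_eq0[n [y [/filP hn e]]].
exists (pproj (fun p => wdeg deg (pword p) == -1) y).
  by apply/phomogP => p; rewrite mcoeff_pproj; case: ifP => [/eqP//|]; rewrite eqxx.
rewrite -pproj_d addNr -[RHS](pproj_id (P := fun p => wdeg deg (pword p) == 0)); last first.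
  by move=> p /hx ->.
rewrite e linearD /= [X in _ = X + _]pproj_eq0 ?add0r // => p /hn.
by rewrite wdeg_negw; lia.
Qed.

End H0.

(** * Parents and children in a rooted tree *)

Section Parents.
Context (T : rootedTree).
Implicit Types (u v w : T).
Local Notation adj := (@tadj T).
Local Notation root := (troot T).

(** The relation in the definition of away. *)
Definition avoid w : rel T := [rel x y | [&& adj x y, x != w & y != w]].

Lemma awayE v w : away v w = adj v w && connect (avoid w) root v.
Proof. by []. Qed.

Lemma avoid_path w x p : path (avoid w) x p =
  path adj x p && ((p == [::]) || (w \notin x :: p)).
Proof.
elim: p x => [|y p IH] x //=; rewrite IH [in RHS]inE negb_or.
have -> : avoid w x y = [&& adj x y, w != x & w != y] by rewrite /avoid /= ![_ == w]eq_sym.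
case: (adj x y) => //=; case: (path adj y p); rewrite ?andbF //=.
rewrite inE negb_or.
by case: p {IH} => [|z p] /=; case: (w == x); case: (w == y); rewrite ?inE ?negb_or ?andbT.
Qed.

Lemma away_step p v : path adj root p -> v \notin root :: p ->
  adj (last root p) v -> away (last root p) v.
Proof.
move=> pp vp a; rewrite awayE a; apply/connectP; exists p => //.
by rewrite avoid_path pp vp orbT.
Qed.

Lemma away_adj v w : away v w -> adj v w.
Proof. by case/andP. Qed.

Lemma away_root v : ~~ away v root.
Proof.
rewrite awayE; apply/negP => /andP[a /connectP[p]].
rewrite avoid_path mem_head orbF => /andP[_ /eqP ->] /= e.
by rewrite e tadj_irr in a.
Qed.

(** Two parents would close up a cycle through v. *)
Lemma away_inj u u' v : away u v -> away u' v -> u = u'.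
Proof.
move=> h h'; case: (eqVneq u u') => // ne.
have [[a c] [a' c']] := (andP h, andP h').
have sym : connect_sym (avoid v).
  by apply: sym_connect_sym => x y; rewrite /avoid /= tadj_sym [X in _ && X]andbC.
have /connectP[p0 pp] : connect (avoid v) u u' by rewrite sym in c; apply: connect_trans c c'.
case: (shortenP pp) => p pp' up _ e.
move: pp'; rewrite avoid_path; have pn : p != [::].
  by apply: contraNneq ne => p0'; rewrite e p0'.
rewrite (negPf pn) /= => /andP[pa pv].
case: (@tree_acyclic T (v :: u :: p)); first by case: (p) pn.
apply/andP; split; last by rewrite cons_uniq pv up.
by rewrite /= rcons_path pa -e a' tadj_sym a.
Qed.

Lemma parent_exists v : v != root -> exists u, away u v.
Proof.
move=> vr; have /connectP[p0 pp] := tree_connected root v.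
case: (shortenP pp) => p; case/lastP: p => [|p x] pa up _ e.
  by rewrite e eqxx in vr.
rewrite last_rcons in e; subst x; exists (last root p).
move: pa up; rewrite rcons_path -rcons_cons rcons_uniq => /andP[pp' a] /andP[vp _].
exact: away_step.
Qed.

Lemma away_total v w : adj v w -> away v w \/ away w v.
Proof.
move=> a; have /connectP[p0 pp] := tree_connected root v.
case: (shortenP pp) => p pa up _ e.
have [wp|wp] := boolP (w \in root :: p); last first.
  by left; rewrite e; apply: away_step => //; rewrite -e.
right; rewrite awayE tadj_sym a /=.
have vw : v != w by apply: contraTneq a => ->; rewrite tadj_irr.
case: (splitPl wp) e pa up => p1 p2 e1 e; rewrite cat_path -cat_cons cat_uniq.
move=> /andP[pa1 _] /and3P[_ h _]; apply/connectP; exists p1 => //.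
rewrite avoid_path pa1; apply/orP; right; apply: contra h => v1.
apply/hasP; exists v => //; rewrite last_cat e1 in e.
move: e; case: (p2) => [|y s] /= e; first by rewrite e eqxx in vw.
by rewrite e mem_last.
Qed.

(** Otherwise the last step of a path from the root to w that avoids v would come
    from a second parent of w. *)
Lemma away_asym v w : away v w -> ~~ away w v.
Proof.
move=> h; apply/negP => h'.
have rv : root != v by apply: contraTneq h' => <-; apply: away_root.
have rw : root != w by apply: contraTneq h => <-; apply: away_root.
have /connectP[p0 pp] : connect (avoid v) root w by case/andP: h'.
case: (shortenP pp) => p; case/lastP: p => [|p x] pa up _ e.
  by rewrite e eqxx in rw.
rewrite last_rcons in e; subst x; move: pa up.
rewrite avoid_path -rcons_cons rcons_uniq rcons_path mem_rcons inE negb_or.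
rewrite -cats1 -size_eq0 size_cat addn1 /= => /andP[/andP[pa a] /andP[_ vp]] /andP[wp _].
have hu := away_step pa wp a; have e := away_inj h hu.
by move: vp; rewrite e mem_last.
Qed.

End Parents.

Section Children.
Context (T : rootedTree) (lt : childOrder T).
Implicit Types (u v w : T).

Definition children v : seq T := sort (fun x y => (x == y) || lt v x y) (enum (away v)).

Lemma mem_children v w : (w \in children v) = away v w.
Proof. by rewrite mem_sort mem_enum. Qed.

Lemma children_uniq v : uniq (children v).
Proof. by rewrite sort_uniq enum_uniq. Qed.

Lemma children_pairwise v : pairwise (lt v) (children v).
Proof.
have tr : {in away v & &, transitive (fun x y => (x == y) || lt v x y)}.
  move=> y x z yv xv zv /predU1P[->//|xy] /predU1P[<-|yz]; first by rewrite xy orbT.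
  by rewrite (child_lt_trans yv xv zv xy yz) orbT.
have : sorted (fun x y => (x == y) || lt v x y) (children v).
  apply: (@sort_sorted_in _ (away v)); last by apply/allP => x; rewrite mem_enum.
  move=> x y xv yv; rewrite eq_sym; case: eqVneq => //= ne.
  by rewrite (child_lt_total lt xv yv) // eq_sym.
rewrite (sorted_pairwise_in tr); last by apply/allP => x; rewrite mem_children.
have := children_uniq v; elim: (children v) => //= x s IH /andP[xs us] /andP[ax ps].
rewrite IH // andbT; apply/allP => y ys; move/allP/(_ y ys): ax => /predU1P[e|//].
by rewrite e ys in xs.
Qed.

Lemma neighbours_cases v (s : seq T) : uniq s -> (forall w, tadj v w = (w \in s)) ->
  (v = troot T /\ perm_eq (children v) s) \/
  (v <> troot T /\ exists2 u, away u v & perm_eq (u :: children v) s).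
Proof.
move=> us hs; have [e|ne] := eqVneq v (troot T); [left|right]; split=> //; last 2 first.
- by apply/eqP.
- have [u hu] := parent_exists ne; exists u => //.
  apply: uniq_perm => //=; first by rewrite mem_children away_asym //= children_uniq.
  move=> w; rewrite inE mem_children -hs; apply/orP/idP => [[/eqP ->|/away_adj//]|].
    by rewrite tadj_sym; apply: away_adj.
  case/away_total => h; [by right | left]; apply/eqP; exact: away_inj h hu.
apply: uniq_perm => //; first exact: children_uniq.
move=> w; rewrite mem_children -hs; apply/idP/idP => [/away_adj//|].
by case/away_total => // h; have := away_root w; rewrite -e h.
Qed.

Lemma sum_children (R : nmodType) v (F : T -> R) :
  \sum_(w | away v w) F w = \sum_(w <- children v) F w.
Proof.
rewrite -big_enum /=; apply: perm_big; apply: uniq_perm.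
- exact: enum_uniq.
- exact: children_uniq.
- by move=> w; rewrite mem_enum mem_children.
Qed.

End Children.

(** * Sums over increasing tuples of children *)

Lemma big_tuple_cons (T : finType) (R : nmodType) n (P : pred (n.+1.-tuple T))
    (F : n.+1.-tuple T -> R) :
  \sum_(w | P w) F w = \sum_x \sum_(t : n.-tuple T | P [tuple of x :: t]) F [tuple of x :: t].
Proof.
rewrite pair_big_dep /=; apply: (reindex (fun p : T * n.-tuple T => [tuple of p.1 :: p.2])).
exists (fun w => (thead w, [tuple of behead w])) => [[x t] _|w _] /=.
  by congr pair; apply: val_inj.
by rewrite [RHS]tuple_eta; apply: val_inj.
Qed.

Section IncreasingTuples.
Context (T : finType) (R : pzRingType) (F : T -> R) (lt : rel T).
Implicit Types (s : seq T).

Definition inc_sum n s : R :=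
  \sum_(w : n.-tuple T | pairwise lt w && all (mem s) w) \prod_(x <- w) F x.

Context (s0 : seq T) (lt_irr : {in s0, irreflexive lt}).
Context (lt_tr : {in s0 & &, transitive lt}).

(** An increasing tuple from x :: s either starts with x and goes on in s, or lies
    in s altogether. *)
Lemma inc_sum_cons n x s : {subset x :: s <= s0} -> uniq (x :: s) -> pairwise lt (x :: s) ->
  inc_sum n.+1 (x :: s) = F x * inc_sum n s + inc_sum n.+1 s.
Proof.
move=> ss /= /andP[xs us] /andP[xlt ps].
have xs0 : x \in s0 by apply: ss; rewrite mem_head.
have ss' y : y \in s -> y \in s0 by move=> h; apply: ss; rewrite inE h orbT.
have xl y : y \in s -> lt x y by move/allP: xlt => h; apply: h.
rewrite /inc_sum [LHS]big_tuple_cons [X in _ + X]big_tuple_cons (bigD1 x) //=.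
congr (_ + _).
  rewrite mulr_sumr; apply: eq_big => [t|t _]; last by rewrite big_cons.
  rewrite mem_head /= -andbA andbCA; apply: andb_id2l => _.
  apply/andP/allP => [[/allP lx /allP a] y yt|a].
    have := a y yt; rewrite inE => /predU1P[e|//].
    by have := lx y yt; rewrite e lt_irr.
  split; apply/allP => y /a h; first exact: xl.
  by rewrite inE; apply/orP; right.
rewrite [RHS](bigD1 x) //= [X in _ = X + _]big1 ?add0r; last first.
  by move=> t; rewrite (negPf xs) andbF.
apply: eq_bigr => y yx; apply: eq_bigl => t.
rewrite inE (negPf yx) /=; case: (boolP (y \in s)) => //= ys.
apply: andb_id2l => /andP[/allP ly _]; apply: eq_in_all => z zt.
rewrite /= inE; case: (eqVneq z x) => [e|] /=; last by [].
subst z.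
have := lt_tr (ss' y ys) xs0 xs0 (xl y ys) (ly x zt).
by rewrite lt_irr.
Qed.

Lemma inc_sum0 s : inc_sum 0 s = 1.
Proof.
rewrite /inc_sum (big_pred1 [tuple]) ?big_nil // => t.
by rewrite tuple0 /= eqxx.
Qed.

(** Expanding the ordered product of the 1 + F x, up to the constant term. *)
Lemma inc_sum_fold n s : {subset s <= s0} -> uniq s -> pairwise lt s -> (size s <= n)%N ->
  \sum_(i < n) inc_sum i.+1 s = foldr (fun x acc => F x + acc + F x * acc) 0 s.
Proof.
elim: s n => [|x s IH] n ss us ps hn.
  rewrite big1 // => i _; rewrite /inc_sum big_pred0 // => -[[|a t] //= _].
  by rewrite andbF.
case: n hn => // n hn; have [/= /andP[_ us'] /andP[_ ps']] := (us, ps).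
have ss' : {subset s <= s0} by move=> y ys; apply: ss; rewrite inE ys orbT.
under eq_bigr => i _ do rewrite (inc_sum_cons _ ss us ps).
rewrite big_split /= IH //; last exact: ltnW.
rewrite -mulr_sumr big_ord_recl inc_sum0.
under eq_bigr => i _ do rewrite lift0.
by rewrite IH // mulrDr mulr1 addrAC.
Qed.

End IncreasingTuples.

Lemma leg_sum_fold (T : rootedTree) (lt : childOrder T) (R : pzRingType) (F : T -> R) v :
  \sum_(i < #|T|) \sum_(w : i.+1.-tuple T | sorted (lt v) w && all (away v) w)
    \prod_(x <- w) F x
  = foldr (fun x acc => F x + acc + F x * acc) 0 (children lt v).
Proof.
have sub w : all (away v) w = all (mem (children lt v)) w.
  by apply: eq_all => x; rewrite /= mem_children.
have inP : {in children lt v, forall x, x \in away v}.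
  by move=> x; rewrite mem_children.
have irr : {in children lt v, irreflexive (lt v)}.
  by move=> x /inP; apply: child_lt_irr.
have tr : {in children lt v & &, transitive (lt v)}.
  by move=> y x z /inP hy /inP hx /inP hz; apply: child_lt_trans.
rewrite -(inc_sum_fold F irr tr (n := #|T|)) ?children_uniq ?children_pairwise //; last first.
  by rewrite -(card_uniqP (children_uniq lt v)) max_card.
apply: eq_bigr => i _; apply: eq_bigl => w; rewrite sub andbC [RHS]andbC.
apply: andb_id2l => a; apply: (sorted_pairwise_in tr a).
Qed.

(** * The relation at a vertex, additive and multiplicative at once *)

Section FormalSum.
Context (R : pzRingType) (k : bool).
Implicit Types (x y z : R).

(** The additive formal group law for k = 0 and the multiplicative one,
    (1 + x)(1 + y) - 1, for k = 1. *)
Definition gl x y : R := x + y + (x * y) *+ k.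

Lemma gl0x x : gl 0 x = x.
Proof. by rewrite /gl mul0r mul0rn addr0 add0r. Qed.
Lemma glx0 x : gl x 0 = x.
Proof. by rewrite /gl mulr0 mul0rn !addr0. Qed.

Lemma glA : associative gl.
Proof.
rewrite /gl; case: k => x y z; rewrite ?mulr1n ?mulr0n ?addr0 ?addrA //.
rewrite !mulrDr !mulrDl !addrA mulrA; congr (_ + _).
by rewrite -!addrA; congr (_ + (_ + _)); rewrite addrCA addrC -!addrA addrCA.
Qed.

Lemma glxN x : x * x = 0 -> gl x (- x) = 0.
Proof. by move=> h; rewrite /gl subrr mulrN h oppr0 mul0rn addr0. Qed.
Lemma glNx x : x * x = 0 -> gl (- x) x = 0.
Proof. by move=> h; rewrite /gl addNr mulNr h oppr0 mul0rn addr0. Qed.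

Lemma gl_left x y z : x * x = 0 -> gl x y = z <-> y = gl (- x) z.
Proof.
move=> h; split=> [<-|->]; first by rewrite glA glNx // gl0x.
by rewrite glA glxN // gl0x.
Qed.
Lemma gl_right x y z : y * y = 0 -> gl x y = z <-> x = gl z (- y).
Proof.
move=> h; split=> [<-|->]; first by rewrite -glA glxN // glx0.
by rewrite -glA glNx // glx0.
Qed.

End FormalSum.

Lemma fold_gl_sum (I : Type) (R : pzRingType) (F : I -> R) s :
  foldr (fun w acc => gl false (F w) acc) 0 s = \sum_(w <- s) F w.
Proof. by elim: s => [|w s IH]; rewrite ?big_nil // big_cons /= IH /gl mulr0n addr0. Qed.

Definition sgn (R : pzRingType) (e : bool) (x : R) : R := if e then - x else x.

Section Moment.
Context (T : rootedTree) (lt : childOrder T).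
Implicit Types (u v w : T).

(** The relation that the loop at v imposes in degree 0: the one of the Ginzburg
    algebra for k = 0 and the Legendrian one for k = 1.  The element F w stands
    for the closed path from v to its neighbour w and back. *)
Definition moment (R : pzRingType) (k : bool) v (F : T -> R) : Prop :=
  foldr (fun w acc => gl k (F w) acc) 0 (children lt v) = \sum_(u | away u v) F u.

Lemma moment_root (R : pzRingType) k (F : T -> R) :
  moment k (troot T) F <->
  foldr (fun w acc => gl k (F w) acc) 0 (children lt (troot T)) = 0.
Proof.
rewrite /moment big_pred0 // => u; apply/negbTE; exact: away_root.
Qed.

Lemma moment_parent (R : pzRingType) k v u (F : T -> R) : away u v ->
  moment k v F <-> foldr (fun w acc => gl k (F w) acc) 0 (children lt v) = F u.
Proof.
move=> h; rewrite /moment (bigD1 u) //= big1 ?addr0 // => u' /andP[h' /eqP[]].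
exact: away_inj h' h.
Qed.

Lemma perm_eq3 (U : eqType) (a b c : U) s : uniq [:: a; b; c] -> perm_eq s [:: a; b; c] ->
  s \in [:: [:: a; b; c]; [:: a; c; b]; [:: b; a; c]; [:: b; c; a]; [:: c; a; b]; [:: c; b; a]].
Proof.
move=> ua ps; have us : uniq s by rewrite (perm_uniq ps).
have ms := perm_mem ps; have := perm_size ps.
case: s us ms {ps} => [|x [|y [|z [|]]]] //= us ms _.
have := (ms x, ms y, ms z); rewrite !inE !eqxx ?orbT /= => -[[hx hy] hz].
move: us; rewrite !inE /= andbT negb_or.
case/esym/or3P: hx => /eqP ->; case/esym/or3P: hy => /eqP ->; case/esym/or3P: hz => /eqP ->;
  by rewrite ?eqxx ?andbF //= ?orbT.
Qed.

Lemma perm_eq2 (U : eqType) (a b : U) s : uniq [:: a; b] -> perm_eq s [:: a; b] ->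
  s = [:: a; b] \/ s = [:: b; a].
Proof.
move=> ua ps; have us : uniq s by rewrite (perm_uniq ps).
have ms := perm_mem ps; have := perm_size ps.
case: s us ms {ps} => [|x [|y [|]]] //= us ms _.
have := (ms x, ms y); rewrite !inE !eqxx ?orbT /= => -[hx hy].
move: us; rewrite !inE /= andbT.
case/esym/orP: hx => /eqP ->; case/esym/orP: hy => /eqP ->; rewrite ?eqxx // => _.
  by left.
by right.
Qed.

Lemma moment_isolated (R : pzRingType) k v (F : T -> R) :
  (forall w, tadj v w = false) -> moment k v F.
Proof.
move=> h; case: (@neighbours_cases T lt v [::]) => //.
  by case=> -> /perm_nilP e; apply/moment_root; rewrite e.
by case=> _ [u _ /perm_nilP].
Qed.

Lemma moment_leaf (R : pzRingType) k v u (F : T -> R) :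
  (forall w, tadj v w = (w == u)) -> moment k v F <-> F u = 0.
Proof.
move=> h; case: (@neighbours_cases T lt v [:: u]) => //.
- by move=> w; rewrite h inE.
- by case=> -> /perm_small_eq e; rewrite moment_root e //= glx0.
case=> _ [u' hu' /perm_small_eq] /(_ isT) [e1 e2]; subst u'.
rewrite (moment_parent _ _ hu') e2 /=.
by split=> [<-|->].
Qed.

(** Which case holds, and in which order, is a matter of the tree alone, whence
    the quantification over all rings inside the disjunction. *)
Lemma moment_two v u w : u != w -> (forall x, tadj v x = (x \in [:: u; w])) ->
  (v <> troot T /\ forall (R : pzRingType) k (F : T -> R), moment k v F <-> F u = F w) \/
  (v = troot T /\
   ((forall (R : pzRingType) k (F : T -> R), moment k v F <-> gl k (F u) (F w) = 0) \/
    (forall (R : pzRingType) k (F : T -> R), moment k v F <-> gl k (F w) (F u) = 0))).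
Proof.
move=> uw h; have us : uniq [:: u; w] by rewrite /= inE uw.
case: (neighbours_cases lt us h) => [[vr p]|[vr [x hx p]]]; [right|left]; split=> //.
  by case: (perm_eq2 us p) => e; [left|right] => R k F; rewrite vr moment_root -vr e /= glx0.
move=> R k F; rewrite (moment_parent _ _ hx).
by case: (perm_eq2 us p) => -[-> ->] /=; rewrite glx0; split=> ->.
Qed.

(** A summand of square zero can be moved across a formal sum by changing its
    sign, so all positions of the root and all orders of the children lead to a
    relation solved for the third loop.  Only the order and the signs e, e' of
    the other two depend on them. *)
Lemma moment_three v a b w : uniq [:: a; b; w] -> (forall x, tadj v x = (x \in [:: a; b; w])) ->
  exists a' b' e e', ((a', b') = (a, b) \/ (a', b') = (b, a)) /\
  forall (R : pzRingType) k (F : T -> R), F a * F a = 0 -> F b * F b = 0 ->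
    (moment k v F <-> F w = gl k (sgn e (F a')) (sgn e' (F b'))).
Proof.
move=> us h; have nn (R : pzRingType) (x : R) : x * x = 0 -> (- x) * (- x) = 0.
  by rewrite mulrNN.
case: (neighbours_cases lt us h) => [[vr p]|[vr [x hx p]]]; have := perm_eq3 us p; last first.
  rewrite !inE => /orP[|/orP[|/orP[|/orP[|/orP[]]]]] /eqP[ex ec].
  - exists b, a, true, false; split=> [|R k F ha hb]; first by right.
    by rewrite (moment_parent _ _ hx) ex ec /= glx0 gl_left.
  - exists a, b, false, true; split=> [|R k F ha hb]; first by left.
    by rewrite (moment_parent _ _ hx) ex ec /= glx0 gl_right.
  - exists a, b, true, false; split=> [|R k F ha hb]; first by left.
    by rewrite (moment_parent _ _ hx) ex ec /= glx0 gl_left.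
  - exists b, a, false, true; split=> [|R k F ha hb]; first by right.
    by rewrite (moment_parent _ _ hx) ex ec /= glx0 gl_right.
  - exists a, b, false, false; split=> [|R k F ha hb]; first by left.
    by rewrite (moment_parent _ _ hx) ex ec /= glx0; split=> ->.
  - exists b, a, false, false; split=> [|R k F ha hb]; first by right.
    by rewrite (moment_parent _ _ hx) ex ec /= glx0; split=> ->.
rewrite !inE => /orP[|/orP[|/orP[|/orP[|/orP[]]]]] /eqP ec;
  [exists b, a|exists a, b|exists a, b|exists b, a|exists b, a|exists a, b];
  exists true, true; (split=> [|R k F ha hb]; first by [left|right]);
  rewrite vr moment_root -vr ec /= glx0.
- by rewrite gl_left // glx0 gl_left.
- by rewrite gl_left // glx0 gl_right.
- by rewrite gl_left // glx0 gl_left.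
- by rewrite gl_left // glx0 gl_right.
- by rewrite glA gl_right // gl0x gl_right.
- by rewrite glA gl_right // gl0x gl_right.
Qed.

End Moment.

(** * Truncated geometric series *)

Section Geometric.
Context (R : pzRingType).
Implicit Types (x y : R).

Definition geo n x : R := \sum_(i < n) x ^+ i.

Lemma geo_comm n x y : GRing.comm x y -> GRing.comm (geo n x) y.
Proof.
move=> h; apply/commr_sym; apply: commr_sum => i _; apply: commrX; exact: commr_sym.
Qed.

Lemma geoK n x : x ^+ n = 0 -> (1 - x) * geo n x = 1.
Proof.
move=> h; apply: oppr_inj; rewrite -mulNr opprB.
by have := subrX1 x n; rewrite h sub0r.
Qed.

Lemma Kgeo n x : x ^+ n = 0 -> geo n x * (1 - x) = 1.
Proof.
move=> h; rewrite (@geo_comm n x (1 - x)) ?geoK //.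
by apply: commrB; [apply: commr1 | apply: commr_refl].
Qed.

(** Solving for x gives the power series - y/(1 + k y). *)
Lemma gl_inverse k n x y : y ^+ n = 0 -> (gl k x y = 0 \/ gl k y x = 0) ->
  x ^+ n = 0 /\ GRing.comm x y.
Proof.
move=> yn; pose t := - (y *+ k).
have tn : t ^+ n = 0 by rewrite /t exprNn exprMn_n yn mul0rn mulr0.
have ty : GRing.comm t y by rewrite /t; apply/commr_sym/commrN/commrMn/commr_refl.
have gy := geo_comm n ty.
have E : x = - (geo n t * y) -> x ^+ n = 0 /\ GRing.comm x y.
  move=> ->; split; first by rewrite exprNn exprMn_comm // yn mulr0 mulr0.
  by apply/commr_sym/commrN/commrM; [apply: commr_sym | apply: commr_refl].
case=> e; apply: E.
  have {}e : x * (1 - t) = - y.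
    apply/eqP; rewrite -addr_eq0; apply/eqP; rewrite -[RHS]e /gl /t opprK mulrDr mulr1.
    by rewrite -mulrnAr addrAC.
  by rewrite gy -mulNr -e -mulrA geoK // mulr1.
have {}e : (1 - t) * x = - y.
  apply/eqP; rewrite -addr_eq0; apply/eqP; rewrite -[RHS]e /gl /t opprK mulrDl mul1r.
  by rewrite -mulrnAl addrAC [x + y]addrC.
by rewrite -mulrN -e mulrA Kgeo // mul1r.
Qed.

End Geometric.

(** * Coordinates on Dynkin trees of types A and D *)

(** The vertices t 0, ..., t h form a path that starts at an end of the tree and
    does not branch before t h. *)
Record tail (T : rootedTree) (h : nat) (t : nat -> T) : Prop := Tail {
  tail_inj : forall i j, (i <= h)%N -> (j <= h)%N -> t i = t j -> i = j;
  tail_end : (0 < h)%N -> forall w, tadj (t 0%N) w = (w == t 1%N);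
  tail_mid : forall i, (i.+1 < h)%N -> forall w,
    tadj (t i.+1) w = (w \in [:: t i; t i.+2]) }.

Record coordA (T : rootedTree) (h : nat) (t : nat -> T) : Prop := CoordA {
  coordA_tail : tail h t;
  coordA_top : forall w, tadj (t h) w = (0 < h)%N && (w == t h.-1);
  coordA_cover : forall v, exists2 i, (i <= h)%N & v = t i }.

(** The trivalent vertex is t h.+1, and the two short legs are a and b. *)
Record coordD (T : rootedTree) (h : nat) (t : nat -> T) (a b : T) : Prop := CoordD {
  coordD_tail : tail h.+1 t;
  coordD_uniq : uniq [:: a; b; t h];
  coordD_top : forall w, tadj (t h.+1) w = (w \in [:: a; b; t h]);
  coordD_a : forall w, tadj a w = (w == t h.+1);
  coordD_b : forall w, tadj b w = (w == t h.+1);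
  coordD_cover : forall v, v = a \/ v = b \/ exists2 i, (i <= h.+1)%N & v = t i }.

Section Coordinates.
Context (T : rootedTree).

Lemma type_A_coord n : type_A T n -> exists h t, coordA h (t : nat -> T) /\
  exists2 r, (r <= h)%N & troot T = t r.
Proof.
case: n => [[]//|h] [_ [f [g fK gK] fe]]; exists h, (fun i => g (inord i)).
have eqt w j : (j <= h)%N -> (w == g (inord j)) = (f w == j :> nat).
  move=> jh; rewrite -(can_eq fK) gK; apply/eqP/eqP => [->|e]; first by rewrite inordK.
  by apply: val_inj; rewrite /= inordK.
have adjE i w : (i <= h)%N -> tadj (g (inord i)) w = (i.+1 == f w) || ((f w).+1 == i).
  by move=> ih; rewrite -fe gK /dynkinA inordK.
have fh w : (f w <= h)%N by rewrite -ltnS.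
have cover v : exists2 i, (i <= h)%N & v = g (inord i).
  by exists (f v); rewrite // inord_val fK.
split; last by [].
split=> //; last first.
  move=> w; rewrite adjE //; have := fh w.
  by rewrite eqt ?leq_pred //; lia.
split=> [i j ih jh /(can_inj gK)/(congr1 val)|h0 w|i ih w].
- by rewrite /= !inordK.
- by rewrite adjE // eqt //; lia.
- by rewrite adjE 1?ltnW // !inE !eqt //; lia.
Qed.

Lemma type_D_coord n : type_D T n -> exists h t a b, coordD h (t : nat -> T) a b.
Proof.
case: n => [|[|[|[|h]]]] [] // _ [f [g fK gK] fe].
exists h, (fun i => g (inord i)), (g (inord h.+2)), (g (inord h.+3)).
have eqt w j : (j <= h.+3)%N -> (w == g (inord j)) = (f w == j :> nat).
  move=> jh; rewrite -(can_eq fK) gK; apply/eqP/eqP => [->|e]; first by rewrite inordK.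
  by apply: val_inj; rewrite /= inordK.
pose E (i j : nat) := (i.+1 == j) && (j < h.+3)%N || (i == h.+1)%N && (j == h.+3).
have adjE i w : (i <= h.+3)%N -> tadj (g (inord i)) w = E i (f w) || E (f w) i.
  by move=> ih; rewrite -fe gK /dynkinD inordK // /E /= subn3.
have fh w : (f w <= h.+3)%N by rewrite -ltnS.
have inj i j : (i <= h.+3)%N -> (j <= h.+3)%N -> g (inord i) = g (inord j) -> i = j.
  by move=> ih jh /(can_inj gK)/(congr1 val); rewrite /= !inordK.
split.
- split=> [i j ih jh|h0 w|i ih w]; first by apply: inj; lia.
  + by rewrite adjE // eqt // /E; have := fh w; lia.
  + by rewrite adjE ?inE ?eqt /E; have := fh w; lia.
- rewrite /= !inE !negb_or andbT -andbA; apply/and3P; split; apply/eqP => /inj; lia.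
- by move=> w; rewrite adjE ?inE ?eqt /E; have := fh w; lia.
- by move=> w; rewrite adjE ?eqt /E; have := fh w; lia.
- by move=> w; rewrite adjE ?eqt /E; have := fh w; lia.
move=> v; have [e|n2] := eqVneq (f v : nat) h.+2.
  by left; apply/eqP; rewrite eqt // e.
right; have [e|n3] := eqVneq (f v : nat) h.+3; first by left; apply/eqP; rewrite eqt // e.
by right; exists (f v); [have := fh v; lia | rewrite inord_val fK].
Qed.

Lemma coordD_sym h (t : nat -> T) a b : coordD h t a b -> coordD h t b a.
Proof.
case=> ht us top ha hb cov; split=> //.
- by move: us; rewrite /= !inE !negb_or !andbT => /andP[/andP[n1 n2] n3]; rewrite eq_sym n1 n3.
- by move=> w; rewrite top !inE orbCA.
- by move=> v; case: (cov v) => [->|[->|h']]; [right; left|left|right; right].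
Qed.

Lemma coordD_notin_tail h (t : nat -> T) a b i : coordD h t a b -> (i <= h.+1)%N -> t i != a.
Proof.
move=> C ih; apply/eqP => e0; have ht := coordD_tail C.
have step j : (j <= h)%N -> t j = a -> j = h.
  move=> jh ej; have ad : tadj (t j) (t j.+1).
    case: j jh ej => [|j] jh _; first by rewrite (tail_end ht).
    by rewrite (tail_mid ht) // !inE eqxx orbT.
  by move: ad; rewrite ej (coordD_a C) => /eqP/(tail_inj ht) e1; have := e1 jh (leqnn _); lia.
move: ih; rewrite leq_eqVlt => /orP[/eqP e1|ih].
  by have := coordD_a C (t h.+1); rewrite -{1}e0 e1 tadj_irr eqxx.
have e1 := step i ih e0; subst i.
by have := coordD_uniq C; rewrite /= !inE e0 eqxx orbT.
Qed.

End Coordinates.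

(** * Long paths vanish *)

Section Rep.
Context (T : rootedTree) (lt : childOrder T) (R : pzRingType) (c : T -> T -> R).
Context (c_orth : forall u v w x, v != w -> c u v * c w x = 0).
Context (c_adj : forall u v, ~~ tadj v u -> c u v = 0).
Implicit Types (u v w : T) (x y z : R).

Definition loop v w : R := c v w * c w v.

Lemma loopX v w n : loop v w ^+ n.+1 = c v w * loop w v ^+ n * c w v.
Proof.
rewrite /loop; elim: n => [|n IH]; first by rewrite expr1 expr0 mulr1.
by rewrite exprS IH [in RHS]exprS !mulrA.
Qed.

Definition dart_prod (s : seq (T * T)) : R := \prod_(p <- s) c p.1 p.2.

Definition killed n y : Prop := forall s, size s = n -> dart_prod s * y = 0.

Definition Ann y : Prop := exists n, killed n y.

Lemma killed_le m n y : killed m y -> (m <= n)%N -> killed n y.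
Proof.
move=> h mn s e; rewrite /dart_prod -(cat_take_drop (n - m) s) big_cat /= -mulrA.
by rewrite [X in _ * X]h ?mulr0 // size_drop e subKn.
Qed.

Lemma Ann0 : Ann 0.
Proof. by exists 0%N => s _; rewrite mulr0. Qed.

Lemma AnnD x y : Ann x -> Ann y -> Ann (x + y).
Proof.
move=> [m hx] [n hy]; exists (maxn m n) => s e; rewrite mulrDr.
by rewrite (killed_le hx (leq_maxl _ _) e) (killed_le hy (leq_maxr _ _) e) addr0.
Qed.

Lemma AnnN x : Ann x -> Ann (- x).
Proof. by move=> [m hx]; exists m => s e; rewrite mulrN hx // oppr0. Qed.

Lemma AnnMn x (k : bool) : Ann x -> Ann (x *+ k).
Proof. by case: k => // _; exact: Ann0. Qed.

Lemma Ann_c u v y : Ann y -> Ann (c u v * y).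
Proof.
move=> [m h]; exists m => s e; rewrite mulrA.
suff -> : dart_prod s * c u v = dart_prod (rcons s (u, v)).
  by apply: (killed_le h (leqnSn m)); rewrite size_rcons e.
by rewrite /dart_prod -cats1 big_cat big_seq1.
Qed.

Lemma Ann_loop u v y : Ann y -> Ann (loop u v * y).
Proof. by move=> h; rewrite /loop -mulrA; do 2!apply: Ann_c. Qed.

Definition at_vertex v y : Prop := forall u w, w != v -> c u w * y = 0.

Lemma at_c u v y : at_vertex u (c u v * y).
Proof. by move=> w x n; rewrite mulrA c_orth ?mul0r. Qed.

Lemma at_loop v w y : at_vertex v (loop v w * y).
Proof. by rewrite /loop -mulrA; apply: at_c. Qed.

Lemma Ann_step v y : at_vertex v y -> (forall w, tadj v w -> Ann (c w v * y)) -> Ann y.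
Proof.
move=> hy H; have /fin_all_exists[n hn] w : exists n, killed n (c w v * y).
  case: (boolP (tadj v w)) => [/H //|n]; exists 0%N => s _.
  by rewrite c_adj // mul0r mulr0.
exists (\max_w n w).+1 => s; case/lastP: s => // s [w u]; rewrite size_rcons => -[e].
rewrite /dart_prod -cats1 big_cat big_seq1 /= -mulrA.
have [->|nu] := eqVneq u v; last by rewrite hy ?mulr0.
by apply: (killed_le (hn w) _ e); apply: leq_bigmax.
Qed.

Context (k : bool) (rel : forall v, moment lt k v (loop v)).

Section Tail.
Context (h : nat) (t : nat -> T) (ht : tail h t).

Lemma tail_rel i : (i.+1 < h)%N ->
  loop (t i.+1) (t i) = loop (t i.+1) (t i.+2) \/
  gl k (loop (t i.+1) (t i)) (loop (t i.+1) (t i.+2)) = 0 \/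
  gl k (loop (t i.+1) (t i.+2)) (loop (t i.+1) (t i)) = 0.
Proof.
move=> ih; have ne : t i != t i.+2.
  by apply/eqP => /(tail_inj ht); rewrite (leq_trans (leqnSn i) (ltnW ih)) ih => /(_ isT isT); lia.
have := rel (t i.+1).
case: (moment_two lt ne (tail_mid ht ih)) => [[_ ->]|[_ [->|->]]]; first by left.
  by right; left.
by right; right.
Qed.

(** Going around the edge the other way raises the order of nilpotency by one,
    and crossing a bivalent vertex preserves it. *)
Lemma tail_nil i : (i < h)%N ->
  loop (t i) (t i.+1) ^+ i.+1 = 0 /\ loop (t i.+1) (t i) ^+ i.+2 = 0.
Proof.
elim: i => [|i IH] ih.
  have e : loop (t 0%N) (t 1%N) = 0 by apply/(moment_leaf lt k _ (tail_end ht ih)).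
  by rewrite expr1 loopX e expr1 mulr0 mul0r.
have [_ r] := IH (ltnW ih).
suff e : loop (t i.+1) (t i.+2) ^+ i.+2 = 0 by rewrite e loopX e mulr0 mul0r.
case: (tail_rel ih) => [<- //|e].
by case: (gl_inverse (k := k) r (x := loop (t i.+1) (t i.+2))) => //; case: e; [right|left].
Qed.

(** At a bivalent vertex the loop towards the end of the tail is a multiple of the
    loop away from it.  When they are related by a formal sum in the unfavourable
    order, nilpotency makes them commute. *)
Lemma tail_Ann_back i y : (i.+1 < h)%N ->
  Ann (loop (t i.+1) (t i.+2) * y) -> Ann (loop (t i.+1) (t i) * y).
Proof.
move=> ih hy; have [_ r] := tail_nil (ltnW ih).
suff [-> //|E] : loop (t i.+1) (t i) = loop (t i.+1) (t i.+2) \/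
    gl k (loop (t i.+1) (t i)) (loop (t i.+1) (t i.+2)) = 0.
  have : (gl k (loop (t i.+1) (t i)) (loop (t i.+1) (t i.+2))) * y = 0 by rewrite E mul0r.
  rewrite /gl !mulrDl -addrA => /eqP; rewrite addr_eq0 => /eqP ->.
  by apply: AnnN; apply: AnnD => //; rewrite mulrnAl -mulrA; apply: AnnMn; apply: Ann_loop.
case: (tail_rel ih) => [|[|e]]; [by left|by right|right].
have [|_ cm] := gl_inverse (k := k) r (x := loop (t i.+1) (t i.+2)); first by left.
by rewrite -[RHS]e /gl cm [X in X + _]addrC.
Qed.

(** Only the arrow from t i to t i.+1 has to be tested.  By induction on i, a long
    path that leaves in the other direction comes back to t i, and so runs
    through the loop of tail_Ann_back. *)
Lemma tail_Ann i y : (i < h)%N -> at_vertex (t i) y ->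
  Ann (c (t i.+1) (t i) * y) -> Ann y.
Proof.
elim: i y => [|i IH] y ih hy up; apply: (Ann_step hy) => w.
  by rewrite (tail_end ht) // => /eqP ->.
rewrite (tail_mid ht) // !inE => /orP[|] /eqP -> //.
apply: IH; [exact: ltnW|exact: at_c|rewrite mulrA].
by apply: tail_Ann_back => //; rewrite /loop -mulrA; apply: Ann_c.
Qed.

Lemma tail_Ann_all : (forall y, at_vertex (t h) y -> Ann y) ->
  forall i, (i <= h)%N -> forall y, at_vertex (t i) y -> Ann y.
Proof.
move=> top i ih; rewrite -(subKn ih); elim: (h - i)%N (leq_subr i h) => [|j IH] jh.
  by rewrite subn0.
move=> y hy; apply: tail_Ann hy _; first by lia.
by apply: IH; [lia | rewrite -subSn // subSS; apply: at_c].
Qed.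

End Tail.

(** At the far end of the tail the remaining loop vanishes. *)
Lemma coordA_Ann h (t : nat -> T) : coordA h t -> forall v y, at_vertex v y -> Ann y.
Proof.
move=> C v y; have [i ih ->] := coordA_cover C v; have ht := coordA_tail C.
move: i ih y; apply: (tail_Ann_all ht) => y hy; apply: (Ann_step hy) => w.
rewrite (coordA_top C) => /andP[h0 /eqP ->]; case: h h0 C ht hy => //= h _ C ht hy.
apply: (tail_Ann ht (i := h)) => //; first exact: at_c.
rewrite mulrA -/(loop _ _).
have -> : loop (t h.+1) (t h) = 0; last by rewrite mul0r; apply: Ann0.
by apply/(moment_leaf lt k _ (coordA_top C)).
Qed.

Section TrivalentVertex.
Context (h : nat) (t : nat -> T) (a b : T) (C : coordD h t a b).
Local Notation hub := (t h.+1).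

Lemma leaf_loop v : (forall w, tadj v w = (w == hub)) -> loop v hub = 0.
Proof. by move=> hv; apply/(moment_leaf lt k _ hv). Qed.

Lemma leaf_square v : (forall w, tadj v w = (w == hub)) -> loop hub v * loop hub v = 0.
Proof. by move=> hv; rewrite -expr2 loopX expr1 leaf_loop // mulr0 mul0r. Qed.

Lemma square0_anticomm x y : x * x = 0 -> y * y = 0 ->
  GRing.comm (x * y + y * x) x /\ GRing.comm (x * y + y * x) y.
Proof.
move=> hx hy; split; rewrite /GRing.comm mulrDl mulrDr -!mulrA ?hx ?hy !mulrA ?hx ?hy.
  by rewrite !mul0r mulr0 !add0r addr0.
by rewrite !mul0r mulr0 !addr0 add0r.
Qed.

(** If x and y square to 0 and z is their formal sum, then xy + yx is z times
    an element that commutes with z, namely the negative of the formal sum of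
    - y and - x. *)
Lemma square0_nilpotent n x y : x * x = 0 -> y * y = 0 -> gl k x y ^+ n = 0 ->
  (x * y + y * x) ^+ n = 0.
Proof.
move=> hx hy; pose z := gl k x y; pose tau := x * y + y * x; rewrite -/tau -/z => zn.
have [tx ty] := square0_anticomm hx hy; rewrite -/tau in tx ty.
have tz : GRing.comm tau z.
  by rewrite /z /gl; do 2?[apply: commrD]; rewrite //; apply/commrMn/commrM.
have e : tau = z * (z - tau *+ k).
  have yy (u : R) : u * y * y = 0 by rewrite -mulrA hy mulr0.
  have -> : z - tau *+ k = x + y - (y * x) *+ k.
    by rewrite /z /gl /tau mulrnDl opprD addrA addrK.
  rewrite /z /gl /tau; case: (k); last first.
    by rewrite !mulr0n subr0 addr0 mulrDl !mulrDr hx hy add0r addr0.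
  rewrite !mulr1n mulrBr !mulrDr !mulrDl !mulrA hx hy !yy !mul0r !add0r !addr0.
  by rewrite addrAC addrK addrC.
rewrite e exprMn_comm ?zn ?mul0r //.
by apply: commrB; [apply: commr_refl | apply/commrMn/commr_sym].
Qed.

(** Bouncing alternately between x and y is multiplication by xy + yx, so it
    can only go on for a bounded time. *)
Lemma trivalent_Ann n x y (P : R -> Prop) : x * x = 0 -> y * y = 0 -> gl k x y ^+ n = 0 ->
  (forall u : R, P (x * u)) -> (forall u : R, P (y * u)) ->
  (forall u : R, P u -> Ann (x * u) -> Ann (y * u) -> Ann u) ->
  forall u : R, P u -> Ann u.
Proof.
move=> hx hy zn Px Py step u Pu.
have tn := square0_nilpotent hx hy zn.
have [tx ty] := square0_anticomm hx hy; pose tau := x * y + y * x.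
rewrite -/tau in tn tx ty.
have xtx (w : R) : x * (y * (x * w)) = x * (tau * w).
  by rewrite /tau !mulrA mulrDr !mulrA hx mul0r add0r.
have yty (w : R) : y * (x * (y * w)) = y * (tau * w).
  by rewrite /tau !mulrA mulrDr !mulrA hy mul0r addr0.
have xx (w : R) : x * (x * w) = 0 by rewrite mulrA hx mul0r.
have yy (w : R) : y * (y * w) = 0 by rewrite mulrA hy mul0r.
have key j : forall m, (n <= m + j)%N -> Ann (x * (tau ^+ m * u)) /\ Ann (y * (tau ^+ m * u)).
  elim: j => [|j IH] m mj.
    rewrite addn0 in mj; rewrite -(subnK mj) exprD tn mulr0 mul0r !mulr0.
    by split; apply: Ann0.
  have [|IHx IHy] := IH m.+1; first by rewrite addSnnS.
  rewrite exprS -!mulrA in IHx IHy; split.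
    apply: (step); rewrite ?xx //; first exact: Ann0.
    by apply: (step); rewrite ?yy ?xtx //; apply: Ann0.
  apply: (step); rewrite ?yy //; last exact: Ann0.
  by apply: (step); rewrite ?xx ?yty //; apply: Ann0.
by have [] := key n 0%N (leqnn n); rewrite expr0 mul1r; apply: (step).
Qed.

(** The loop along the tail is a formal sum of the two short loops, so only paths
    through the short legs matter, and those are handled by trivalent_Ann. *)
Lemma coordD_hub_Ann y : at_vertex hub y -> Ann y.
Proof.
have ht := coordD_tail C.
have [a' [b' [e [e' [ab rel']]]]] := moment_three lt (coordD_uniq C) (coordD_top C).
have [xa xb] := (leaf_square (coordD_a C), leaf_square (coordD_b C)).
have relC : loop hub (t h) = gl k (sgn e (loop hub a')) (sgn e' (loop hub b')).
  by apply/rel'.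
have [ha hb] : (forall w, tadj a' w = (w == hub)) /\ (forall w, tadj b' w = (w == hub)).
  by case: ab => -[-> ->]; split; move=> w; rewrite ?(coordD_a C) ?(coordD_b C).
have sq d z : z * z = 0 -> sgn d z * sgn d z = 0 :> R by case: d; rewrite /sgn ?mulrNN.
have [sa sb] := (sq e _ (leaf_square ha), sq e' _ (leaf_square hb)).
have [_ zn] := tail_nil ht (ltnSn h); rewrite relC in zn.
apply: (trivalent_Ann sa sb zn) => [u|u|u hu ua ub].
- by rewrite /sgn; case: (e); rewrite ?mulNr -?mulrN; apply: at_loop.
- by rewrite /sgn; case: (e'); rewrite ?mulNr -?mulrN; apply: at_loop.
have un d z : Ann (sgn d z * u) -> Ann (z * u).
  by case: d; rewrite /sgn ?mulNr // => /AnnN; rewrite opprK.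
have leaf v : (forall w, tadj v w = (w == hub)) -> Ann (loop hub v * u) -> Ann (c v hub * u).
  move=> hv hl; apply: (Ann_step (@at_c v hub u)) => w; rewrite hv => /eqP ->.
  by rewrite mulrA.
have la := leaf _ ha (un _ _ ua); have lb := leaf _ hb (un _ _ ub).
apply: (Ann_step hu) => w; rewrite (coordD_top C) !inE.
have [ca cb] : Ann (c a hub * u) /\ Ann (c b hub * u) by case: ab la lb => -[-> ->].
case/or3P => /eqP -> //; apply: (tail_Ann ht (i := h)) => //; first exact: at_c.
rewrite mulrA -/(loop _ _) relC /gl !mulrDl mulrnAl -mulrA.
do 2?[apply: AnnD] => //; apply: AnnMn.
by rewrite /sgn; case: (e); rewrite ?mulNr; [apply: AnnN|]; apply: Ann_loop.
Qed.

Lemma coordD_Ann v y : at_vertex v y -> Ann y.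
Proof.
case: (coordD_cover C v) => [->|[->|[i ih ->]]] hy.
- by apply: (Ann_step hy) => w; rewrite (coordD_a C) => /eqP ->; apply/coordD_hub_Ann/at_c.
- by apply: (Ann_step hy) => w; rewrite (coordD_b C) => /eqP ->; apply/coordD_hub_Ann/at_c.
exact: (tail_Ann_all (coordD_tail C) coordD_hub_Ann ih).
Qed.

End TrivalentVertex.
End Rep.

(** * A product of unipotent elements *)

(** Instances for the tactic non_commutative_ring. *)
Section NcRing.
Context (R : pzRingType).
#[local] Instance nc_ops : @Ring_ops R 0 1 +%R *%R (fun x y : R => x - y) -%R (@eq R).
Defined.
#[local] Instance nc_ring : @Ring R 0 1 +%R *%R (fun x y : R => x - y) -%R (@eq R) nc_ops.
Proof.
constructor.
- exact: RelationClasses.eq_equivalence.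
- by move=> x y -> u v ->.
- by move=> x y -> u v ->.
- by move=> x y -> u v ->.
- by move=> x y ->.
- exact: add0r.
- exact: addrC.
- exact: addrA.
- exact: mul1r.
- exact: mulr1.
- exact: mulrA.
- exact: mulrDl.
- move=> x y z; exact: mulrDr.
- by [].
- exact: subrr.
Qed.
End NcRing.
#[local] Existing Instance nc_ops.
#[local] Existing Instance nc_ring.

Section Unipotent.
Context (R : pzRingType).
Implicit Types (x y z : R).

Lemma square0_sum x y : x * x = 0 -> y * y = 0 -> (x + y) * (x + y) = x * y + y * x.
Proof. by move=> hx hy; rewrite mulrDl !mulrDr hx hy add0r addr0. Qed.

Lemma mulr4n x : x *+ 4 = x + x + x + x.
Proof. by rewrite !mulrS mulr0n addr0 !addrA. Qed.

Lemma unipotent_conj x y (z := x + y) : x * x = 0 -> y * y = 0 ->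
  (1 + y) * x * (1 - y) + (1 + y) * x * (1 - y) =
  (1 - z * z) * z + (x - y) * ((1 - z) * (1 - z)).
Proof.
move=> hx hy; rewrite /z.
transitivity ((1 - (x + y) * (x + y)) * (x + y) + (x - y) * ((1 - (x + y)) * (1 - (x + y)))
   + ((x * x - y * y + y * (x * x) + (y * y) * x + (y * y) * y)
    + (x * x - y * y + y * (x * x) + (y * y) * x + (y * y) * y))).
  by non_commutative_ring.
by rewrite hx hy !(mul0r, mulr0, subr0, addr0).
Qed.

(** X and Y are conjugates of x and y, rescaled by al = 1/(1 - z^4).  The claim
    says that (1 + 4X)(1 + 4Y) is the square of the Cayley transform of z.  Let
    d = x - y, which anticommutes with z and squares to - z^2.  Multiplied by
    1 - z^4, the two factors become s a + 2 d a' and s a - 2 d a, where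
    s = 1 - z^2, a = (1 + z)^2 and a' = (1 - z)^2; the mixed terms of their
    product cancel. *)
Lemma unipotent_product x y al g (z := x + y)
    (X := al * ((1 + y) * x * (1 - y))) (Y := al * ((1 - x) * y * (1 + x))) :
  x * x = 0 -> y * y = 0 ->
  GRing.comm al x -> GRing.comm al y -> al * (1 - z * z * (z * z)) = 1 ->
  GRing.comm g z -> (1 - z) * g = 1 ->
  gl true (X *+ 4) (Y *+ 4) = (g * g * z) *+ 4.
Proof.
move=> hx hy ax ay aK gz gK.
have az : GRing.comm al z by apply: commrD.
pose d := x - y; pose s := 1 - z * z; pose a := (1 + z) * (1 + z).
pose a' := (1 - z) * (1 - z).
have zd : z * d = - (d * z).
  transitivity (- (d * z) + ((x * x - y * y) + (x * x - y * y))).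
    by rewrite /z /d; non_commutative_ring.
  by rewrite hx hy subr0 !addr0.
have dd : d * d = - (z * z).
  transitivity (- (z * z) + ((x * x + y * y) + (x * x + y * y))).
    by rewrite /z /d; non_commutative_ring.
  by rewrite hx hy !addr0.
have ad : a * d = d * a'.
  rewrite /a /a'; transitivity (d + z * d + z * d + z * (z * d)); first by non_commutative_ring.
  rewrite zd; transitivity (d - d * z - d * z - (z * d) * z); first by non_commutative_ring.
  by rewrite zd; non_commutative_ring.
have a'd : a' * d = d * a.
  rewrite /a /a'; transitivity (d - z * d - z * d + z * (z * d)); first by non_commutative_ring.
  rewrite zd; transitivity (d + d * z + d * z - (z * d) * z); first by non_commutative_ring.
  by rewrite zd; non_commutative_ring.
have sd : s * d = d * s.
  rewrite /s; transitivity (d - z * (z * d)); first by non_commutative_ring.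
  rewrite zd; transitivity (d + (z * d) * z); first by non_commutative_ring.
  by rewrite zd; non_commutative_ring.
pose p := s * a + (d * a' + d * a'); pose q := s * a - (d * a + d * a).
have pq : p * q = (1 + z * z) * (1 + z * z) * (a * a).
  have sa' : s * a' = a' * s by rewrite /s /a'; non_commutative_ring.
  transitivity (s * a * (s * a) - (s * (a * d) * a + s * (a * d) * a)
    + (d * (a' * s) * a + d * (a' * s) * a)
    - (d * (a' * d) * a + d * (a' * d) * a + d * (a' * d) * a + d * (a' * d) * a)).
    by rewrite /p /q; non_commutative_ring.
  rewrite ad a'd -sa' (mulrA s d) sd !(mulrA d d) dd.
  transitivity (s * a * (s * a) + z * z * a * a + z * z * a * a + z * z * a * a + z * z * a * a).
    by non_commutative_ring.
  by rewrite /s /a; non_commutative_ring.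
have X4 : 1 + X *+ 4 = al * p.
  have h := unipotent_conj hx hy; rewrite -/z -/s -/d -/a' in h.
  rewrite mulr4n /X -{1}aK.
  transitivity (al * (1 - z * z * (z * z) + ((1 + y) * x * (1 - y) + (1 + y) * x * (1 - y))
     + ((1 + y) * x * (1 - y) + (1 + y) * x * (1 - y)))); first by non_commutative_ring.
  by rewrite h /p /a /s; congr (al * _); non_commutative_ring.
have Y4 : 1 + Y *+ 4 = al * q.
  have hx' : - x * - x = 0 by rewrite mulrNN.
  have hy' : - y * - y = 0 by rewrite mulrNN.
  have h := unipotent_conj hy' hx'.
  have e : - y + - x = - z by rewrite /z opprD addrC.
  rewrite e !opprK in h.
  rewrite mulr4n /Y -{1}aK.
  transitivity (al * (1 - z * z * (z * z) - ((1 - x) * (- y) * (1 + x) + (1 - x) * (- y) * (1 + x))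
     - ((1 - x) * (- y) * (1 + x) + (1 - x) * (- y) * (1 + x)))); first by non_commutative_ring.
  rewrite h /q /a /s; congr (al * _).
  have -> : - y + x = d by rewrite addrC.
  by non_commutative_ring.
have commQ : al * q = q * al.
  have e u v : GRing.comm al u -> GRing.comm al v -> GRing.comm al (u * v) by apply: commrM.
  have cd : GRing.comm al d by apply: commrB.
  have ca : GRing.comm al a by apply: e; apply: commrD => //; apply: commr1.
  have cs : GRing.comm al s by apply: commrB; [apply: commr1 | apply: e].
  by apply: commrB; [apply: e | apply: commrD; apply: e].
pose b := al * (1 + z * z) * (1 + z).
have bg : b = g.
  rewrite -[LHS]mulr1 -gK mulrA; suff -> : b * (1 - z) = 1 by rewrite mul1r.
  by rewrite -[RHS]aK /b; non_commutative_ring.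
suff e : 1 + gl true (X *+ 4) (Y *+ 4) = 1 + (g * g * z) *+ 4 by apply: addrI e.
have -> : 1 + gl true (X *+ 4) (Y *+ 4) = (1 + X *+ 4) * (1 + Y *+ 4).
  by rewrite /gl mulr1n; non_commutative_ring.
rewrite X4 Y4 commQ mulrA -(mulrA al) pq.
have zb : z * al = al * z by rewrite -az.
transitivity (b * b * ((1 - z) * (1 - z) + z + z + z + z)).
  rewrite /b /a.
  have cz : GRing.comm al ((1 + z * z) * (1 + z * z) * (((1 + z) * (1 + z)) * ((1 + z) * (1 + z)))).
    by repeat (first [exact: az | exact: commr1 | apply: commrM | apply: commrD]).
  rewrite -mulrA -cz.
  have cz' : GRing.comm al ((1 + z * z) * (1 + z)).
    by repeat (first [exact: az | exact: commr1 | apply: commrM | apply: commrD]).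
  rewrite -[al * (1 + z * z) * (1 + z)]mulrA.
  transitivity (al * ((al * ((1 + z * z) * (1 + z))) * ((1 + z * z) * (1 + z)) *
    ((1 - z) * (1 - z) + z + z + z + z))); first by non_commutative_ring.
  by rewrite {1}cz'; non_commutative_ring.
rewrite bg mulr4n.
have -> : g * g * ((1 - z) * (1 - z) + z + z + z + z) =
   g * (g * (1 - z)) * (1 - z) + (g * g * z + g * g * z + g * g * z + g * g * z).
  by non_commutative_ring.
have gK' : g * (1 - z) = 1 by rewrite -[RHS]gK mulrBl mulrBr mulr1 mul1r gz.
by rewrite gK' mulr1 gK'.
Qed.

End Unipotent.

(** * Loops reparametrised by power series *)

Section Reparametrisation.
Context (R : pzRingType).
Implicit Types (x y q : R) (m n : nat).

(** The power series of 1/(1 - q x)^m, truncated: it is only used when x ^+ n = 0. *)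
Definition repar n q m x : R := geo n (q * x) ^+ m.

Lemma geo_intertwine n x y u : u * x = y * u -> u * geo n x = geo n y * u.
Proof.
move=> h; rewrite /geo mulr_sumr mulr_suml; apply: eq_bigr => i _.
by elim: (i : nat) => [|j IH]; rewrite ?mulr1 ?mul1r // !exprS mulrA h -!mulrA IH.
Qed.

Lemma repar_intertwine n q m x y u : GRing.comm q u -> u * x = y * u ->
  u * repar n q m x = repar n q m y * u.
Proof.
move=> qu h; have e : u * (q * x) = q * y * u by rewrite mulrA -qu -!mulrA h.
rewrite /repar; elim: m => [|m IH]; first by rewrite mulr1 mul1r.
by rewrite !exprS mulrA (geo_intertwine n e) -!mulrA IH.
Qed.

Lemma nil_mul n q x : GRing.comm q x -> x ^+ n = 0 -> (q * x) ^+ n = 0.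
Proof. by move=> h xn; rewrite exprMn_comm // xn mulr0. Qed.

(** At a bivalent root the additive relation makes the two loops opposite; this
    is the multiplicative relation for the reparametrised loops, in either
    order. *)
Definition opposite_repar n q m m' : Prop := forall x, x ^+ n = 0 ->
  gl true (repar n q m x * x) (repar n q m' (- x) * - x) = 0 /\
  gl true (repar n q m' (- x) * - x) (repar n q m x * x) = 0.

(** Here 1 + x/(1 - x) = 1/(1 - x) is inverse to 1 - x. *)
Lemma opposite_repar10 n : opposite_repar n 1 1 0.
Proof.
move=> x xn; rewrite /repar expr1 expr0 !mul1r /gl !mulr1n.
have h := Kgeo xn; have h' := geoK xn.
have hx : geo n x * x = geo n x - 1 by rewrite -h; non_commutative_ring.
have xh : x * geo n x = geo n x - 1 by rewrite -h'; non_commutative_ring.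
split.
  transitivity ((geo n x * x - x) * (1 - x) - x * x); first by non_commutative_ring.
  rewrite hx; transitivity (geo n x * (1 - x) - 1); last by rewrite h subrr.
  by non_commutative_ring.
transitivity (geo n x * x - x - (x * geo n x) * x); first by non_commutative_ring.
by rewrite xh; non_commutative_ring.
Qed.

(** With y = x/4 one has 1 + x/(1 - y)^2 = ((1 + y)/(1 - y))^2, whose inverse is
    obtained by changing the sign of x. *)
Lemma opposite_repar22 n q : (forall x, GRing.comm q x) -> q *+ 4 = 1 ->
  opposite_repar n q 2 2.
Proof.
move=> qc q4 x xn; pose y := q * x.
have yn : y ^+ n = 0 by apply: nil_mul.
have yn' : (- y) ^+ n = 0 by rewrite exprNn yn mulr0.
have x4 : x = y + y + y + y by rewrite /y -!mulrDl -mulr4n q4 mul1r.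
rewrite /repar (mulrN q) -/y; set g := geo n y; set g' := geo n (- y).
have [K1 K2] : (1 - y) * g = 1 /\ g * (1 - y) = 1 by split; [apply: geoK | apply: Kgeo].
have [K3 K4] : (1 - - y) * g' = 1 /\ g' * (1 - - y) = 1 by split; [apply: geoK | apply: Kgeo].
rewrite opprK in K3 K4.
have e1 : 1 + g ^+ 2 * x = (g * (1 + y)) * (g * (1 + y)).
  have gy : g * y = y * g by apply: geo_comm.
  transitivity (g * (g * (1 - y)) * (1 - y) + g ^+ 2 * x).
    by rewrite K2 mulr1 K2.
  rewrite x4 expr2; transitivity (g * g * ((1 + y) * (1 + y))); first by non_commutative_ring.
  transitivity (g * ((1 + y) * g) * (1 + y)); last by non_commutative_ring.
  have -> : (1 + y) * g = g * (1 + y) by rewrite mulrDl mul1r -gy; non_commutative_ring.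
  by non_commutative_ring.
have e2 : 1 + g' ^+ 2 * - x = (g' * (1 - y)) * (g' * (1 - y)).
  have gy : g' * y = y * g' by apply: geo_comm; apply/commr_sym/commrN.
  transitivity (g' * (g' * (1 + y)) * (1 + y) + g' ^+ 2 * - x).
    by rewrite K4 mulr1 K4.
  rewrite x4 expr2; transitivity (g' * g' * ((1 - y) * (1 - y))); first by non_commutative_ring.
  transitivity (g' * ((1 - y) * g') * (1 - y)); last by non_commutative_ring.
  have -> : (1 - y) * g' = g' * (1 - y) by rewrite mulrBl mul1r -gy; non_commutative_ring.
  by non_commutative_ring.
have c1 : (g * (1 + y)) * (g' * (1 - y)) = 1.
  rewrite -mulrA (mulrA (1 + y)) K3 mul1r; exact: K2.
have c2 : (g' * (1 - y)) * (g * (1 + y)) = 1.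
  rewrite -mulrA (mulrA (1 - y)) K1 mul1r; exact: K4.
have E u v : 1 + gl true u v = (1 + u) * (1 + v) by rewrite /gl mulr1n; non_commutative_ring.
split; apply: (@addrI _ 1); rewrite E addr0 e1 e2.
  by rewrite -mulrA (mulrA (g * (1 + y)) (g' * _)) c1 mul1r c1.
by rewrite -mulrA (mulrA (g' * (1 - y)) (g * _)) c2 mul1r c2.
Qed.

End Reparametrisation.

(** * Multiplicative relations from additive ones *)

Section Deform.
Context (T : rootedTree) (lt : childOrder T) (R : pzRingType) (c c' : T -> T -> R).
Context (rel : forall v, moment lt false v (loop c v)).
Implicit Types (u v w : T) (x y z : R).

Section DeformTail.
Context (h : nat) (t : nat -> T) (ht : tail h t) (n : nat) (hn : (h < n)%N).
Context (q : R) (qc : forall x, GRing.comm q x) (m : nat -> nat).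
Context (c'_up : forall i, (i < h)%N ->
  c' (t i) (t i.+1) = repar n q (m i) (loop c (t i) (t i.+1)) * c (t i) (t i.+1)).
Context (c'_down : forall i, (i < h)%N -> c' (t i.+1) (t i) = c (t i.+1) (t i)).
Context (m_nonroot : forall i, (i.+1 < h)%N -> t i.+1 <> troot T -> m i = m i.+1).
Context (m_root : forall i, (i.+1 < h)%N -> t i.+1 = troot T ->
  opposite_repar n q (m i) (m i.+1)).

Lemma deform_up i : (i < h)%N ->
  loop c' (t i) (t i.+1) = repar n q (m i) (loop c (t i) (t i.+1)) * loop c (t i) (t i.+1).
Proof. by move=> ih; rewrite /loop c'_up // c'_down // -mulrA. Qed.

Lemma deform_down i : (i < h)%N ->
  loop c' (t i.+1) (t i) = repar n q (m i) (loop c (t i.+1) (t i)) * loop c (t i.+1) (t i).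
Proof.
move=> ih; rewrite /loop c'_up // c'_down // mulrA.
by rewrite (@repar_intertwine _ n q (m i) _ (loop c (t i.+1) (t i))) /loop ?mulrA.
Qed.

Lemma tail_nil_n i : (i < h)%N -> loop c (t i.+1) (t i) ^+ n = 0.
Proof.
move=> ih; have [_ e] := tail_nil rel ht ih.
have ni : (i.+2 <= n)%N by apply: leq_ltn_trans hn.
by rewrite -(subnK ni) exprD e mulr0.
Qed.

Lemma deform_tail i : (i < h)%N -> moment lt true (t i) (loop c' (t i)).
Proof.
case: i => [|i] ih.
  have e := tail_end ht ih; apply/(moment_leaf lt true _ e); rewrite deform_up //.
  by have /(moment_leaf lt false _ e) -> := rel (t 0%N); rewrite mulr0.
have ne : t i != t i.+2.
  by apply/eqP => /(tail_inj ht); rewrite (leq_trans (leqnSn i) (ltnW ih)) ih => /(_ isT isT); lia.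
have r := rel (t i.+1); have xn := tail_nil_n (ltnW ih).
case: (moment_two lt ne (tail_mid ht ih)) => [[nr H]|[r0 H]].
  by apply/H; rewrite deform_up // deform_down ?(ltnW ih) // -(m_nonroot ih nr); have /H -> := r.
have e : loop c (t i.+1) (t i.+2) = - loop c (t i.+1) (t i).
  apply/eqP; rewrite -addr_eq0; apply/eqP.
  case: H => H; have /H := r; rewrite /gl mulr0n addr0 //.
  by rewrite addrC.
have [o1 o2] := m_root ih r0 xn.
by case: H => H; apply/H; rewrite deform_up // deform_down ?(ltnW ih) // e.
Qed.

End DeformTail.

Section DeformHub.
Context (h : nat) (t : nat -> T) (a b : T) (C : coordD h t a b) (n : nat) (hn : (h.+1 < n)%N).
Context (q : R) (qc : forall x, GRing.comm q x) (q4 : q *+ 4 = 1).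
Local Notation hub := (t h.+1).
Context (e e' : bool).
Context (hub_rel : loop c hub (t h) = sgn e (loop c hub a) + sgn e' (loop c hub b)).
Let x := q * sgn e (loop c hub a).
Let y := q * sgn e' (loop c hub b).
Let al := geo n ((x + y) * (x + y) * ((x + y) * (x + y))).
Context (c'_down : c' hub (t h) = c hub (t h)).
Context (c'_up : c' (t h) hub = repar n q 2 (loop c (t h) hub) * c (t h) hub).
Context (c'_ha : c' hub a = al * (1 + y) * c hub a) (c'_ah : c' a hub = c a hub * (1 - y)).
Context (c'_hb : c' hub b = al * (1 - x) * c hub b) (c'_bh : c' b hub = c b hub * (1 + x)).

Lemma hub_square v d : (forall w, tadj v w = (w == hub)) ->
  q * sgn d (loop c hub v) * (q * sgn d (loop c hub v)) = 0.
Proof.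
move=> hv; have s0 := leaf_square rel hv.
have e0 : sgn d (loop c hub v) * sgn d (loop c hub v) = 0 by case: (d); rewrite /sgn ?mulrNN.
by rewrite mulrA -(mulrA q) -qc -mulrA -mulrA e0 !mulr0.
Qed.

Let xx : x * x = 0. Proof. exact: hub_square (coordD_a C). Qed.
Let yy : y * y = 0. Proof. exact: hub_square (coordD_b C). Qed.

Lemma hub_z : x + y = q * loop c hub (t h).
Proof. by rewrite hub_rel mulrDr. Qed.

Lemma hub_z_nil : (x + y) ^+ n = 0.
Proof.
rewrite hub_z; apply: nil_mul => //.
exact: (tail_nil_n (coordD_tail C) hn (ltnSn h)).
Qed.

Lemma hub_tau_comm : GRing.comm ((x + y) * (x + y)) x /\ GRing.comm ((x + y) * (x + y)) y.
Proof. by rewrite (square0_sum xx yy); apply: square0_anticomm. Qed.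

Lemma hub_al_comm : GRing.comm al x /\ GRing.comm al y.
Proof.
have [tx ty] := hub_tau_comm.
by split; apply: geo_comm; apply/commr_sym/commrM; apply/commr_sym.
Qed.

Lemma hub_alK : al * (1 - (x + y) * (x + y) * ((x + y) * (x + y))) = 1.
Proof.
have tn : ((x + y) * (x + y)) ^+ n = 0 by rewrite exprMn_comm // hub_z_nil mulr0.
by apply: Kgeo; rewrite exprMn_comm // tn mulr0.
Qed.

Lemma scale_sgn d (u : R) : (q * sgn d u) *+ 4 = sgn d u.
Proof. by rewrite -mulrnAl q4 mul1r. Qed.

Lemma hub_a : sgn e (loop c' hub a) = (al * ((1 + y) * x * (1 - y))) *+ 4.
Proof.
rewrite /loop c'_ha c'_ah -[in RHS]mulrnAr.
have -> : ((1 + y) * x * (1 - y)) *+ 4 = (1 + y) * sgn e (loop c hub a) * (1 - y).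
  by rewrite -mulrnAl -mulrnAr scale_sgn.
by rewrite /loop; case: (e); rewrite /sgn ?mulrN ?mulNr ?mulrN !mulrA.
Qed.

Lemma hub_b : sgn e' (loop c' hub b) = (al * ((1 - x) * y * (1 + x))) *+ 4.
Proof.
rewrite /loop c'_hb c'_bh -[in RHS]mulrnAr.
have -> : ((1 - x) * y * (1 + x)) *+ 4 = (1 - x) * sgn e' (loop c hub b) * (1 + x).
  by rewrite -mulrnAl -mulrnAr scale_sgn.
by rewrite /loop; case: (e'); rewrite /sgn ?mulrN ?mulNr ?mulrN !mulrA.
Qed.

(** The instance of unipotent_product for x = A/4 and y = B/4, up to signs, where A
    and B are the loops at the short legs; it matches the series chosen for the
    tail. *)
Lemma hub_product : loop c' hub (t h) = gl true (sgn e (loop c' hub a)) (sgn e' (loop c' hub b)).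
Proof.
rewrite hub_a hub_b.
have [ax ay] := hub_al_comm.
have gK := geoK hub_z_nil.
have gz : GRing.comm (geo n (x + y)) (x + y) by apply: geo_comm.
rewrite (unipotent_product xx yy ax ay hub_alK gz gK).
rewrite /loop c'_up c'_down mulrA.
rewrite (@repar_intertwine _ n q 2 _ (loop c hub (t h))) /loop ?mulrA //.
rewrite -mulrA -[c hub (t h) * _]/(loop c hub (t h)) /repar -hub_z expr2.
by rewrite -[in LHS](mul1r (loop c _ _)) -q4 mulrnAl -hub_z mulrnAr.
Qed.

(** Apart from its constant term, the series al contains p twice at least, and p
    can be moved next to u or to w. *)
Lemma hub_al_leaf (p r u w : R) : u * p = 0 -> p * w = 0 -> u * w = 0 ->
  (x + y) * (x + y) = p * r + r * p -> GRing.comm al p -> GRing.comm ((x + y) * (x + y)) p ->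
  u * al * w = 0.
Proof.
move=> up pw uw et ap tp; set tau := (x + y) * (x + y) in et tp.
have at' : al * tau = tau * al.
  by have [ax ay] := hub_al_comm; apply: commrM; apply: commrD.
have -> : al = 1 + tau * al * tau.
  rewrite -at' -[X in X + _]hub_alK -/tau; by non_commutative_ring.
transitivity (u * w + (u * tau) * al * tau * w); first by non_commutative_ring.
have ut : u * tau = u * r * p by rewrite et mulrDr !mulrA up mul0r add0r.
rewrite uw add0r ut.
transitivity (u * r * (p * al) * tau * w); first by non_commutative_ring.
rewrite -ap; transitivity (u * r * al * (p * tau) * w); first by non_commutative_ring.
rewrite -tp; transitivity (u * r * al * tau * (p * w)); first by non_commutative_ring.
by rewrite pw mulr0.
Qed.

(** On a short leg, the conjugators cancel in the closed path at the leaf, and the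
    scaling factor, a series in xy + yx, only contributes its constant term. *)
Lemma leaf_deform v d (p r s : R) : (forall w, tadj v w = (w == hub)) ->
  p = q * sgn d (loop c hub v) -> (x + y) * (x + y) = p * r + r * p ->
  GRing.comm al p -> GRing.comm ((x + y) * (x + y)) p ->
  GRing.comm al s -> s * s = 0 ->
  c' hub v = al * (1 + s) * c hub v -> c' v hub = c v hub * (1 - s) ->
  moment lt true v (loop c' v).
Proof.
move=> hv ep et ap tp as' ss e1 e2; apply/(moment_leaf lt true _ hv).
have l0 : c v hub * c hub v = 0 by have /(moment_leaf lt false _ hv) := rel v.
have up : c v hub * p = 0.
  rewrite ep mulrA -qc -mulrA; case: (d); rewrite /sgn ?mulrN /loop (mulrA (c v hub)) l0;
    by rewrite !(mul0r, mulr0, oppr0).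
have pw : p * c hub v = 0.
  rewrite ep -mulrA; case: (d); rewrite /sgn ?mulNr /loop -(mulrA (c hub v)) l0;
    by rewrite !(mul0r, mulr0, oppr0).
rewrite /loop e1 e2.
transitivity (c v hub * ((1 - s) * al * (1 + s)) * c hub v); first by rewrite !mulrA.
have cu : GRing.comm al (1 - s) by apply: commrB; [apply: commr1|].
rewrite -cu; have -> : al * (1 - s) * (1 + s) = al * (1 - s * s) by non_commutative_ring.
by rewrite ss subr0 mulr1 (hub_al_leaf up pw l0 et ap tp).
Qed.

Lemma deform_a : moment lt true a (loop c' a).
Proof.
have [[ax ay] [tx ty]] := (hub_al_comm, hub_tau_comm).
exact: (leaf_deform (coordD_a C) erefl (square0_sum xx yy) ax tx ay yy c'_ha c'_ah).
Qed.

Lemma deform_b : moment lt true b (loop c' b).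
Proof.
have [[ax ay] [tx ty]] := (hub_al_comm, hub_tau_comm).
apply: (leaf_deform (r := x) (s := - x) (coordD_b C) erefl _ ay ty) => //.
- by rewrite (square0_sum xx yy) addrC.
- exact: commrN.
- by rewrite mulrNN xx.
- by rewrite opprK.
Qed.

End DeformHub.
End Deform.

(** * The two algebras in terms of adjacent pairs *)

Section GinzburgSide.
Context (K : fieldType) (T : rootedTree) (lt : childOrder T).
Implicit Types (u v w : T).
Local Notation Q := (ginz_quiver T).
Local Notation P := (pathAlg K Q).
Local Notation e := (fun v => pvert (v : qvert Q) : P).

Definition ginz_dart w v : option (qarr Q) :=
  if insub (w, v) : option (tarrow T) is Some g then Some (inl (inl g)) else
  if insub (v, w) : option (tarrow T) is Some g then Some (inl (inr g)) else None.

Definition ginz_c w v : P := if ginz_dart w v is Some a then parr a else 0.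

Lemma ginz_dartP w v a : ginz_dart w v = Some a ->
  [/\ qtgt a = w, qsrc a = v & ginz_deg a = 0].
Proof.
rewrite /ginz_dart; case: insubP => [g _ e1 [<-]|_]; first by rewrite /= e1.
by case: insubP => [g _ e1 [<-]|//]; rewrite /= e1.
Qed.

Lemma ginz_dartK (a : qarr Q) : ginz_deg a == 0 -> ginz_dart (qtgt a) (qsrc a) = Some a.
Proof.
case: a => [[g|g]|v] //= _; rewrite /ginz_dart /=.
  by rewrite -surjective_pairing valK.
case: insubP => [g' /= h _|_]; first by rewrite (negPf (away_asym (valP g))) in h.
by rewrite -surjective_pairing valK.
Qed.

Lemma ginz_dart_adj w v : tadj v w -> ginz_dart w v.
Proof.
rewrite /ginz_dart; case: insubP => [//|/= n1]; case: insubP => [//|/= n2].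
by case/away_total => h; rewrite h in n1 n2.
Qed.

Lemma ginz_c_adj w v : ~~ tadj v w -> ginz_c w v = 0.
Proof.
rewrite /ginz_c /ginz_dart; case: insubP => [g h _ /negP[]|_]; first exact: away_adj h.
by case: insubP => [g h _ /negP[]|//]; rewrite tadj_sym; apply: away_adj h.
Qed.

Lemma ginz_c_tgt w v : e w * ginz_c w v = ginz_c w v.
Proof.
rewrite /ginz_c; case E: (ginz_dart w v) => [a|]; last by rewrite mulr0.
by have [<- _ _] := ginz_dartP E; rewrite pvert_arr.
Qed.

Lemma ginz_c_src w v : ginz_c w v * e v = ginz_c w v.
Proof.
rewrite /ginz_c; case E: (ginz_dart w v) => [a|]; last by rewrite mul0r.
by have [_ <- _] := ginz_dartP E; rewrite parr_vert.
Qed.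

Lemma ginz_c_homog w v : phomog (@ginz_deg T) 0 (ginz_c w v).
Proof.
rewrite /ginz_c; case E: (ginz_dart w v) => [a|]; last exact: phomog0.
by have [_ _ <-] := ginz_dartP E; apply: phomog_arr.
Qed.

Lemma ginz_c_lenf w v : lenf 1 (ginz_c w v).
Proof.
rewrite /ginz_c; case: (ginz_dart w v) => [a|]; last exact: fil0.
exact: (fil_arr K (fun=> 1%N) a).
Qed.

Lemma ginz_g_c (g : tarrow T) : ginz_g K g = ginz_c (val g).1 (val g).2.
Proof. by rewrite /ginz_c /ginz_dart -surjective_pairing valK. Qed.

Lemma ginz_gs_c (g : tarrow T) : ginz_gs K g = ginz_c (val g).2 (val g).1.
Proof.
rewrite /ginz_c; have := @ginz_dartK (inl (inr g)) isT; rewrite /=.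
by move=> ->.
Qed.

(** An edge contributes g^* g at its upper vertex and - g g^* at its lower one. *)
Lemma ginz_dhE v : e v * ginz_dh K T * e v =
  \sum_(w | away v w) ginz_c v w * ginz_c w v - \sum_(u | away u v) ginz_c v u * ginz_c u v.
Proof.
pose F (p : T * T) := ginz_c p.2 p.1 * ginz_c p.1 p.2 - ginz_c p.1 p.2 * ginz_c p.2 p.1.
have -> : ginz_dh K T = \sum_w \sum_(u | away u w) F (w, u).
  rewrite pair_big_dep /= /ginz_dh.
  rewrite (reindex_omap (val : tarrow T -> T * T) insub) /=; last first.
    by move=> p hp; rewrite insubT.
  apply: eq_big => [g|g _]; first by rewrite valK eqxx andbT (valP g).
  by rewrite -surjective_pairing ginz_gs_c ginz_g_c.
have L u x y : e v * (ginz_c u x * y * ginz_c x u) * e v =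
    if u == v then ginz_c u x * y * ginz_c x u else 0.
  have [->|ne] := eqVneq u v; first by rewrite !mulrA ginz_c_tgt -!mulrA ginz_c_src.
  by rewrite -[ginz_c u x]ginz_c_tgt !mulrA pvertM eq_sym (negPf ne) !mul0r.
have L1 u x : e v * (ginz_c u x * ginz_c x u) * e v = if u == v then ginz_c u x * ginz_c x u else 0.
  by have := L u x 1; rewrite !mulr1.
rewrite mulr_sumr mulr_suml.
transitivity (\sum_w \sum_(u | away u w) ((if u == v then ginz_c u w * ginz_c w u else 0)
   - (if w == v then ginz_c w u * ginz_c u w else 0))).
  apply: eq_bigr => w _; rewrite mulr_sumr mulr_suml; apply: eq_bigr => u _.
  by rewrite /F /= mulrBr mulrBl !L1.
under eq_bigr => w _ do rewrite sumrB.
rewrite sumrB; congr (_ - _); last first.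
  rewrite (bigD1 v) //= [X in _ + X]big1 ?addr0 => [|w /negPf nw].
    by apply: eq_bigr => u _; rewrite eqxx.
  by apply: big1 => u _; rewrite nw.
rewrite (exchange_big_dep predT) //= (bigD1 v) //= [X in _ + X]big1 ?addr0 => [|u /negPf nu].
  by apply: eq_bigr => w _; rewrite eqxx.
by apply: big1 => w _; rewrite nu.
Qed.

Fact ginz_deg01 (a : qarr Q) : (ginz_deg a == 0) || (ginz_deg a == -1).
Proof. by case: a => [[]|]. Qed.

Fact ginz_d_lenf (a : qarr Q) : lenf 1 (ginz_d K a).
Proof.
case: a => [a|v]; first exact: fil0.
rewrite /ginz_d ginz_dhE; apply: filB; apply: fil_sum => w _.
  exact: (fil_le (filM (ginz_c_lenf _ _) (ginz_c_lenf _ _))).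
exact: (fil_le (filM (ginz_c_lenf _ _) (ginz_c_lenf _ _))).
Qed.

Definition ginzH := piH (@ginz_d_tgt K T) (@ginz_d_src K T) (@ginz_d_homog K T) ginz_deg01.

Lemma ginz_c_orth u v w x : v != w -> ginz_c u v * ginz_c w x = 0.
Proof.
move=> ne; rewrite -(ginz_c_src u v) -(ginz_c_tgt w x) -!mulrA [X in _ * X]mulrA.
by rewrite pvertM (negPf ne) mul0r mulr0.
Qed.

Lemma ginz_rel v : moment lt false v (loop (fun w x => ginzH (ginz_c w x)) v).
Proof.
rewrite /moment fold_gl_sum -sum_children.
have := piH_d (@ginz_d_tgt K T) (@ginz_d_src K T) (@ginz_d_homog K T) ginz_deg01
  (parr (inr v : qarr Q)).
rewrite pdiff_arr /ginz_d ginz_dhE -/ginzH rmorphB !rmorph_sum /= => /eqP.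
rewrite subr_eq0 => /eqP; under eq_bigr do rewrite rmorphM.
by under [in RHS]eq_bigr do rewrite rmorphM.
Qed.

End GinzburgSide.

Section LegendrianSide.
Context (K : fieldType) (T : rootedTree) (lt : childOrder T).
Implicit Types (u v w : T).
Local Notation Q := (leg_quiver T).
Local Notation P := (pathAlg K Q).

Lemma leg_c_adj w v : ~~ tadj v w -> leg_c K w v = 0.
Proof. by rewrite /leg_c; case: insubP => //= p h _; rewrite tadj_sym h. Qed.

Lemma leg_c_dart (p : tdart T) : leg_c K (val p).1 (val p).2 = parr (inr p : qarr Q).
Proof. by rewrite /leg_c -surjective_pairing valK. Qed.

Lemma leg_c_lenf w v : lenf 1 (leg_c K w v).
Proof.
rewrite /leg_c; case: insubP => [p _ _|_]; last exact: fil0.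
exact: (fil_arr K (fun=> 1%N) (inr p : qarr Q)).
Qed.

Fact leg_deg01 (a : qarr Q) : (leg_deg a == 0) || (leg_deg a == -1).
Proof. by case: a. Qed.

Definition mult_moment (R : pzRingType) (F : T -> R) v : R :=
  foldr (fun w acc => gl true (F w) acc) 0 (children lt v) - \sum_(u | away u v) F u.

Lemma leg_DcE v : leg_Dc K lt v = mult_moment (fun w => leg_c K v w * leg_c K w v) v.
Proof. by rewrite /leg_Dc leg_sum_fold addrC. Qed.

Lemma mult_moment_morph (R S : pzRingType) (f : {rmorphism R -> S}) (F : T -> R) v :
  f (mult_moment F v) = mult_moment (fun w => f (F w)) v.
Proof.
rewrite /mult_moment rmorphB rmorph_sum; congr (_ - _).
elim: (children lt v) => [|w s IH] /=; first exact: rmorph0.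
by rewrite -IH /gl !mulr1n 2!(rmorphD f) (rmorphM f).
Qed.

Lemma eq_mult_moment (R : pzRingType) (F G : T -> R) v :
  F =1 G -> mult_moment F v = mult_moment G v.
Proof.
move=> e; rewrite /mult_moment; congr (_ - _); last by apply: eq_bigr => u _.
by elim: (children lt v) => //= w s ->; rewrite e.
Qed.

Lemma mult_momentE (R : pzRingType) (F : T -> R) v : mult_moment F v = 0 <-> moment lt true v F.
Proof. by rewrite /mult_moment /moment; split=> [/eqP|->]; rewrite ?subrr // subr_eq0 => /eqP. Qed.

Lemma mult_moment_lenf (K' : fieldType) (Q' : quiver) (F : T -> pathAlg K' Q') v k :
  (0 < k)%N -> (forall w, lenf k (F w)) -> lenf k (mult_moment F v).
Proof.
move=> k0 hF; apply: filB; last by apply: fil_sum => u _; apply: hF.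
elim: (children lt v) => [|w s IH] /=; first exact: fil0.
rewrite /gl mulr1n; apply: filD; first by apply: filD; first apply: hF.
by apply: (fil_le (filM (hF w) IH)); lia.
Qed.

Fact leg_d_lenf (a : qarr Q) : lenf 1 (leg_d K lt a).
Proof.
case: a => [v|p]; last exact: fil0.
rewrite /leg_d leg_DcE; apply: mult_moment_lenf => // w.
exact: (fil_le (filM (leg_c_lenf _ _) (leg_c_lenf _ _))).
Qed.

Definition legH := piH (@leg_d_tgt K T lt) (@leg_d_src K T lt) (@leg_d_homog K T lt) leg_deg01.

Lemma leg_rel v : moment lt true v (loop (fun w x => legH (leg_c K w x)) v).
Proof.
apply/mult_momentE; rewrite /loop.
rewrite -(eq_mult_moment v (fun w => rmorphM legH (leg_c K v w) (leg_c K w v))).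
rewrite -mult_moment_morph -leg_DcE.
have := piH_d (@leg_d_tgt K T lt) (@leg_d_src K T lt) (@leg_d_homog K T lt) leg_deg01
  (parr (inl v : qarr Q)).
by rewrite pdiff_arr.
Qed.

Lemma leg_c_orth u v w x : v != w -> leg_c K u v * leg_c K w x = 0.
Proof.
move=> ne; rewrite -(leg_c_src K u v) -(leg_c_tgt K w x) -!mulrA [X in _ * X]mulrA.
by rewrite pvertM (negPf ne) mul0r mulr0.
Qed.

End LegendrianSide.

(** * The change of arrows *)

Section ChangeOfArrows.
Context (T : rootedTree) (R : pzRingType) (c : T -> T -> R) (n : nat) (q : R).

(** The position along the tail; vertices off the tail have position h.+1. *)
Definition tail_pos (h : nat) (t : nat -> T) (w : T) : nat :=
  index w [seq t i | i <- iota 0 h.+1].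

(** Of the two arrows of an edge of the tail, only the one that points to its end
    is modified. *)
Definition tail_factor h t (m : nat -> nat) w v : R :=
  if (tail_pos h t v == (tail_pos h t w).+1) && (tail_pos h t v <= h)%N
  then repar n q (m (tail_pos h t w)) (loop c w v) else 1.

Lemma tail_posE h (t : nat -> T) i : tail h t -> (i <= h)%N -> tail_pos h t (t i) = i.
Proof.
move=> ht ih; rewrite /tail_pos.
have si : (i < size [seq t j | j <- iota 0 h.+1])%N by rewrite size_map size_iota ltnS.
have ei : t i = nth (t 0%N) [seq t j | j <- iota 0 h.+1] i.
  by rewrite (nth_map 0%N) ?size_iota // nth_iota.
rewrite {1}ei index_uniq // map_inj_in_uniq ?iota_uniq // => j k.
by rewrite !mem_iota /= !add0n !ltnS; apply: (tail_inj ht).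
Qed.

Definition hub_loop hub e a : R := q * sgn e (loop c hub a).

Definition hub_scale hub e a e' b : R :=
  let z := hub_loop hub e a + hub_loop hub e' b in geo n (z * z * (z * z)).

(** On the short legs the factors are those of unipotent_product, with 1 + y and
    its inverse 1 - y distributed over the two arrows of the leg a, and 1 - x and
    1 + x over those of the leg b. *)
Definition left_factor h t (a b : T) e e' w v : R :=
  let hub := t h.+1 in
  if (w == hub) && (v == a) then hub_scale hub e a e' b * (1 + hub_loop hub e' b) else
  if (w == hub) && (v == b) then hub_scale hub e a e' b * (1 - hub_loop hub e a) else
  tail_factor h.+1 t (fun=> 2) w v.

Definition right_factor h t (a b : T) e e' w v : R :=
  let hub := t h.+1 in
  if (w == a) && (v == hub) then 1 - hub_loop hub e' b else
  if (w == b) && (v == hub) then 1 + hub_loop hub e a else 1.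

End ChangeOfArrows.

Section Morph.
Context (R S : pzRingType) (f : {rmorphism R -> S}).

Lemma rmorph_geo n x : f (geo n x) = geo n (f x).
Proof. by rewrite /geo rmorph_sum; apply: eq_bigr => i _; rewrite rmorphXn. Qed.

Lemma rmorph_repar n q m x : f (repar n q m x) = repar n (f q) m (f x).
Proof. by rewrite /repar rmorphXn /= rmorph_geo rmorphM. Qed.

Lemma rmorph_sgn e x : f (sgn e x) = sgn e (f x).
Proof. by case: e => //=; rewrite rmorphN. Qed.

Lemma rmorph_hub_loop (T : rootedTree) (c : T -> T -> R) q hub e a :
  f (hub_loop c q hub e a) = hub_loop (fun w v => f (c w v)) (f q) hub e a.
Proof. by rewrite /hub_loop rmorphM rmorph_sgn /loop rmorphM. Qed.

Lemma rmorph_hub_scale (T : rootedTree) (c : T -> T -> R) n q hub e a e' b :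
  f (hub_scale c n q hub e a e' b) = hub_scale (fun w v => f (c w v)) n (f q) hub e a e' b.
Proof. by rewrite /hub_scale rmorph_geo !rmorphM !rmorphD !rmorph_hub_loop. Qed.

Lemma rmorph_tail_factor (T : rootedTree) (c : T -> T -> R) n q h t m w v :
  f (tail_factor c n q h t m w v) = tail_factor (fun w v => f (c w v)) n (f q) h t m w v.
Proof.
by rewrite /tail_factor; case: ifP => _; rewrite ?rmorph1 // rmorph_repar /loop rmorphM.
Qed.

End Morph.

Section Existence.
Context (K : fieldType) (T : rootedTree) (lt : childOrder T).
Implicit Types (u v w : T).
Local Notation Q := (ginz_quiver T).
Local Notation P := (pathAlg K Q).
Local Notation e := (fun v => pvert (v : qvert Q) : P).
Local Notation homog := (phomog (@ginz_deg T)).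
Local Notation g := (@ginz_c K T).
Local Notation pi := (@ginzH K T).
Local Notation HG :=
  (H0 (@ginz_d_tgt K T) (@ginz_d_src K T) (@ginz_d_homog K T) (@ginz_deg01 T)).

(** What a homomorphism from the Legendrian algebra must do on the arrows of
    degree 0, in order to extend over the loops and to be the identity to first
    order. *)
Record deformation (phi : T -> T -> P) : Prop := Deformation {
  deformation_homog : forall w v, homog 0 (phi w v);
  deformation_lenf : forall w v, lenf 2 (phi w v - g w v);
  deformation_tgt : forall w v, e w * phi w v = phi w v;
  deformation_src : forall w v, phi w v * e v = phi w v;
  deformation_moment : forall v, moment lt true v (loop (fun w x => pi (phi w x)) v) }.

Record small v (x : P) : Prop := Small {
  small_homog : homog 0 x; small_lenf : lenf 1 x; small_comm : GRing.comm (e v) x }.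

(** The factors of the new arrows are 1 plus combinations of closed paths.  As the constant
    term is 1 and not e_v, that they commute with e_v has to be recorded. *)
Record near1 v (x : P) : Prop := Near1 {
  near1_homog : homog 0 x; near1_lenf : lenf 1 (x - 1); near1_comm : GRing.comm (e v) x }.

Lemma homog1 : homog 0 (1 : P).
Proof. by rewrite -pvert_sum; apply: phomog_sum => v _; apply: phomog_vert. Qed.

Lemma smallD v x y : small v x -> small v y -> small v (x + y).
Proof. by case=> ? ? ? [? ? ?]; split; [exact: phomogD|exact: filD|exact: commrD]. Qed.

Lemma smallN v x : small v x -> small v (- x).
Proof.
by case=> h ? ?; split; [rewrite -scaleN1r; exact: phomogZ|exact: filN|exact: commrN].
Qed.

Lemma smallM v x y : small v x -> small v y -> small v (x * y).
Proof.
case=> h1 l1 c1 [h2 l2 c2]; split; [|exact: fil_le (filM l1 l2) _|exact: commrM].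
by rewrite -[0]addr0; apply: phomogM.
Qed.

Lemma smallZ v (k : K) x : small v x -> small v (k%:A * x).
Proof.
case=> h l cm; rewrite mulr_algl; split; [exact: phomogZ|exact: filZ|].
by rewrite /GRing.comm -scalerAr cm scalerAl.
Qed.

Lemma small_sgn v d x : small v x -> small v (sgn d x).
Proof. by case: d => //; apply: smallN. Qed.

Lemma small_loop v w : small v (loop g v w).
Proof.
split; first by rewrite -[0]addr0; apply: phomogM; apply: ginz_c_homog.
  exact: fil_le (filM (ginz_c_lenf _ _ _) (ginz_c_lenf _ _ _)) _.
by rewrite /GRing.comm /loop mulrA ginz_c_tgt -mulrA ginz_c_src.
Qed.

Lemma near11 v : near1 v 1.
Proof. by split; [exact: homog1|rewrite subrr; exact: fil0|exact: commr1]. Qed.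

Lemma near1D v x y : near1 v x -> small v y -> near1 v (x + y).
Proof.
case=> h1 l1 c1 [h2 l2 c2]; split; [exact: phomogD|rewrite addrAC; exact: filD|exact: commrD].
Qed.

Lemma near1M v x y : near1 v x -> near1 v y -> near1 v (x * y).
Proof.
case=> h1 l1 c1 [h2 l2 c2]; split; [by rewrite -[0]addr0; apply: phomogM| |exact: commrM].
have -> : x * y - 1 = (x - 1) * y + (y - 1) by rewrite mulrBl mul1r addrA subrK.
apply: filD => //; exact: (filM l1 (filT _ y)).
Qed.

Lemma near1X v x k : near1 v x -> near1 v (x ^+ k).
Proof.
move=> h; elim: k => [|k IH]; first exact: near11.
by rewrite exprS; apply: near1M.
Qed.

Lemma near1_geo v n x : small v x -> near1 v (geo n.+1 x).
Proof.
move=> h; elim: n => [|n IH].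
  by rewrite /geo big_ord_recr big_ord0 /= add0r; apply: near11.
rewrite /geo big_ord_recr /= -/(geo _ _); apply: near1D => //.
elim: n {IH} => [|n IH]; first by rewrite expr1.
by rewrite exprS; apply: smallM.
Qed.

Lemma near1_repar v n (k : K) m x : small v x -> near1 v (repar n.+1 k%:A m x).
Proof. by move=> h; apply: near1X; apply: near1_geo; apply: smallZ. Qed.

Lemma near1_tail_factor n (k : K) h t m w v : near1 w (tail_factor g n.+1 k%:A h t m w v).
Proof.
rewrite /tail_factor; case: ifP => _; last exact: near11.
by apply: near1_repar; apply: small_loop.
Qed.

Lemma deformation_near1 (l r : T -> T -> P) :
  (forall w v, near1 w (l w v)) -> (forall w v, near1 v (r w v)) ->
  (forall v, moment lt true v (loop (fun w x => pi (l w x * g w x * r w x)) v)) ->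
  deformation (fun w v => l w v * g w v * r w v).
Proof.
move=> hl hr hm; split=> // w v; have [h1 l1 c1] := hl w v; have [h2 l2 c2] := hr w v.
- rewrite -[0]addr0; apply: phomogM => //; rewrite -[0]addr0; apply: phomogM => //.
  exact: ginz_c_homog.
- have -> : l w v * g w v * r w v - g w v
      = (l w v - 1) * (g w v * r w v) + g w v * (r w v - 1).
    by rewrite mulrBl mulrBr mul1r mulr1 addrA subrK mulrA.
  apply: filD; last exact: (filM (ginz_c_lenf K w v) l2).
  exact: (filM l1 (filM (ginz_c_lenf K w v) (filT _ (r w v)))).
- by rewrite !mulrA c1 -(mulrA (l w v)) ginz_c_tgt.
by rewrite -mulrA -c2 mulrA -(mulrA (l w v)) ginz_c_src.
Qed.

Lemma pi_scale (k : K) x : GRing.comm (pi k%:A) x.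
Proof. exact/commr_sym/piH_scale. Qed.

Lemma eq_moment k v (R : pzRingType) (F G : T -> R) : F =1 G ->
  moment lt k v F -> moment lt k v G.
Proof.
move=> e h; rewrite /moment -(eq_bigr _ (fun u _ => e u)) -h.
by elim: (children lt v) => //= w s ->; rewrite e.
Qed.

(** The series is x/(1 - x) for the edges before the root, and x after it; at the
    root, where the two meet, they are inverse to each other. *)
Lemma coordA_deformation h t : coordA h (t : nat -> T) -> (exists2 r, (r <= h)%N & troot T = t r) ->
  exists phi, deformation phi.
Proof.
move=> C [r rh er]; have ht := coordA_tail C.
pose m i : nat := (i < r)%N; pose n := h.+1.
pose l := tail_factor g n 1%:A h t m.
exists (fun w v => l w v * g w v * 1); apply: (@deformation_near1 l (fun _ _ => 1)) => [w v|w v|].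
- exact: near1_tail_factor.
- exact: near11.
pose c w v := pi (g w v); pose c' w v := pi (l w v * g w v * 1).
have rel := ginz_rel K lt.
have q1 : pi 1%:A = 1 by rewrite scale1r rmorph1.
have up i : (i < h)%N ->
    c' (t i) (t i.+1) = repar n 1 (m i) (loop c (t i) (t i.+1)) * c (t i) (t i.+1).
  move=> ih; rewrite /c' mulr1 rmorphM /= rmorph_tail_factor q1 /tail_factor.
  by rewrite !tail_posE ?eqxx ?ih // ltnW.
have down i : (i < h)%N -> c' (t i.+1) (t i) = c (t i.+1) (t i).
  move=> ih; rewrite /c' mulr1 rmorphM /= rmorph_tail_factor /tail_factor.
  by rewrite !tail_posE ?(ltnW ih) // ltn_eqF ?mul1r // ltnW.
have comm1 (x : HG) : GRing.comm 1 x by apply/commr_sym/commr1.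
have tailm := deform_tail (c' := c') rel ht (ltnSn h) comm1 up down.
move=> v; have [i ih ->] := coordA_cover C v; move: ih; rewrite leq_eqVlt => /orP[/eqP ->|ih].
  have [h0|h0] := posnP h.
    by apply: moment_isolated => w; rewrite (coordA_top C) h0.
  have eh : h = h.-1.+1 by rewrite prednK.
  have top w : tadj (t h) w = (w == t h.-1) by rewrite (coordA_top C) h0.
  apply/(moment_leaf lt true _ top).
  have l0 : loop c (t h) (t h.-1) = 0 by apply/(moment_leaf lt false _ top)/rel.
  have hp : (h.-1 < h)%N by rewrite {2}eh.
  have := deform_down (c := c) (c' := c') comm1 up down hp.
  by rewrite -eh l0 mulr0.
apply: tailm => // j jh; rewrite /m => ne.
  have : j.+1 <> r by move=> e1; apply: ne; rewrite er e1.
  by case: ltngtP => //; case: ltngtP => //; lia.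
have ej : j.+1 = r by apply: (tail_inj ht) => //; [exact: ltnW | rewrite ne er].
rewrite ej ltnn -ej ltnSn; exact: opposite_repar10.
Qed.

(** The series is x/(1 - x/4)^2 all along the tail, whatever the position of the
    root. *)
Lemma coordD_deformation h t a b : coordD h (t : nat -> T) a b -> 2%N \notin [pchar K] ->
  exists phi, deformation phi.
Proof.
move=> C0 ch2; pose hub := t h.+1.
have [a' [b' [e1 [e2 [ab rel3]]]]] := moment_three lt (coordD_uniq C0) (coordD_top C0).
have {ab rel3} [C rel3] : coordD h t a' b' /\ forall (R : pzRingType) k (F : T -> R),
    F a' * F a' = 0 -> F b' * F b' = 0 ->
    moment lt k hub F <-> F (t h) = gl k (sgn e1 (F a')) (sgn e2 (F b')).
  case: ab rel3 => -[-> ->] rel3; split=> // [|R k F ha hb]; first exact: coordD_sym.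
  exact: rel3.
move: {C0} C rel3; move: a' b' => {}a {}b C rel3.
have ht := coordD_tail C; pose n := h.+2; pose k : K := 4%:R^-1.
have k4 : k *+ 4 = 1.
  have n2 : 2%:R != 0 :> K by move: ch2; rewrite inE /=.
  by rewrite -mulr_natr /k mulVf // (natrM K 2 2) mulf_neq0.
pose l := left_factor g n k%:A h t a b e1 e2; pose r := right_factor g k%:A h t a b e1 e2.
have small_hub d v : small hub (hub_loop g k%:A hub d v).
  by apply: smallZ; apply: small_sgn; apply: small_loop.
exists (fun w v => l w v * g w v * r w v); apply: deformation_near1 => [w v|w v|].
- rewrite /l /left_factor; case: ifP => [/andP[/eqP -> _]|_].
    apply: near1M; last by apply: near1D => //; apply: near11.
    by apply: near1_geo; do 2?[apply: smallM]; apply: smallD.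
  case: ifP => [/andP[/eqP -> _]|_]; last exact: near1_tail_factor.
  apply: near1M; last by apply: near1D; [apply: near11 | apply: smallN].
  by apply: near1_geo; do 2?[apply: smallM]; apply: smallD.
- rewrite /r /right_factor; case: ifP => [/andP[_ /eqP ->]|_].
    by apply: near1D; [apply: near11 | apply: smallN].
  case: ifP => [/andP[_ /eqP ->]|_]; last exact: near11.
  by apply: near1D; [apply: near11 |].
pose c w v := pi (g w v); pose c' w v := pi (l w v * g w v * r w v).
have rel := ginz_rel K lt; pose q := pi k%:A.
have qc (x : HG) : GRing.comm q x by apply: pi_scale.
have q4 : q *+ 4 = 1 by rewrite -rmorphMn /= scalerMnl k4 scale1r rmorph1.
have ta i : (i <= h.+1)%N -> (t i == a) = false.
  by move=> ih; apply/negbTE; apply: coordD_notin_tail C ih.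
have tb i : (i <= h.+1)%N -> (t i == b) = false.
  by move=> ih; apply/negbTE; apply: coordD_notin_tail (coordD_sym C) ih.
have thub i : (i <= h)%N -> (t i == hub) = false.
  by move=> ih; apply/eqP => /(tail_inj ht) e0; have := e0 (leqW ih) (leqnn _); lia.
have [ah bh] : (a == hub) = false /\ (b == hub) = false.
  by rewrite ![_ == hub]eq_sym ta ?tb.
have nab : (a == b) = false.
  by apply/negbTE; have := coordD_uniq C; rewrite /= !inE negb_or => /andP[/andP[]].
have pos_leaf v : v \in [:: a; b] -> tail_pos h.+1 t v = h.+2.
  move=> hv; rewrite /tail_pos memNindex ?size_map ?size_iota //.
  apply/mapP => -[i]; rewrite mem_iota /= add0n ltnS => ih ev; move: hv.
  by rewrite ev !inE ta // tb.
have tailE m i j : (i <= h.+1)%N -> (j <= h.+1)%N ->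
    tail_factor c n q h.+1 t m (t i) (t j) =
    if j == i.+1 then repar n q (m i) (loop c (t i) (t j)) else 1.
  by move=> ih jh; rewrite /tail_factor !tail_posE // jh andbT.
have up i : (i < h.+1)%N ->
    c' (t i) (t i.+1) = repar n q 2 (loop c (t i) (t i.+1)) * c (t i) (t i.+1).
  move=> ih; rewrite /c' /l /left_factor /r /right_factor !ta ?tb ?(ltnW ih) //= mulr1.
  by rewrite !andbF rmorphM rmorph_tail_factor tailE ?eqxx // ltnW.
have down i : (i < h.+1)%N -> c' (t i.+1) (t i) = c (t i.+1) (t i).
  move=> ih; rewrite /c' /l /left_factor /r /right_factor !ta ?tb ?(ltnW ih) //= mulr1.
  by rewrite !andbF rmorphM rmorph_tail_factor tailE ?(ltnW ih) // ltn_eqF ?mul1r // leqnSn.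
have hubE v : v \in [:: a; b] -> tail_factor g n k%:A h.+1 t (fun=> 2) v hub = 1.
  move=> hv; by rewrite /tail_factor (pos_leaf v hv) /hub tail_posE // ltn_eqF.
have ha : c' hub a = hub_scale c n q hub e1 a e2 b * (1 + hub_loop c q hub e2 b) * c hub a.
  rewrite /c' /l /left_factor /r /right_factor -/hub !eqxx ![hub == _]eq_sym ah bh /= mulr1.
  by rewrite !rmorphM rmorph_hub_scale rmorphD rmorph1 rmorph_hub_loop.
have hb : c' hub b = hub_scale c n q hub e1 a e2 b * (1 - hub_loop c q hub e1 a) * c hub b.
  rewrite /c' /l /left_factor /r /right_factor -/hub !eqxx ![hub == _]eq_sym ah bh /= mulr1.
  by rewrite [b == a]eq_sym nab !rmorphM rmorph_hub_scale rmorphB rmorph1 rmorph_hub_loop.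
have a_h : c' a hub = c a hub * (1 - hub_loop c q hub e2 b).
  rewrite /c' /l /left_factor /r /right_factor -/hub !eqxx ah /= hubE ?mem_head // mul1r.
  by rewrite rmorphM rmorphB rmorph1 rmorph_hub_loop.
have b_h : c' b hub = c b hub * (1 + hub_loop c q hub e1 a).
  rewrite /c' /l /left_factor /r /right_factor -/hub !eqxx bh [b == a]eq_sym nab /=.
  rewrite hubE ?inE ?eqxx ?orbT // mul1r.
  by rewrite rmorphM rmorphD rmorph1 rmorph_hub_loop.
have hub_rel : loop c hub (t h) = sgn e1 (loop c hub a) + sgn e2 (loop c hub b).
  have /rel3 : moment lt false hub (loop c hub) := rel hub.
  rewrite /gl mulr0n addr0; apply.
    exact: (leaf_square rel (coordD_a C)).
  exact: (leaf_square rel (coordD_b C)).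
have ma := deform_a (c' := c') rel C (ltnSn _) qc hub_rel ha a_h.
have mb := deform_b (c' := c') rel C (ltnSn _) qc hub_rel hb b_h.
move=> v; case: (coordD_cover C v) => [->|[->|[i ih ->]]] //.
move: ih; rewrite leq_eqVlt => /orP[/eqP ->|ih].
  have sq u : (forall w, tadj u w = (w == hub)) -> moment lt true u (loop c' u) ->
      loop c' hub u * loop c' hub u = 0.
    by move=> hu /(moment_leaf lt true _ hu) e0; rewrite -expr2 loopX expr1 e0 mulr0 mul0r.
  apply/rel3; [exact: sq (coordD_a C) ma|exact: sq (coordD_b C) mb|].
  exact: (hub_product (c' := c') rel C (ltnSn _) qc q4 hub_rel
    (down _ (ltnSn h)) (up _ (ltnSn h)) ha a_h hb b_h).
apply: (deform_tail (c' := c') rel ht (ltnSn _) qc (m := fun=> 2) up down) => // j _ _.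
exact: opposite_repar22.
Qed.

End Existence.

(** * Homomorphisms and path length *)

Section FilteredHom.
Context (K : fieldType).

Lemma pext_lenf (Q Q' : quiver) (r : pathRep Q (pathAlg K Q')) :
  (forall a, lenf 1 (rep_a r a)) -> forall k x, lenf k x -> lenf k (pext r x).
Proof.
move=> ra k; apply: fil_ind => [c x y e e'||p].
- by rewrite linearP; apply: filL.
- by rewrite linear0; apply: fil0.
rewrite sum1_size pext_base => kp; apply: fil_le _ kp.
suff h : lenf (size (pword p)) (rep_w r (pword p)) by exact: (filM (filT _ (rep_v r _)) h).
rewrite /rep_w; elim: (pword p) => [|a s IH]; first exact: filT.
by rewrite big_cons; exact: (filM (ra a) IH).
Qed.

(** Telescoping along a word, one letter at a time. *)
Lemma near_identity (Q : quiver) (E : {lrmorphism pathAlg K Q -> pathAlg K Q}) :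
  (forall v, E (pvert v) = pvert v) -> (forall a, lenf 2 (E (parr a) - parr a)) ->
  forall k x, lenf k x -> lenf k.+1 (E x - x).
Proof.
move=> Ev Ea k; apply: fil_ind => [c x y e e'||p].
- have -> : E (c *: x + y) - (c *: x + y) = c *: (E x - x) + (E y - y).
    by rewrite linearP /= opprD addrACA scalerBr.
  exact: filL.
- by rewrite linear0 subr0; apply: fil0.
rewrite sum1_size => kp; apply: (@fil_le _ _ _ (size (pword p)).+1); last by [].
have Es s : lenf (size s) (E (wprod K s)) /\ lenf (size s).+1 (E (wprod K s) - wprod K s).
  elim: s => [|a s [IH1 IH2]].
    by rewrite /wprod big_nil rmorph1 subrr; split; [apply: filT | apply: fil0].
  have ea : lenf 1 (E (parr a)).
    rewrite -[E _](subrK (parr a)); apply: filD; first exact: fil_le (Ea a) _.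
    exact: (fil_arr K (fun=> 1%N) a).
  rewrite /wprod big_cons -/(wprod K s) rmorphM; split; first exact: (filM ea IH1).
  have -> : E (parr a) * E (wprod K s) - parr a * wprod K s =
      (E (parr a) - parr a) * E (wprod K s) + parr a * (E (wprod K s) - wprod K s).
    by rewrite mulrBl mulrBr addrA subrK.
  apply: filD; first exact: (filM (Ea a) IH1).
  exact: (filM (fil_arr K (fun=> 1%N) a) IH2).
rewrite pbaseE rmorphM /= Ev -mulrBr.
exact: (filM (filT _ (pvert _)) (proj2 (Es (pword p)))).
Qed.

End FilteredHom.

(** * Long words are exact *)

Section LongWords.
Context (K : fieldType) (Q : quiver) (deg : qarr Q -> int).
Context (d0 : qarr Q -> pathAlg K Q).
Context (d0_tgt : forall a, pvert (qtgt a) * d0 a = d0 a).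
Context (d0_src : forall a, d0 a * pvert (qsrc a) = d0 a).
Context (d0_homog : forall a, phomog deg (deg a + 1) (d0 a)).
Context (deg01 : forall a, (deg a == 0) || (deg a == -1)).
Context (T : rootedTree) (tgt src : qarr Q -> T) (c : T -> T -> pathAlg K Q).
Context (c_arr : forall a, deg a == 0 -> parr a = c (tgt a) (src a)).
Local Notation pi := (piH d0_tgt d0_src d0_homog deg01).

Lemma words_exact : Ann (fun w v => pi (c w v)) 1 ->
  exists N, forall s, all (fun a => deg a == 0) s -> size s = N ->
  exists2 y, phomog deg (-1) y & pdiff deg d0 y = wprod K s.
Proof.
move=> [N hN]; exists N => s s0 sN.
apply: (piH_eq0 (d0_homog := d0_homog) (deg01 := deg01) (d0_tgt := d0_tgt) (d0_src := d0_src)).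
  exact: word_homog0.
have := hN [seq (tgt a, src a) | a <- s]; rewrite size_map mulr1 => /(_ sN) <-.
rewrite /dart_prod big_map /wprod rmorph_prod /= !big_seq; apply: eq_bigr => a /(allP s0) ha.
by rewrite c_arr.
Qed.

End LongWords.

Section Assembly.
Context (K : fieldType) (T : rootedTree) (lt : childOrder T).
Implicit Types (u v w : T).
Local Notation QG := (ginz_quiver T).
Local Notation QL := (leg_quiver T).
Local Notation G := (pathAlg K QG).
Local Notation L := (pathAlg K QL).

Definition dynkin_coords : Prop :=
  (exists h (t : nat -> T), coordA h t) \/ (exists h (t : nat -> T) a b, coordD h t a b).

Lemma dynkin_Ann (R : pzRingType) (c : T -> T -> R) k : dynkin_coords ->
  (forall u v w x, v != w -> c u v * c w x = 0) -> (forall u v, ~~ tadj v u -> c u v = 0) ->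
  (forall v, moment lt k v (loop c v)) -> forall v y, at_vertex c v y -> Ann c y.
Proof.
case=> [[h [t C]]|[h [t [a [b C]]]]] orth adj rel; first exact: coordA_Ann orth adj k rel _ _ C.
exact: coordD_Ann orth adj k rel _ _ _ _ C.
Qed.

Lemma Ann_1 (R : pzRingType) (c : T -> T -> R) (e : T -> R) :
  \sum_v e v = 1 -> (forall u w v, w != v -> c u w * e v = 0) ->
  (forall v y, at_vertex c v y -> Ann c y) -> Ann c 1.
Proof.
move=> <- h H; elim/big_ind: _ => [||v _]; first exact: Ann0.
  by move=> x y; apply: AnnD.
by apply: (H v) => u w n; apply: h.
Qed.

Lemma ginz_long_exact : dynkin_coords -> exists N, forall s,
  all (fun a => @ginz_deg T a == 0) s -> size s = N ->
  exists2 y, phomog (@ginz_deg T) (-1) y & pdiff (@ginz_deg T) (@ginz_d K T) y = wprod K s.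
Proof.
move=> D; apply: (words_exact (tgt := @qtgt QG) (src := @qsrc QG) (c := @ginz_c K T)
   (d0_tgt := @ginz_d_tgt K T) (d0_src := @ginz_d_src K T) (d0_homog := @ginz_d_homog K T)
   (deg01 := @ginz_deg01 T)).
  by move=> a ha; rewrite /ginz_c ginz_dartK.
apply: (Ann_1 (e := fun v => ginzH K T (pvert (v : qvert QG)))).
- by rewrite -rmorph_sum pvert_sum rmorph1.
- move=> u w v nwv; rewrite -rmorphM -(ginz_c_src K u w) -mulrA pvertM (negPf nwv).
  by rewrite mulr0 rmorph0.
apply: (dynkin_Ann D _ _ (ginz_rel K lt)).
- by move=> u v w x n; rewrite -rmorphM ginz_c_orth // rmorph0.
- by move=> u v n; rewrite ginz_c_adj // rmorph0.
Qed.

Lemma leg_long_exact : dynkin_coords -> exists N, forall s,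
  all (fun a => @leg_deg T a == 0) s -> size s = N ->
  exists2 y, phomog (@leg_deg T) (-1) y & pdiff (@leg_deg T) (@leg_d K T lt) y = wprod K s.
Proof.
move=> D; apply: (words_exact (tgt := @qtgt QL) (src := @qsrc QL) (c := @leg_c K T)
   (d0_tgt := @leg_d_tgt K T lt) (d0_src := @leg_d_src K T lt) (d0_homog := @leg_d_homog K T lt)
   (deg01 := @leg_deg01 T)).
  by case=> // p _; rewrite leg_c_dart.
apply: (Ann_1 (e := fun v => legH K lt (pvert (v : qvert QL)))).
- by rewrite -rmorph_sum pvert_sum rmorph1.
- move=> u w v nwv; rewrite -rmorphM -(leg_c_src K u w) -mulrA pvertM (negPf nwv).
  by rewrite mulr0 rmorph0.
apply: (dynkin_Ann D _ _ (leg_rel K lt)).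
- by move=> u v w x n; rewrite -rmorphM leg_c_orth // rmorph0.
- by move=> u v n; rewrite leg_c_adj // rmorph0.
Qed.

(** * The quasi-isomorphism *)

Context (phi : T -> T -> G) (D : deformation lt phi).

Definition new_moment v : G := mult_moment lt (fun w => phi v w * phi w v) v.

Lemma phi_lenf w v : lenf 1 (phi w v).
Proof.
rewrite -[phi w v](subrK (ginz_c K w v)); apply: filD; last exact: ginz_c_lenf.
exact: fil_le (deformation_lenf D w v) _.
Qed.

Lemma new_moment_homog v : phomog (@ginz_deg T) 0 (new_moment v).
Proof.
have h w : phomog (@ginz_deg T) 0 (phi v w * phi w v).
  by rewrite -[0]addr0; apply: phomogM; apply: (deformation_homog D).
apply: phomogB; last by apply: phomog_sum => u _; apply: h.
elim: (children lt v) => [|w s IH] /=; first exact: phomog0.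
rewrite /gl mulr1n; apply: phomogD; first exact: phomogD.
by rewrite -[0]addr0; apply: phomogM.
Qed.

Lemma new_moment_exact v : exists2 y, phomog (@ginz_deg T) (-1) y &
  pdiff (@ginz_deg T) (@ginz_d K T) y = new_moment v.
Proof.
apply: (piH_eq0 (d0_tgt := @ginz_d_tgt K T) (d0_src := @ginz_d_src K T)
  (d0_homog := @ginz_d_homog K T) (deg01 := @ginz_deg01 T)); first exact: new_moment_homog.
rewrite -/(ginzH K T) mult_moment_morph; apply/mult_momentE.
apply: (eq_moment _ (deformation_moment D v)) => w.
by rewrite /loop rmorphM.
Qed.

(** The new arrows differ from the old ones by paths of length at least 2, and the
    product terms of the multiplicative moment map have length at least 4. *)
Lemma new_moment_lead v : lenf 3 (new_moment v - ginz_d K (inr v : qarr QG)).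
Proof.
pose F w := phi v w * phi w v; pose F0 w := ginz_c K v w * ginz_c K w v.
have hF w : lenf 3 (F w - F0 w).
  have -> : F w - F0 w = (phi v w - ginz_c K v w) * phi w v
      + ginz_c K v w * (phi w v - ginz_c K w v).
    by rewrite mulrBl mulrBr addrA subrK.
  apply: filD; first exact: (filM (deformation_lenf D v w) (phi_lenf w v)).
  exact: (filM (ginz_c_lenf K v w) (deformation_lenf D w v)).
have lF w : lenf 2 (F w) by exact: (filM (phi_lenf v w) (phi_lenf w v)).
have H s : lenf 1 (foldr (fun w acc => gl true (F w) acc) 0 s) /\
    lenf 3 (foldr (fun w acc => gl true (F w) acc) 0 s - \sum_(w <- s) F0 w).
  elim: s => [|w s [IH1 IH2]] /=; first by rewrite big_nil subr0; split; exact: fil0.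
  have l3 := filM (lF w) IH1.
  have l1 : lenf 1 (F w) by exact: fil_le (lF w) _.
  rewrite /gl mulr1n; split.
    exact: filD (filD l1 IH1) (fil_le l3 _).
  rewrite big_cons addrAC opprD addrACA; exact: filD (filD (hF w) IH2) l3.
rewrite /new_moment /mult_moment /ginz_d ginz_dhE (sum_children lt).
have -> (A B C E : G) : A - B - (C - E) = (A - C) - (B - E).
  by rewrite !opprB addrACA [RHS]addrACA [- B - C]addrC.
apply: filB; first by case: (H (children lt v)).
by rewrite -sumrB; apply: fil_sum => u _; apply: hF.
Qed.

(** The Ginzburg differential raises path length by exactly one; here path
    length is the degree for which all arrows have degree 1. *)
Local Notation len_homog := (phomog (fun=> 1) : int -> pred G).

Lemma len_homogP (k : nat) (x : G) : len_homog k x <-> forall p, x@_p != 0 -> size (pword p) = k.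
Proof.
have e (s : seq (qarr QG)) : wdeg (fun=> 1) s = (size s)%:Z.
  by rewrite /wdeg; elim: s => [|a s IH]; rewrite ?big_nil // big_cons IH.
split=> [/phomogP h p /h|h]; first by rewrite e => -[].
by apply/phomogP => p /h <-.
Qed.

Lemma ginz_d_len (a : qarr QG) : len_homog 2 (ginz_d K a).
Proof.
case: a => [a|v]; first exact: phomog0.
have h w x : len_homog 1 (ginz_c K w x).
  by rewrite /ginz_c; case: ginz_dart => [a|]; [exact: phomog_arr | exact: phomog0].
rewrite /ginz_d ginz_dhE; apply: phomogB; apply: phomog_sum => w _.
  exact: (phomogM (h _ _) (h _ _)).
exact: (phomogM (h _ _) (h _ _)).
Qed.

Definition has_size k (p : qpath QG) : bool := size (pword p) == k.

Lemma pproj_size_d k (x : G) : pproj (has_size k.+1) (pdiff (@ginz_deg T) (@ginz_d K T) x)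
  = pdiff (@ginz_deg T) (@ginz_d K T) (pproj (has_size k) x).
Proof.
elim/path_ind: x => [c x y e1 e2||p]; first by rewrite !linearP /= e1 e2.
  by rewrite !linear0.
have /len_homogP h : len_homog (size (pword p)).+1 (wdiff (@ginz_deg T) (@ginz_d K T) (pword p)).
  elim: (pword p) => [|a s IH] /=; first exact: phomog0.
  have hs : len_homog (size s) (wprod K s).
    have := phomog_word K (fun=> 1) s; congr (is_true (phomog _ _ _)).
    by rewrite /wdeg; elim: (s) => [|b r IHr]; rewrite ?big_nil // big_cons IHr.
  apply: phomogD; first exact: (phomogM (ginz_d_len a) hs).
  by apply: phomogZ; exact: (phomogM (phomog_arr K (fun=> 1) a) IH).
rewrite pproj_base pdiff_base; case: (size (pword p) =P k) => [e1|n1].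
  rewrite /has_size e1 eqxx pdiff_base; apply: pproj_id => q /h ->.
  by rewrite e1.
have -> : has_size k p = false by apply/eqP.
rewrite linear0; apply: pproj_eq0 => q /h; rewrite /has_size => ->.
by rewrite eqSS; apply/eqP.
Qed.

Lemma new_moment_idem v :
  pvert (v : qvert QG) * new_moment v * pvert (v : qvert QG) = new_moment v.
Proof.
pose e : G := pvert (v : qvert QG).
have hF w : e * (phi v w * phi w v) = phi v w * phi w v.
  by rewrite mulrA (deformation_tgt D).
have hF' w : (phi v w * phi w v) * e = phi v w * phi w v.
  by rewrite -mulrA (deformation_src D).
rewrite -/e /new_moment /mult_moment mulrBr mulrBl mulr_sumr mulr_suml; congr (_ - _).
  elim: (children lt v) => [|w s IH] /=; first by rewrite mulr0 mul0r.
  rewrite /gl mulr1n !mulrDr !mulrDl IH hF hF'; congr (_ + _).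
  set z := foldr _ _ _ in IH *; rewrite mulrA hF.
  have ze : z * e = z by rewrite -IH -mulrA pvertM eqxx.
  by rewrite -mulrA ze.
by apply: eq_bigr => w _; rewrite hF hF'.
Qed.

(** The part of length 1 of a filling of the new moment map bounds its leading
    term, which is d h_v.  Replacing that part by h_v gives the image of c_v. *)
Lemma new_loop v : exists y : G,
  [/\ phomog (@ginz_deg T) (-1) y, lenf 2 (y - parr (inr v : qarr QG)),
      pvert (v : qvert QG) * y = y, y * pvert (v : qvert QG) = y &
      pdiff (@ginz_deg T) (@ginz_d K T) y = new_moment v].
Proof.
have [y hy dy] := new_moment_exact v.
pose e : G := pvert (v : qvert QG); pose hv : G := parr (inr v : qarr QG).
pose y1 := pproj (has_size 1) y.
have he : phomog (@ginz_deg T) 0 e by exact: phomog_vert.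
have ee : e * e = e by rewrite pvertM eqxx.
have ehv : e * hv = hv by exact: (pvert_arr K (inr v : qarr QG)).
have hve : hv * e = hv by exact: (parr_vert K (inr v : qarr QG)).
have hy1 : phomog (@ginz_deg T) (-1) y1.
  move/phomogP: hy => hy; apply/phomogP => p; rewrite mcoeff_pproj.
  by case: ifP => [_ /hy|]; rewrite ?eqxx.
have ly1 : lenf 2 (y - y1).
  have /lenfP l1 : lenf 1 y by apply: lenf1_homog hy _.
  apply/lenfP => p; rewrite mcoeffB mcoeff_pproj /has_size.
  case: (size _ =P 1%N) => [_|n1]; first by rewrite subrr eqxx.
  by rewrite subr0 => /l1; move: n1; case: (size _) => [|[]].
have dy1 : pdiff (@ginz_deg T) (@ginz_d K T) y1 = ginz_d K (inr v : qarr QG).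
  rewrite -pproj_size_d dy -[new_moment v](subrK (ginz_d K (inr v : qarr QG))) linearD /=.
  rewrite [X in X + _]pproj_eq0 ?add0r; last first.
    by move=> p /(lenfP _ _ (new_moment_lead v)); rewrite /has_size; case: eqP => // ->.
  have /len_homogP h2 := ginz_d_len (inr v : qarr QG).
  by apply: pproj_id => p /h2 e2; apply/eqP.
have hx : phomog (@ginz_deg T) (-1) (hv + (y - y1)).
  by apply: phomogD; [exact: (phomog_arr K _ (inr v : qarr QG)) | exact: phomogB].
exists (e * (hv + (y - y1)) * e); split.
- rewrite -[-1]addr0; apply: phomogM => //; rewrite -[-1]add0r; exact: phomogM.
- rewrite mulrDr mulrDl ehv hve addrC addKr.
  exact: (filM (filM (filT _ e) ly1) (filT _ e)).
- by rewrite !mulrA ee.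
- by rewrite -!mulrA ee.
have hex : phomog (@ginz_deg T) (-1) (e * (hv + (y - y1))) by rewrite -[-1]add0r; apply: phomogM.
rewrite (leibniz (@ginz_d_tgt K T) (@ginz_d_src K T) _ hex) pdiff_vert mulr0 scaler0 addr0.
rewrite (d_mul0 (@ginz_d_tgt K T) (@ginz_d_src K T) (@ginz_d_homog K T) (@ginz_deg01 T) _ he).
by rewrite linearD linearB /= pdiff_arr dy1 dy addrC subrK new_moment_idem.
Qed.

(** The Legendrian algebra is free on its arrows, so f is determined by its values
    there; j sends each arrow of the Ginzburg algebra to its counterpart and is
    only a homomorphism of algebras. *)
Lemma quasi_iso_of_deformation : dynkin_coords ->
  exists f : dgHom (legendrian K lt) (ginzburg K T), quasi_iso f.
Proof.
move=> DC.
have /fin_all_exists[Y hY] v : exists y : G,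
    [/\ phomog (@ginz_deg T) (-1) y, lenf 2 (y - parr (inr v : qarr QG)),
      pvert (v : qvert QG) * y = y, y * pvert (v : qvert QG) = y &
      pdiff (@ginz_deg T) (@ginz_d K T) y = new_moment v] by exact: new_loop.
pose fa (a : qarr QL) : G :=
  match a : leg_arr T with inl v => Y v | inr p => phi (val p).1 (val p).2 end.
have f_tgt (a : qarr QL) : pvert (qtgt a : qvert QG) * fa a = fa a.
  by case: a => [v|p]; [case: (hY v) | exact: (deformation_tgt D)].
have f_src (a : qarr QL) : fa a * pvert (qsrc a : qvert QG) = fa a.
  by case: a => [v|p]; [case: (hY v) | exact: (deformation_src D)].
pose fr : pathRep QL G := @PathRep K QL G (fun v => pvert (v : qvert QG)) fa
  (@pvertM K QG) (@pvert_sum K QG) f_tgt f_src.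
have f_homog (a : qarr QL) : phomog (@ginz_deg T) (leg_deg a) (fa a).
  by case: a => [v|p]; [case: (hY v) | exact: (deformation_homog D)].
have f_c w v : tadj v w -> pext fr (leg_c K w v) = phi w v.
  move=> a; rewrite /leg_c; case: insubP => [p _ ep|]; last by rewrite /= tadj_sym a.
  by rewrite pext_arr /= ep.
have f_d (a : qarr QL) : pdiff (@ginz_deg T) (@ginz_d K T) (fa a) = pext fr (leg_d K lt a).
  case: a => [v|p] /=; last first.
    rewrite linear0; apply: (d_deg0 (@ginz_d_homog K T) (@ginz_deg01 T)).
    exact: (deformation_homog D).
  have [_ _ _ _ ->] := hY v; rewrite leg_DcE mult_moment_morph.
  rewrite /new_moment /mult_moment.
  have e w : tadj v w -> pext fr (leg_c K v w * leg_c K w v) = phi v w * phi w v.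
    by move=> vw; rewrite rmorphM /= !f_c // tadj_sym.
  congr (_ - _); last by apply: eq_bigr => u uv; apply/esym/e; rewrite tadj_sym; apply: away_adj.
  have : all (away v) (children lt v) by apply/allP => w; rewrite mem_children.
  elim: (children lt v) => //= w s IH /andP[vw hs]; rewrite IH //.
  by congr gl; apply/esym/e/away_adj.
pose f : dgHom (legendrian K lt) (ginzburg K T) := path_dgHom (leg_d_tgt K lt) (leg_d_src K lt)
  (leg_d_homog K lt) (leg_d_closed K lt) (B := ginzburg K T) (r := fr) (fun v => erefl)
  f_homog f_d.
exists f.
pose ja (a : qarr QG) : L := match a : ginz_arr T with
  | inl (inl g) => leg_c K (val g).1 (val g).2
  | inl (inr g) => leg_c K (val g).2 (val g).1
  | inr v => parr (inl v : qarr QL) end.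
have j_tgt (a : qarr QG) : pvert (qtgt a : qvert QL) * ja a = ja a.
  case: a => [[g|g]|v]; [exact: leg_c_tgt|exact: leg_c_tgt|].
  exact: (pvert_arr K (inl v : qarr QL)).
have j_src (a : qarr QG) : ja a * pvert (qsrc a : qvert QL) = ja a.
  case: a => [[g|g]|v]; [exact: leg_c_src|exact: leg_c_src|].
  exact: (parr_vert K (inl v : qarr QL)).
pose jr : pathRep QG L := @PathRep K QG L (fun v => pvert (v : qvert QL)) ja
  (@pvertM K QL) (@pvert_sum K QL) j_tgt j_src.
have j_homog (a : qarr QG) : phomog (@leg_deg T) (ginz_deg a) (ja a).
  case: a => [[g|g]|v]; [exact: leg_c_homog|exact: leg_c_homog|].
  exact: (phomog_arr K _ (inl v : qarr QL)).
have j_c w v : pext jr (ginz_c K w v) = leg_c K w v.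
  have [a|n] := boolP (tadj v w); last by rewrite ginz_c_adj // leg_c_adj // linear0.
  have := ginz_dart_adj a; rewrite /ginz_c /ginz_dart.
  case: insubP => [g _ eg _|_]; first by rewrite pext_arr /= eg.
  by case: insubP => [g _ eg _|_ //]; rewrite pext_arr /= eg.
have ja_lenf (a : qarr QG) : lenf 1 (ja a).
  case: a => [[g|g]|v]; [exact: leg_c_lenf|exact: leg_c_lenf|].
  exact: (fil_arr K (fun=> 1%N) (inl v : qarr QL)).
have fa_lenf (a : qarr QL) : lenf 1 (fa a).
  case: a => [v|p]; last exact: phi_lenf.
  have [hy _ _ _ _] := hY v; exact: lenf1_homog hy _.
have jF := pext_lenf (r := jr) ja_lenf; have fF := pext_lenf (r := fr) fa_lenf.
have jf_arr (a : qarr QL) : lenf 2 (pext jr (pext fr (parr a)) - parr a).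
  rewrite pext_arr; case: a => [v|p] /=.
    have [_ l _ _ _] := hY v; have := jF _ _ l.
    by rewrite linearB /= pext_arr.
  have := jF _ _ (deformation_lenf D (val p).1 (val p).2).
  by rewrite linearB /= j_c leg_c_dart.
have f_lead w v : lenf 2 (pext fr (leg_c K w v) - ginz_c K w v).
  have [a|n] := boolP (tadj v w); first by rewrite f_c //; apply: deformation_lenf D _ _.
  by rewrite ginz_c_adj // leg_c_adj // linear0 subrr; apply: fil0.
have fj_arr (a : qarr QG) : lenf 2 (pext fr (pext jr (parr a)) - parr a).
  rewrite pext_arr; case: a => [[g|g]|v] /=.
  - have := f_lead (val g).1 (val g).2; by rewrite -(ginz_g_c K g).
  - have := f_lead (val g).2 (val g).1; by rewrite -(ginz_gs_c K g).
  - by rewrite pext_arr /=; case: (hY v).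
have jfv (v : qvert QL) : pext jr (pext fr (pvert v)) = pvert v by rewrite !pext_vert.
have fjv (v : qvert QG) : pext fr (pext jr (pvert v)) = pvert v by rewrite !pext_vert.
have jf := near_identity (E := pext jr \o pext fr) jfv jf_arr.
have fj := near_identity (E := pext fr \o pext jr) fjv fj_arr.
have [NL exL] := leg_long_exact DC; have [NG exG] := ginz_long_exact DC.
have dL := deep_exactP (leg_d_tgt K lt) (leg_d_src K lt) (leg_d_homog K lt) (leg_d_closed K lt)
  (@leg_deg01 T) (leg_d_lenf K lt) exL.
have dG := deep_exactP (@ginz_d_tgt K T) (@ginz_d_src K T) (@ginz_d_homog K T) (@ginz_d_closed K T)
  (@ginz_deg01 T) (@ginz_d_lenf K T) exG.
apply: (@filtered_quasi_iso K T (legendrian K lt) (ginzburg K T) f (pext jr)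
  (fun k => lenf k) (fun k => lenf k)).
- by move=> x; apply: filT.
- by move=> x; apply: filT.
- by move=> k x y; apply: filB.
- by move=> k x y; apply: filB.
- by move=> k l x; apply: fil_le.
- by move=> k l x; apply: fil_le.
- by move=> k x; exact: (@d_lenf K QG (@ginz_deg T) (@ginz_d K T) (@ginz_d_lenf K T) k x).
- exact: fF.
- exact: jF.
- move=> i y hy.
  exact: (@pext_homog K QG (@ginz_deg T) (legendrian K lt) jr (fun v => erefl) j_homog i y hy).
- exact: jf.
- exact: fj.
- exact: dL.
- exact: dG.
Qed.

End Assembly.

Lemma dynkin_deformation (K : fieldType) (T : rootedTree) (lt : childOrder T) :
  (exists n : nat, type_A T n) \/ ((exists n : nat, type_D T n) /\ 2%N \notin [pchar K]) ->
  dynkin_coords T /\ exists phi : T -> T -> pathAlg K (ginz_quiver T), deformation lt phi.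
Proof.
case=> [[n /type_A_coord[h [t [C r]]]]|[[n /type_D_coord[h [t [a [b C]]]]] ch2]].
  by split; [left; exists h, t | exact: coordA_deformation C r].
by split; [right; exists h, t, a, b | exact: coordD_deformation C ch2].
Qed.

Theorem theorem1 (K : fieldType) (T : rootedTree) (lt : childOrder T) :
  (exists n : nat, type_A T n) \/
  ((exists n : nat, type_D T n) /\ 2%N \notin [pchar K]%R) ->
  exists f : dgHom (legendrian K lt) (ginzburg K T), quasi_iso f.
Proof.
by move=> /(dynkin_deformation lt)[DC [phi D]]; apply: quasi_iso_of_deformation D DC.
Qed.
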